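(* Let $d \ge 1$, let $t \ge 0$, and let $A$ be an integrable function on $[0,t]$ with values in the real $d\times d$ matrices. Let $Y$ denote the solution of $Y'(\tau) = A(\tau)\,Y(\tau)$, $Y(0)=\mathrm{I}$, on $[0,t]$. If $\int_0^t \|A(\tau)\|_2\,d\tau < \pi$, then the Magnus series $\sum_{n=1}^\infty \Omega_n(t)$ associated with $A$ converges, and its sum $\Omega(t) = \sum_{n=1}^\infty \Omega_n(t)$ satisfies $e^{\Omega(t)} = Y(t)$.
   Context: Here $\mathrm{I}$ is the $d\times d$ identity matrix, $\|\cdot\|_2$ is the matrix norm induced by the Euclidean norm (spectral norm), and $e^{\Omega}$ is the matrix exponential. As $A$ is only assumed integrable, the solution $Y$ is understood in the Carathéodory sense: $Y$ is absolutely continuous and the differential equation holds almost everywhere, i.e. $Y(s) = \mathrm{I} + \int_0^s A(\tau)Y(\tau)\,d\tau$ for $s\in[0,t]$. For square matrices, $\operatorname{ad}_X(Z) = [X,Z] = XZ - ZX$. $B_k$ denote the Bernoulli numbers, $B_0=1$, $B_1=-\tfrac12$, $B_2=\tfrac16$, $B_3=0$, etc. (generating function $\frac{x}{e^x-1} = \sum_{k\ge0} \frac{B_k}{k!}x^k$). The Magnus series is the formal series solution $\Omega = \Omega_1 + \Omega_2 + \Omega_3 + \cdots$, $\Omega(0)=0$, of the equation $$\Omega' = \sum_{k=0}^\infty \frac{B_k}{k!}\operatorname{ad}_\Omega^k(A),$$ where $\Omega_n$ collects the terms homogeneous of degree $n$ in $A$ (so $\Omega_n$ is a sum of $n$-fold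 integrals of $n-1$ nested commutators). Explicitly, for $s \in [0,t]$, $$\Omega_1(s) = \int_0^s A(\tau)\,d\tau,$$ $$\Omega_n(s) = \sum_{k=1}^{n-1} \frac{B_k}{k!} \sum_{\substack{j_1+\cdots+j_k = n-1\\ j_1,\dots,j_k\ge 1}} \int_0^s \operatorname{ad}_{\Omega_{j_1}(\tau)} \operatorname{ad}_{\Omega_{j_2}(\tau)}\cdots \operatorname{ad}_{\Omega_{j_k}(\tau)}\big(A(\tau)\big)\,d\tau \qquad (n\ge 2).$$ The first terms are $$\Omega_1(s) = \int_0^s A(\tau)\,d\tau,\qquad \Omega_2(s) = -\frac12\int_0^s\int_0^{\tau_1}[A(\tau_2),A(\tau_1)]\,d\tau_2\,d\tau_1,$$ $$\Omega_3(s) = \frac14\int_0^s\int_0^{\tau_1}\int_0^{\tau_2}\big[[A(\tau_3),A(\tau_2)],A(\tau_1)\big]\,d\tau_3\,d\tau_2\,d\tau_1 + \frac1{12}\int_0^s\int_0^{\tau_1}\int_0^{\tau_1}\big[A(\tau_3),[A(\tau_2),A(\tau_1)]\big]\,d\tau_3\,d\tau_2\,d\tau_1.$$ Convergence of the Magnus series at $t$ means convergence of the series of matrices $\sum_{n\ge1}\Omega_n(t)$, in which all terms homogeneous of degree $n$ in $A$ are grouped together into the single matrix $\Omega_n(t)$. *)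

(* Defs.v *)
From HB Require Import structures.
From mathcomp Require Import all_boot all_order all_algebra.
From mathcomp Require Import all_classical all_reals all_analysis.
From mathcomp Require Import ring.

Set Implicit Arguments.
Unset Strict Implicit.
Unset Printing Implicit Defensive.
Import Order.TTheory GRing.Theory Num.Theory.
Import numFieldNormedType.Exports.

Local Open Scope classical_set_scope.
Local Open Scope ring_scope.

Section bernoulli_numbers.
Variable R : realType.

(* The identity [x = (\sum_k B_k/k! x^k) (e^x - 1)] of formal power series,
   compared at x^(n+1) and multiplied by (n+1)!, reads
   [\sum_(k <= n) 'C(n.+1, k) B_k = (n == 0)]; it is solved for B_n.
   The first argument [N] is fuel, and any [N >= n] suffices. *)
Fixpoint bernoulli_fuel (N n : nat) : R :=
  ((n == 0)%:R -
   \sum_(k < n) 'C(n.+1, k)%:R * (if N is N'.+1 then bernoulli_fuel N' k else 0))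
  / n.+1%:R.

Definition bernoulli_number (n : nat) : R := bernoulli_fuel n n.

Lemma bernoulli_fuelE (N n : nat) :
  (n <= N)%N -> bernoulli_fuel N n = bernoulli_number n.
Proof.
suff H : forall m N M, (m <= N)%N -> (m <= M)%N ->
    bernoulli_fuel N m = bernoulli_fuel M m by move=> nN; exact: H.
move=> m; elim/ltn_ind: m => m IH [|N'] [|M'].
- by [].
- by rewrite leqn0 => /eqP -> _ /=; rewrite !big_ord0.
- by move=> _; rewrite leqn0 => /eqP -> /=; rewrite !big_ord0.
move=> mN mM /=; congr ((_ - _) / _); apply: eq_bigr => k _; congr (_ * _).
by apply: IH => //; rewrite -ltnS (leq_trans (ltn_ord k)).
Qed.

Lemma bernoulli_number_rec (n : nat) :
  \sum_(k < n.+1) 'C(n.+1, k)%:R * bernoulli_number k = (n == 0)%:R.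
Proof.
rewrite big_ord_recr /= binSn.
have -> : bernoulli_number n = ((n == 0)%:R -
   \sum_(k < n) 'C(n.+1, k)%:R * bernoulli_number k) / n.+1%:R.
  rewrite {1}/bernoulli_number; case: n => [|n] /=.
    by rewrite !big_ord0.
  congr ((_ - _) / _); apply: eq_bigr => k _.
  by rewrite bernoulli_fuelE // -ltnS.
rewrite [n.+1%:R * _]mulrC mulfVK ?pnatr_eq0 //.
by rewrite addrC subrK.
Qed.

(* Coefficient of x^n in the identity
   [(\sum_k B_k/k! x^k) ((e^x - 1)/x) = 1]. *)
Lemma bernoulli_number_gf (n : nat) :
  \sum_(k < n.+1) (bernoulli_number k / k`!%:R) * ((n.+1 - k)`!%:R)^-1
  = (n == 0)%:R.
Proof.
have nz m : m`!%:R != 0 :> R by rewrite pnatr_eq0 -lt0n fact_gt0.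
apply: (mulfI (nz n.+1)); have -> : n.+1`!%:R * (n == 0)%:R = (n == 0)%:R :> R.
  by case: n => [|n]; rewrite /= ?mulr1 ?mulr0.
rewrite -[RHS]bernoulli_number_rec mulr_sumr; apply: eq_bigr => k _.
have kn : (k <= n.+1)%N by exact: ltnW (ltn_ord k).
rewrite -(bin_fact kn) !natrM.
have := nz k; have := nz (n.+1 - k)%N.
by move: (_`!)%:R (_`!)%:R => b a b0 a0; field; rewrite a0 b0.
Qed.

End bernoulli_numbers.

Section matrices.
Variable R : realType.

Definition euclid_norm (n : nat) (v : 'cV[R]_n) : R :=
  Num.sqrt (\sum_i v i 0 ^+ 2).

Definition spectral_norm (n : nat) (M : 'M[R]_n) : R :=
  sup [set euclid_norm (M *m v) | v in [set v | euclid_norm v <= 1]].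

Definition expmx (n : nat) (M : 'M[R]_n) : 'M[R]_n :=
  limn (series (fun k => (k`!%:R)^-1 *: (M ^+ k))).

Definition admx (n : nat) (X Z : 'M[R]_n) : 'M[R]_n := X *m Z - Z *m X.

(* The completed measure is used so that "measurable" and "integrable" are
   meant in the sense of Lebesgue; [lebesgue_measure] is on the Borel sets. *)
Local Notation leb := (@completed_lebesgue_measure R).

Definition mx_integrable (n : nat) (D : set R) (F : R -> 'M[R]_n) : Prop :=
  forall i j, leb.-integrable D (fun x => (F x i j)%:E).

Definition mx_integral (n : nat) (D : set R) (F : R -> 'M[R]_n) : 'M[R]_n :=
  \matrix_(i, j) \int[leb]_(x in D) (F x i j).

(* Requiring that [A *m Y] be integrable excludes the default value of the
   integral; with the integral equation it makes Y absolutely continuous. *)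
Definition caratheodory_solution (n : nat) (t : R) (A Y : R -> 'M[R]_n) : Prop :=
  mx_integrable `[0, t] (fun x => A x *m Y x) /\
  forall s, 0 <= s <= t ->
    Y s = 1%:M + mx_integral `[0, s] (fun x => A x *m Y x).

End matrices.

Section magnus.
Variables (R : realType) (d : nat) (A : R -> 'M[R]_d).

(* The n-th term for n >= 2, in terms of [Om j] with 1 <= j < n. The inner sum
   ranges over the compositions of n-1 in k parts; [foldr] computes
   ad_(Om j_1) (ad_(Om j_2) ( ... (ad_(Om j_k) A))). *)
Definition magnus_step (Om : nat -> R -> 'M[R]_d) (n : nat) (s : R) : 'M[R]_d :=
  \sum_(1 <= k < n) (bernoulli_number R k / k`!%:R) *:
    \sum_(j : k.-tuple 'I_n |
            all (fun i : 'I_n => 0 < i)%N j && (\sum_(i <- j) i == n.-1)%N)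
      mx_integral `[0, s]
        (fun x => foldr (fun i : 'I_n => admx (Om i x)) (A x) j).

(* The first argument [N] is fuel, and any [N >= n] suffices. *)
Fixpoint magnus_fuel (N n : nat) (s : R) : 'M[R]_d :=
  match N, n with
  | _, 0 | 0, _ => 0
  | _, 1 => mx_integral `[0, s] A
  | N'.+1, _ => magnus_step (magnus_fuel N') n s
  end.

Definition magnus_term (n : nat) (s : R) : 'M[R]_d := magnus_fuel n n s.

Lemma magnus_step_eq (Om Om' : nat -> R -> 'M[R]_d) (n : nat) (s : R) :
  (forall j x, (j < n)%N -> Om j x = Om' j x) ->
  magnus_step Om n s = magnus_step Om' n s.
Proof.
move=> OmE; rewrite /magnus_step; apply: eq_bigr => k _; congr (_ *: _).
apply: eq_bigr => j _; congr mx_integral; apply/funext => x.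
by elim: (tval j) => //= i l ->; rewrite OmE.
Qed.

Lemma magnus_fuelE (N n : nat) (s : R) :
  (n <= N)%N -> magnus_fuel N n s = magnus_term n s.
Proof.
suff H : forall m N M s, (m <= N)%N -> (m <= M)%N ->
    magnus_fuel N m s = magnus_fuel M m s by move=> nN; exact: H.
move=> m; elim/ltn_ind: m => -[_ [|N'] [|M'] //|[_ [|N'] [|M'] //|m IH]].
move=> [|N'] [|M'] // s' mN mM /=; apply: magnus_step_eq => j x jm.
by apply: IH => //; rewrite -ltnS (leq_trans jm).
Qed.

Lemma magnus_term1 (s : R) : magnus_term 1 s = mx_integral `[0, s] A.
Proof. by []. Qed.

Lemma magnus_termE (n : nat) (s : R) :
  (2 <= n)%N -> magnus_term n s = magnus_step magnus_term n s.
Proof.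
case: n => [|[|n]] // _; rewrite {1}/magnus_term /=; apply: magnus_step_eq.
by move=> j x jn; exact: (@magnus_fuelE n.+1).
Qed.

End magnus.

(* Main.v *)
(* Let w = ||A||, theta(x) the integral of w over [0, x], L = theta(t) < pi, and let
   Y(x) = sum_k 'X^k Y_k(x) be the formal solution of Y' = 'X A Y, Y(0) = 1. The Bernoulli
   recursion says that exp(sum_n 'X^n Omega_n) = Y, so Omega_n(t) is the coefficient of 'X^n
   in log Y(t), the integral over s in [0, 1] of (Y - 1) (1 + s (Y - 1))^-1. For a real s this
   coefficient is the integral of A T^(n-1) 1 over [0, t], where T = T_s maps u to the
   primitive y of A u such that s y(t) + (1 - s) y(0) = 0. For the squared norm
   int w exp(-2 a theta) |u|^2 with exp(a L) = (1 - s) / s, a Wirtinger inequality for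
   antiperiodic functions bounds the norm of T by L / pi < 1; if a is too large it can be
   replaced by +-pi / L, so the weights stay bounded and the terms Omega_n(t) decay
   geometrically, uniformly in s. All series then converge absolutely at 'X = 1, where
   exp(sum_n Omega_n) = sum_k Y_k is the Picard series of Y(t). *)
Require Import Defs.
From HB Require Import structures.
From mathcomp Require Import all_boot all_order all_algebra.
From mathcomp Require Import all_classical all_reals all_analysis.
From mathcomp Require Import measurable_realfun.
From mathcomp Require Import ring lra zify.

Set Implicit Arguments.
Unset Strict Implicit.
Unset Printing Implicit Defensive.
Import Order.TTheory GRing.Theory Num.Theory.
Import numFieldNormedType.Exports.

Local Open Scope classical_set_scope.
Local Open Scope ring_scope.

(** * Lebesgue integration on an interval *)

(** Bounding the Bernoulli recursion term by term falls short of the constant pi, which is spectral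
    in origin: in arc length, antiperiodic functions on an interval of length L have frequencies
    that are odd multiples of pi / L. Multiplying y by exp(- a theta) makes the condition s y(t) +
    (1 - s) y(0) = 0 antiperiodic, which is where the weight comes from; a is real because s stays
    in [0, 1]. The Wirtinger inequality is obtained by completing a square with a solution of a
    Riccati equation. This uses neither Fourier series nor an inverse of theta, which may be
    constant on intervals. The price is a zero of y at which the branch of the tangent is changed.
    The entries of y have different zeros, so the inequality is scalar, with a multiplier p for each
    entry and a weight common to all of them. Since p occurs on both sides, it disappears when the
    entries are summed and paired through the spectral norm. On the formal side, the coefficients up
    to degree N depend only on truncations at degree N, so polynomials modulo 'X^(N+1) take the
    place of power series. *)

Section basic.
Variable R : realType.
Local Notation leb := (@completed_lebesgue_measure R).
Local Notation cT := (caratheodory_type (@wlength R idfun)^*%mu).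

Definition lmfun (D : set R) (f : R -> R) := @measurable_fun _ _ cT _ D f.

Lemma borel_completed (D : set R) :
  measurable D -> @measurable _ cT D.
Proof. by move=> mD; apply: sub_caratheodory. Qed.

Lemma lmeasurable_itv (i : interval R) : @measurable _ cT [set` i].
Proof. by apply: borel_completed; exact: measurable_itv. Qed.

Lemma borel_measurable_fun (D : set R) (f : R -> R) : measurable D ->
  measurable_fun D f -> lmfun D f.
Proof.
move=> mD mf _ B mB; apply: borel_completed; exact: mf.
Qed.

Lemma lmfunD D f g : lmfun D f -> lmfun D g -> lmfun D (fun x => f x + g x).
Proof. exact: measurable_funD. Qed.
Lemma lmfunM D f g : lmfun D f -> lmfun D g -> lmfun D (fun x => f x * g x).
Proof. exact: measurable_funM. Qed.
Lemma lmfun_norm D f : lmfun D f -> lmfun D (fun x => `|f x|).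
Proof. by move=> mf; apply: measurableT_comp. Qed.
Lemma lmfun_cst D c : lmfun D (fun=> c).
Proof. exact: measurable_cst. Qed.
Lemma lmfun_eq D f g : (forall x, D x -> f x = g x) -> lmfun D f -> lmfun D g.
Proof. by move=> fg; apply: eq_measurable_fun => x; rewrite inE => /fg. Qed.

Lemma leb_itv_oc (a b : R) : a <= b -> leb `]a, b] = (b - a)%:E.
Proof.
move=> ab; rewrite (_ : leb _ = lebesgue_measure `]a, b]) // lebesgue_measure_itv /= lte_fin.
by case: ltgtP ab => // -> _; rewrite subrr.
Qed.

Definition L1 (D : set R) (f : R -> R) := leb.-integrable D (EFin \o f).
Definition bmfun (D : set R) (f : R -> R) :=
  lmfun D f /\ exists M, forall x, D x -> `|f x| <= M.

Section D.
Variable D : set R.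
Hypothesis mD : @measurable _ cT D.

Lemma L1_lmfun f : L1 D f -> lmfun D f.
Proof. by move=> /integrableP[/measurable_EFinP]. Qed.

Lemma L1D f g : L1 D f -> L1 D g -> L1 D (fun x => f x + g x).
Proof. by move=> hf hg; have := integrableD mD hf hg. Qed.

Lemma L1_bm f g : bmfun D f -> L1 D g -> L1 D (fun x => f x * g x).
Proof.
move=> [mf [M hM]] hg; have := integrableMr mD mf _ hg; apply.
exists M; split; first exact: num_real.
by move=> z Mz x Dx; apply: le_trans (hM _ Dx) (ltW Mz).
Qed.
Lemma L1Z c f : L1 D f -> L1 D (fun x => c * f x).
Proof. by move=> hf; have := integrableZl mD c hf. Qed.
Lemma L1_abs f : L1 D f -> L1 D (fun x => `|f x|).
Proof. by move=> hf; have := integrable_abse hf. Qed.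
Lemma L1_le f g : lmfun D f -> L1 D g -> (forall x, D x -> `|f x| <= g x) -> L1 D f.
Proof.
move=> mf hg h; apply: (le_integrable mD _ _ hg); first exact/measurable_EFinP.
by move=> x Dx /=; rewrite lee_fin (le_trans (h x Dx)) // ler_norm.
Qed.
Lemma L1_eq f g : (forall x, D x -> f x = g x) -> L1 D f -> L1 D g.
Proof.
by move=> fg; apply: eq_integrable => // x; rewrite inE /= => /fg ->.
Qed.
Lemma L1_sum (I : Type) (s : seq I) (P : pred I) (f : I -> R -> R) :
  (forall i, P i -> L1 D (f i)) -> L1 D (fun x => \sum_(i <- s | P i) f i x).
Proof.
move=> h; rewrite /L1.
rewrite (_ : _ \o _ = (fun x => \sum_(i <- s | P i) (EFin \o f i) x)%E).
  exact: integrable_sum.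
by apply/funext => x /=; rewrite sumEFin.
Qed.

Lemma bm_cst c : bmfun D (fun=> c).
Proof. by split; [exact: lmfun_cst|exists `|c|]. Qed.
Lemma bmD f g : bmfun D f -> bmfun D g -> bmfun D (fun x => f x + g x).
Proof.
move=> [mf [M hM]] [mg [N hN]]; split; first exact: lmfunD.
by exists (M + N) => x Dx; rewrite (le_trans (ler_normD _ _)) // lerD ?hM ?hN.
Qed.
Lemma bmM f g : bmfun D f -> bmfun D g -> bmfun D (fun x => f x * g x).
Proof.
move=> [mf [M hM]] [mg [N hN]]; split; first exact: lmfunM.
by exists (M * N) => x Dx; rewrite normrM ler_pM ?hM ?hN.
Qed.
Lemma bm_eq f g : (forall x, D x -> f x = g x) -> bmfun D f -> bmfun D g.
Proof.
move=> fg [mf [M hM]]; split; first exact: lmfun_eq mf.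
by exists M => x Dx; rewrite -fg ?hM.
Qed.
Lemma bm_sum (I : Type) (s : seq I) (P : pred I) (f : I -> R -> R) :
  (forall i, P i -> bmfun D (f i)) -> bmfun D (fun x => \sum_(i <- s | P i) f i x).
Proof.
move=> h; elim: s => [|i s IH].
  by apply: bm_eq (bm_cst 0) => x _; rewrite big_nil.
have [Pi|Pi] := boolP (P i).
  by apply: bm_eq (bmD (h i Pi) IH) => x _; rewrite big_cons Pi.
by apply: bm_eq IH => x _; rewrite big_cons (negbTE Pi).
Qed.
End D.
Lemma L1S (D E : set R) f : @measurable _ cT D -> @measurable _ cT E ->
  D `<=` E -> L1 E f -> L1 D f.
Proof. by move=> mD mE DE; apply: integrableS. Qed.
End basic.

Section indef.
Variables (R : realType) (t : R).
Local Notation leb := (@completed_lebesgue_measure R).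
Local Notation cT := (caratheodory_type (@wlength R idfun)^*%mu).
Local Notation D := (`[0, t]%classic).
Local Hint Extern 0 (@measurable _ _ [set` _]) => exact: lmeasurable_itv : core.

Definition indef (f : R -> R) (s : R) : R := \int[leb]_(x in `[0, s]) f x.

Lemma L1_sub f a b : 0 <= a -> b <= t -> L1 D f -> L1 `]a, b] f.
Proof.
move=> a0 bt; apply: L1S => // x /=; rewrite !in_itv /= => /andP[ax xb].
by rewrite (le_trans a0 (ltW ax)) (le_trans xb bt).
Qed.

Lemma L1_subc f a b : 0 <= a -> b <= t -> L1 D f -> L1 `[a, b] f.
Proof.
move=> a0 bt; apply: L1S => // x /=; rewrite !in_itv /= => /andP[ax xb].
by rewrite (le_trans a0 ax) (le_trans xb bt).
Qed.

Lemma indefB f a b : L1 D f -> 0 <= a -> a <= b -> b <= t ->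
  indef f b - indef f a = \int[leb]_(x in `]a, b]) f x.
Proof.
move=> hf a0 ab bt; rewrite /indef.
rewrite (@itv_bndbnd_setU _ _ (BLeft 0) (BRight a) (BRight b)) ?bnd_simp //.
rewrite Rintegral_setU //; last 2 first.
- rewrite -itv_bndbnd_setU ?bnd_simp //; exact: L1_subc.
- apply/disj_set2P; rewrite -subset0 => z/=; rewrite !in_itv/= => -[/andP[_]].
  by rewrite leNgt => /negbTE ->.
by rewrite addrC addKr.
Qed.

Lemma Rint_ac f : L1 D f -> forall e : R, 0 < e -> exists2 d : R, 0 < d &
  forall B, @measurable _ cT B -> B `<=` D -> (leb B < d%:E)%E ->
    \int[leb]_(x in B) `|f x| < e.
Proof.
move=> hf e e0.
have hT : leb.-integrable setT (EFin \o (f \_ D)).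
  by rewrite -restrict_EFin; apply/integrable_restrict => //=; rewrite setTI.
have [d [d0 h]] := integral_normr_continuous hT e0.
exists d => // B mB BD ltB; have := h B mB ltB.
congr (_ < _); apply: eq_Rintegral => x /set_mem Bx.
by rewrite patchE mem_set //; apply: BD.
Qed.

(** A point has measure zero, so by absolute continuity of the integral the value is below every
    positive [e]. *)
Lemma indef0 f : 0 <= t -> L1 D f -> indef f 0 = 0.
Proof.
move=> t0 hf; apply/eqP; rewrite -normr_le0; apply/ler_addgt0Pr => e e0.
have [d d0 h] := Rint_ac hf e0; rewrite add0r.
apply: le_trans (le_normr_Rintegral _ _) (ltW (h _ _ _ _)) => //.
- exact: L1_subc.
- by move=> x /=; rewrite !in_itv /= => /andP[-> /le_trans]; apply.
- rewrite (_ : leb _ = lebesgue_measure `[0, 0]) // lebesgue_measure_itv /=.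
  by rewrite ltxx lte_fin.
Qed.

Lemma indef_ucont f : L1 D f -> forall e : R, 0 < e -> exists2 d : R, 0 < d &
  forall a b, 0 <= a -> a <= b -> b <= t -> b - a < d ->
    indef (fun x => `|f x|) b - indef (fun x => `|f x|) a < e.
Proof.
move=> hf e e0; have [d d0 h] := Rint_ac hf e0; exists d => // a b a0 ab bt bad.
rewrite indefB //; last by apply: L1_abs.
apply: h => //; last by rewrite leb_itv_oc // lte_fin.
by move=> x /=; rewrite !in_itv /= => /andP[ax xb]; rewrite (le_trans a0 (ltW ax)) (le_trans
  xb bt).
Qed.

Lemma le_indefB f g a b : L1 D f -> L1 D g -> 0 <= a -> a <= b -> b <= t ->
  (forall x, a < x <= b -> f x <= g x) ->
  indef f b - indef f a <= indef g b - indef g a.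
Proof.
move=> hf hg a0 ab bt fg; rewrite !indefB //; apply: le_Rintegral => //.
- exact: L1_sub.
- exact: L1_sub.
Qed.

Lemma norm_indefB f a b : L1 D f -> 0 <= a -> a <= b -> b <= t ->
  `|indef f b - indef f a| <= indef (fun x => `|f x|) b - indef (fun x => `|f x|) a.
Proof.
move=> hf a0 ab bt; rewrite !indefB //; last exact: L1_abs.
by apply: le_normr_Rintegral => //; apply: L1_sub.
Qed.

Lemma indefD f g s : L1 D f -> L1 D g -> 0 <= s <= t ->
  indef (fun x => f x + g x) s = indef f s + indef g s.
Proof.
by move=> hf hg /andP[s0 st]; rewrite /indef RintegralD //; apply: L1_subc.
Qed.

Lemma indefZ c f s : L1 D f -> 0 <= s <= t -> indef (fun x => c * f x) s = c * indef f s.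
Proof.
by move=> hf /andP[s0 st]; rewrite /indef RintegralZl //; apply: L1_subc.
Qed.

Lemma indef_eq f g s : (forall x, 0 <= x <= s -> f x = g x) -> indef f s = indef g s.
Proof.
by move=> fg; apply: eq_Rintegral => x; rewrite inE /= in_itv => /fg.
Qed.

Lemma indef_sum (I : Type) (r : seq I) (P : pred I) (f : I -> R -> R) s :
  (forall i, P i -> L1 D (f i)) -> 0 <= s <= t ->
  indef (fun x => \sum_(i <- r | P i) f i x) s = \sum_(i <- r | P i) indef (f i) s.
Proof.
move=> hf st; have L0 : L1 D (fun=> 0) by exact: (integrable0 leb D).
elim: r => [|i r IH].
  rewrite big_nil; transitivity (0 * indef (fun=> 0) s); last by rewrite mul0r.
  rewrite -indefZ //.
  by apply: indef_eq => x _; rewrite big_nil mul0r.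
rewrite big_cons; case: ifP => Pi.
  rewrite -IH -indefD //; last by apply: L1_sum => //.
    by apply: indef_eq => x _; rewrite big_cons Pi.
  exact: hf.
by rewrite -IH; apply: indef_eq => x _; rewrite big_cons Pi.
Qed.

Lemma indef_ge0 f s : 0 <= s -> (forall x, 0 <= x <= s -> 0 <= f x) -> 0 <= indef f s.
Proof.
by move=> s0 h; apply: Rintegral_ge0 => x /=; rewrite in_itv; apply: h.
Qed.

(** Uniform continuity on [[0, t]]. Only ordered pairs are required, which is the form that
    increments of [indef] provide; [ucontP] recovers the symmetric form. *)
Definition ucont (F : R -> R) := forall e : R, 0 < e -> exists2 d : R, 0 < d &
  forall a b, 0 <= a -> a <= b -> b <= t -> b - a < d -> `|F b - F a| < e.

Lemma ucontP F : ucont F -> forall e : R, 0 < e -> exists2 d : R, 0 < d &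
  forall a b, 0 <= a <= t -> 0 <= b <= t -> `|b - a| < d -> `|F b - F a| < e.
Proof.
move=> h e e0; have [d d0 hd] := h e e0; exists d => // a b /andP[a0 at_] /andP[b0 bt].
case: (leP a b) => ab; first by rewrite ger0_norm ?subr_ge0 //; exact: hd.
by rewrite distrC [X in _ -> X < _]distrC ger0_norm ?subr_ge0 1?ltW // => ?; apply: hd => //;
  exact: ltW.
Qed.

Lemma indef_is_ucont f : L1 D f -> ucont (indef f).
Proof.
move=> hf e e0; have [d d0 h] := indef_ucont hf e0; exists d => // a b a0 ab bt bad.
by apply: le_lt_trans (norm_indefB _ _ _ _) (h _ _ _ _ _ _).
Qed.

(** The 1-Lipschitz retraction of the line onto [[0, t]]: composed with it, a function controlled on
    [[0, t]] alone becomes continuous on the whole line. *)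
Let clamp (x : R) := Num.max 0 (Num.min t x).

Lemma ucont_clamp_continuous F : 0 <= t -> ucont F -> continuous (F \o clamp).
Proof.
move=> t0 hF x; apply/cvgrPdist_lt => e e0.
have [d d0 h] := ucontP hF e0.
have hc y : 0 <= clamp y <= t.
  by rewrite /clamp le_max lexx /= ge_max t0 ge_min lexx.
near=> y; apply: h => //.
have : `|x - y| < d by near: y; exists d.
apply: le_lt_trans; rewrite ler_norml.
have := ler_norm (x - y); have := ler_norm (- (x - y)); rewrite normrN.
move: `|x - y| => z h1 h2; rewrite /clamp !maxEle !minEle.
by case: (leP t x) => ?; case: (leP t y) => ?; do 2?[case: (leP 0 _) => ?]; lra.
Unshelve. all: by end_near. Qed.

Lemma ucont_bm F : 0 <= t -> ucont F -> bmfun D F.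
Proof.
move=> t0 hF.
have cF := ucont_clamp_continuous t0 hF.
have E x : D x -> (F \o clamp) x = F x.
  move=> /=; rewrite in_itv /= => /andP[x0 xt].
  by rewrite /clamp (min_idPr _) // (max_idPr _).
apply: (bm_eq E); split.
  apply: borel_measurable_fun => //; apply: measurable_funTS.
  exact: continuous_measurable_fun.
have cD : {within D, continuous (F \o clamp)} by apply: continuous_subspaceT.
have [c _ hc] := EVT_max t0 cD; have [c' _ hc'] := EVT_min t0 cD.
exists (`|(F \o clamp) c| + `|(F \o clamp) c'|) => x Dx.
have := hc x Dx; have := hc' x Dx; rewrite ler_norml.
have := ler_norm ((F \o clamp) c); have := ler_norm (- (F \o clamp) c'); rewrite normrN.
have := normr_ge0 ((F \o clamp) c); have := normr_ge0 ((F \o clamp) c').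
by lra.
Qed.

Lemma ucont_ivt F (a b : R) : 0 <= a -> a <= b -> b <= t -> ucont F -> F a * F b <= 0 ->
  exists2 c, a <= c <= b & F c = 0.
Proof.
move=> a0 ab bt hF sg.
have t0 : 0 <= t by rewrite (le_trans a0) // (le_trans ab).
have cF := ucont_clamp_continuous t0 hF.
have E x : 0 <= x <= t -> (F \o clamp) x = F x.
  move=> /andP[x0 xt].
  by rewrite /= /clamp (min_idPr _) // (max_idPr _).
have cD : {within `[a, b], continuous (F \o clamp)} by apply: continuous_subspaceT.
have [|c] := @IVT _ _ _ _ 0 ab cD.
  rewrite !E ?a0 ?(le_trans a0 ab) ?bt ?(le_trans ab bt) //.
  by rewrite ge_min le_max; move: sg; case: (leP (F a) 0) => h1;
    case: (leP (F b) 0) => h2 //= h3; nra.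
rewrite in_itv /= => /andP[ac cb]; rewrite -[_ _ = 0]/((F \o clamp) c = 0) E; last first.
  by rewrite (le_trans a0 ac) (le_trans cb bt).
by move=> Fc; exists c => //; rewrite ac cb.
Qed.
End indef.

(** * Absolutely continuous functions *)

Section prim.
Variables (R : realType) (t : R).
Hypothesis t0 : 0 <= t.
Local Notation leb := (@completed_lebesgue_measure R).
Local Notation cT := (caratheodory_type (@wlength R idfun)^*%mu).
Local Notation D := (`[0, t]%classic).
Local Hint Extern 0 (@measurable _ _ [set` _]) => exact: lmeasurable_itv : core.

Let mD : @measurable _ cT D. Proof. exact: lmeasurable_itv. Qed.

(* F is absolutely continuous on [0, t] with derivative f almost everywhere. *)
Definition Prim (F f : R -> R) :=
  L1 D f /\ forall s, 0 <= s <= t -> F s = F 0 + indef f s.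

(* Stands in for the almost everywhere differentiability of absolutely continuous functions
   in the proof of the chain rule. *)
Lemma increment_small_cst (H G : R -> R) :
  (forall e, 0 < e -> exists2 d, 0 < d & forall a b, 0 <= a -> a <= b -> b <= t ->
    b - a < d -> `|H b - H a| <= e * (G b - G a)) ->
  forall s, 0 <= s <= t -> H s = H 0.
Proof.
move=> h s /andP[s0 st].
have key e : 0 < e -> `|H s - H 0| <= e * (G s - G 0).
  move=> e0; have [d d0 hd] := h e e0.
  (* Enough equal steps for their length [s / n] to be below [d]; over them the increments of [G]
     telescope. *)
  pose n := (Num.truncn (s / d)).+1.
  have n0 : 0 < n%:R :> R by rewrite ltr0n.
  have sn : s / n%:R < d.
    rewrite ltr_pdivrMr // mulrC -ltr_pdivrMr // /n.
    by have /andP[] := truncn_itv (divr_ge0 s0 (ltW d0)).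
  pose x (k : nat) := s / n%:R * k%:R.
  have xS k : x k.+1 - x k = s / n%:R by rewrite /x -natr1; ring.
  have q0 : 0 <= s / n%:R by rewrite divr_ge0 // ltW.
  have step k : (k <= n)%N -> `|H (x k) - H 0| <= e * (G (x k) - G 0).
    elim: k => [_|k IH kn]; first by rewrite /x mulr0 !subrr normr0 mulr0.
    have xt : x k.+1 <= t.
      apply: le_trans st; rewrite /x mulrAC ler_pdivrMr // ler_wpM2l // ler_nat //.
    have x0 : 0 <= x k by rewrite mulr_ge0.
    have xx : x k <= x k.+1 by rewrite -subr_ge0 xS.
    have := hd _ _ x0 xx xt; rewrite xS => /(_ sn) h1.
    have h2 := IH (ltnW kn).
    rewrite -(subrKA (H (x k))); apply: le_trans (ler_normD _ _) _.
    by apply: le_trans (lerD h1 h2) _; rewrite -mulrDr subrKA.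
  have := step n (leqnn n); rewrite /x -mulrA mulVf ?mulr1 // gt_eqF //.
apply/eqP; rewrite -subr_eq0 -normr_le0; apply/ler_addgt0Pr => e e0; rewrite add0r.
have e1 : 0 < e / (`|G s - G 0| + 1) by rewrite divr_gt0 // ltr_wpDl.
apply: le_trans (key _ e1) _; rewrite mulrAC ler_pdivrMr ?ltr_wpDl //.
by rewrite ler_wpM2l // ?(ltW e0) // (le_trans (ler_norm _)) // lerDl.
Qed.

Lemma primL F f : Prim F f -> L1 D f.
Proof. by case. Qed.

Lemma primE F f s : Prim F f -> 0 <= s <= t -> F s = F 0 + indef f s.
Proof. by case=> _; apply. Qed.

Lemma primB F f a b : Prim F f -> 0 <= a -> a <= b -> b <= t ->
  F b - F a = indef f b - indef f a.
Proof.
move=> hF a0 ab bt; rewrite (primE hF) ?(le_trans a0 ab) //.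
by rewrite [F a](primE hF) ?a0 ?(le_trans ab bt) //; ring.
Qed.

Lemma prim_ucont F f : Prim F f -> ucont t F.
Proof.
move=> hF e e0; have [d d0 h] := indef_is_ucont (primL hF) e0.
by exists d => // a b a0 ab bt bad; rewrite (primB hF) // h.
Qed.

Lemma prim_bm F f : Prim F f -> bmfun D F.
Proof. by move=> /prim_ucont; apply: ucont_bm. Qed.

Lemma indef_prim f : L1 D f -> Prim (indef f) f.
Proof. by move=> hf; split => // s st; rewrite (indef0 t0 hf) add0r. Qed.

Lemma prim_eq F G f g : (forall s, 0 <= s <= t -> F s = G s) ->
  (forall s, 0 <= s <= t -> f s = g s) -> Prim F f -> Prim G g.
Proof.
move=> FG fg [hf hF]; split.
  by apply: (L1_eq mD _ hf) => x /=; rewrite in_itv; apply: fg.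
move=> s /andP[s0 st]; rewrite -!FG ?lexx ?s0 ?st // hF ?s0 //.
congr (_ + _); apply: indef_eq => x /andP[x0 xs].
by rewrite fg // x0 (le_trans xs).
Qed.

Lemma primD F G f g : Prim F f -> Prim G g ->
  Prim (fun x => F x + G x) (fun x => f x + g x).
Proof.
move=> [hf hF] [hg hG]; split; first exact: (L1D mD).
by move=> s st; rewrite hF // hG // (indefD hf hg) //; ring.
Qed.

Lemma primZ c F f : Prim F f -> Prim (fun x => c * F x) (fun x => c * f x).
Proof.
move=> [hf hF]; split; first exact: (L1Z mD c hf).
by move=> s st; rewrite hF // (indefZ c hf) //; ring.
Qed.

Lemma L10 : L1 D (fun=> 0).
Proof. exact: (integrable0 leb D). Qed.

Lemma indef_zero s : 0 <= s <= t -> indef (fun=> 0) s = 0.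
Proof.
move=> st; transitivity (0 * indef (fun=> 0) s); last by rewrite mul0r.
by rewrite -(indefZ 0 L10 st); apply: indef_eq => x _; rewrite mul0r.
Qed.

Lemma prim_cst c : Prim (fun=> c) (fun=> 0).
Proof. by split; [exact: L10|move=> s st; rewrite indef_zero ?addr0]. Qed.

Lemma prim_sum (I : Type) (r : seq I) (P : pred I) (F f : I -> R -> R) :
  (forall i, P i -> Prim (F i) (f i)) ->
  Prim (fun x => \sum_(i <- r | P i) F i x) (fun x => \sum_(i <- r | P i) f i x).
Proof.
move=> h; elim: r => [|i r IH].
  by apply: prim_eq (prim_cst 0) => s _; rewrite big_nil.
case Pi : (P i); last by apply: prim_eq IH => s _; rewrite big_cons Pi.
by apply: prim_eq (primD (h i Pi) IH) => s _; rewrite big_cons Pi.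
Qed.

(** A quadratic remainder that is uniform on [S]. The chain rule uses no other regularity of [phi],
    since a Lipschitz bound for [phi'] follows from it. *)
Definition taylor1 (S : R -> Prop) (phi phi' : R -> R) := exists2 K, 0 <= K &
  forall x y, S x -> S y -> `|phi y - phi x - phi' x * (y - x)| <= K * (y - x) ^+ 2.

(** In the sum of the estimates at [x] and at [y] the values of [phi] cancel, and (phi' y - phi' x)
    (y - x) remains. *)
Lemma taylor1_lip (S : R -> Prop) phi phi' K :
  (forall x y, S x -> S y -> `|phi y - phi x - phi' x * (y - x)| <= K * (y - x) ^+ 2) ->
  forall x y, S x -> S y -> `|phi' y - phi' x| <= 2 * K * `|y - x|.
Proof.
move=> h x y Sx Sy; have [->|xy] := eqVneq x y; first by rewrite !subrr normr0 mulr0.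
have d0 : 0 < `|y - x| by rewrite normr_gt0 subr_eq0 eq_sym.
rewrite -(ler_pM2r d0) -normrM.
have -> : 2 * K * `|y - x| * `|y - x| = K * (y - x) ^+ 2 + K * (x - y) ^+ 2.
  by rewrite -(opprB y x) sqrrN -[(y - x) ^+ 2]ger0_norm ?sqr_ge0 // normrX; ring.
rewrite (_ : _ * (y - x) = (phi y - phi x - phi' x * (y - x)) + (phi x - phi y - phi' y * (x -
  y))); last by ring.
by apply: le_trans (ler_normD _ _) (lerD (h x y Sx Sy) (h y x Sy Sx)).
Qed.

(** The difference [H] of the two sides is constant by [increment_small_cst], with the integral of
    |f| as [G]. Its increment over a short interval is the Taylor remainder of [phi] plus the error
    of freezing phi'(F) at the left end; both are a small multiple of the integral of |f| over the
    interval. *)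
Lemma prim_comp (S : R -> Prop) phi phi' F f : taylor1 S phi phi' ->
  (forall s, 0 <= s <= t -> S (F s)) -> Prim F f ->
  Prim (fun x => phi (F x)) (fun x => phi' (F x) * f x).
Proof.
move=> [K K0 hK] SF hF.
have lip := taylor1_lip hK.
have uF := prim_ucont hF.
have u' : ucont t (fun x => phi' (F x)).
  move=> e e0; have e1 : 0 < e / (2 * K + 1) by rewrite divr_gt0 // ltr_wpDl // mulr_ge0.
  have [d d0 hd] := uF _ e1; exists d => // a b a0 ab bt bad.
  apply: le_lt_trans (lip _ _ (SF _ _) (SF _ _)) _; rewrite ?a0 ?(le_trans ab bt) ?(le_trans
    a0 ab) //.
  have := hd a b a0 ab bt bad; rewrite ltr_pdivlMr ?ltr_wpDl ?mulr_ge0 //.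
  by apply: le_lt_trans; rewrite mulrDr mulr1 mulrC lerDl.
have Lf := primL hF.
have L' : L1 D (fun x => phi' (F x) * f x) by apply: (L1_bm mD) => //; apply: ucont_bm.
split=> // s st.
apply/eqP; rewrite -subr_eq; apply/eqP.
set H := fun s => phi (F s) - indef (fun x => phi' (F x) * f x) s.
rewrite -[LHS]/(H s) (@increment_small_cst H (indef (fun x => `|f x|))) //.
  by rewrite /H (indef0 t0 L') subr0.
(* The remainder contributes [K] and the freezing [2 * K] times the oscillation of [F]; the 1 keeps
   the denominator positive. *)
move=> e e0; have e1 : 0 < e / (3 * K + 1) by rewrite divr_gt0 // ltr_wpDl // mulr_ge0.
have [d d0 hd] := uF _ e1; exists d => // a b a0 ab bt bad.
set W := indef (fun x => `|f x|) b - _.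
have W0 : 0 <= W by apply: (le_trans (normr_ge0 _) (norm_indefB Lf a0 ab bt)).
have FW : `|F b - F a| <= W by rewrite (primB hF) //; exact: (norm_indefB Lf a0 ab bt).
have Fe : `|F b - F a| <= e / (3 * K + 1) by apply: ltW; apply: hd.
have Sa : S (F a) by apply: SF; rewrite a0 (le_trans ab).
have Sb : S (F b) by apply: SF; rewrite bt (le_trans a0).
have -> : H b - H a = (phi (F b) - phi (F a) - phi' (F a) * (F b - F a)) +
   (phi' (F a) * (F b - F a) - (indef (fun x => phi' (F x) * f x) b - indef (fun x => phi' (F
     x) * f x) a)).
  by rewrite /H; ring.
have B1 : `|phi (F b) - phi (F a) - phi' (F a) * (F b - F a)| <= K * (e / (3 * K + 1)) * W.
  apply: le_trans (hK _ _ Sa Sb) _; rewrite -mulrA ler_wpM2l //.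
  by rewrite -(ger0_norm (sqr_ge0 _)) normrX expr2 ler_pM.
have B2 : `|phi' (F a) * (F b - F a) - (indef (fun x => phi' (F x) * f x) b - indef (fun x =>
  phi' (F x) * f x) a)| <= 2 * K * (e / (3 * K + 1)) * W.
  rewrite (primB hF) // mulrBr -!(indefZ _ Lf) ?a0 ?(le_trans ab bt) ?(le_trans a0 ab) //.
  have LZ := L1Z mD (phi' (F a)) Lf.
  pose g x := phi' (F a) * f x + (-1) * (phi' (F x) * f x).
  have Lg : L1 D g by apply: (L1D mD) => //; apply: (L1Z mD).
  have -> : forall A B C E : R, A - B - (C - E) = (A + (-1) * C) - (B + (-1) * E) by move=> *;
    ring.
  rewrite -!(indefZ _ L') -?(indefD LZ) ?a0 ?(le_trans ab bt) ?(le_trans a0 ab) //;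
    [|exact: (L1Z mD (-1) L')..].
  apply: le_trans (norm_indefB Lg a0 ab bt) _.
  have La : L1 D (fun x => `|f x|) := L1_abs Lf.
  rewrite /W mulrBr -!(indefZ _ La) ?a0 ?(le_trans ab bt) ?(le_trans a0 ab) //.
  apply: (@le_indefB _ t) => //; [apply: (L1_abs Lg)|apply: (L1Z mD _ La)|].
  move=> x /andP[ax xb]; rewrite /g mulN1r -mulrBl normrM ler_wpM2r //.
  have xt : x <= t by rewrite (le_trans xb).
  have x0 : 0 <= x by rewrite (le_trans a0) // ltW.
  apply: le_trans (lip _ _ _ Sa) _; first by apply: SF; rewrite x0.
  rewrite ler_wpM2l ?mulr_ge0 // distrC ltW // hd // ?(ltW ax) //.
  by apply: le_lt_trans bad; rewrite lerD2r.
apply: le_trans (ler_normD _ _) _; apply: le_trans (lerD B1 B2) _.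
rewrite -mulrDl ler_wpM2r // -mulrDl mulrA ler_pdivrMr ?ltr_wpDl ?mulr_ge0 //.
by rewrite mulrC ler_wpM2l ?(ltW e0) //; lra.
Qed.

Lemma prim_sqr F f : Prim F f -> Prim (fun x => F x ^+ 2) (fun x => 2 * F x * f x).
Proof.
move=> hF; apply: (@prim_comp (fun=> True) (fun x => x ^+ 2) (fun x => 2 * x)) => //.
by exists 1 => // x y _ _; rewrite mul1r -(ger0_norm (sqr_ge0 (y - x))) (_ : _ - _ - _ = (y -
  x) ^+ 2) //; ring.
Qed.

(** By polarization, 2 F G = (F + G)^2 - (F^2 + G^2), so the chain rule for the square is enough. *)
Lemma primM F G f g : Prim F f -> Prim G g ->
  Prim (fun x => F x * G x) (fun x => f x * G x + F x * g x).
Proof.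
move=> hF hG; have h1 := prim_sqr (primD hF hG).
have h2 := primD h1 (primZ (-1) (primD (prim_sqr hF) (prim_sqr hG))).
by apply: prim_eq (primZ (1/2) h2) => s _ /=; field.
Qed.

Lemma lmfun_le (c : R) : lmfun D (fun x => (x <= c)%R%:R).
Proof.
apply: borel_measurable_fun => //; apply: measurable_funTS.
rewrite (_ : (fun _ => _) = \1_(`]-oo, c]%classic)); first exact: measurable_indic.
apply/funext => x; rewrite indicE; congr (nat_of_bool _)%:R.
by apply/idP/idP; rewrite inE /= in_itv.
Qed.

Lemma bm_le (c : R) : bmfun D (fun x => (x <= c)%R%:R).
Proof.
split; first exact: lmfun_le.
by exists 1 => x _; case: (x <= c); rewrite ?normr1 ?normr0.
Qed.

(** Freezing a function after [c] allows a function to be cut at [c] into two absolutely continuous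
    pieces. *)
Lemma prim_stop F f c : 0 <= c <= t -> Prim F f ->
  Prim (fun x => F (Num.min x c)) (fun x => (x <= c)%R%:R * f x).
Proof.
move=> /andP[c0 ct] [hf hF].
have Lg : L1 D (fun x => (x <= c)%R%:R * f x) by apply: (L1_bm mD) => //; exact: bm_le.
have E s : s <= c -> indef (fun x => (x <= c)%R%:R * f x) s = indef f s.
  by move=> sc; apply: indef_eq => x /andP[_ xs]; rewrite (le_trans xs sc) mul1r.
split => // s /andP[s0 st]; rewrite (min_idPl c0).
case: (leP s c) => sc; first by rewrite E // hF // s0.
rewrite hF ?c0 // -E //; congr (_ + _); apply/eqP; rewrite eq_sym -subr_eq0 -normr_le0.
apply: le_trans (norm_indefB Lg c0 (ltW sc) st) _.
have h0 : indef (fun=> 0) s - indef (fun=> 0) c = 0 :> R.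
  by rewrite !indef_zero ?subrr ?c0 ?s0.
rewrite -h0.
apply: (@le_indefB _ t) => //; [apply: (L1_abs Lg)|exact: L10|exact: ltW|].
by move=> x /andP[cx _]; rewrite (leNgt x c) cx mul0r normr0.
Qed.
End prim.

(** * Second-order estimates for the exponential and the tangent *)

Section taylor.
Variable R : realType.

Lemma mvt_unordered (lo hi : R) (phi phi' : R -> R) :
  (forall x : R, lo <= x <= hi -> is_derive x 1 phi (phi' x)) ->
  forall x y, lo <= x <= hi -> lo <= y <= hi ->
  exists c, [/\ lo <= c <= hi, `|c - x| <= `|y - x| & phi y - phi x = phi' c * (y - x)].
Proof.
move=> h.
have key (x y : R) : lo <= x -> x <= y -> y <= hi ->
    exists2 c, x <= c <= y & phi y - phi x = phi' c * (y - x).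
  move=> lx xy yh.
  have dphi (z : R) : z \in `[x, y] -> is_derive z 1 phi (phi' z).
    by rewrite in_itv /= => /andP[xz zy]; apply: h; rewrite (le_trans lx xz) (le_trans zy yh).
  have d1 (z : R) : z \in `]x, y[ -> is_derive z 1 phi (phi' z).
    by move=> zz; apply: dphi; exact: subset_itv_oo_cc.
  have cphi : {within `[x, y], continuous phi}.
    apply: derivable_within_continuous => z zxy.
    by case: (dphi z zxy).
  have [c] := MVT_segment xy d1 cphi.
  by rewrite in_itv /= => ? ?; exists c.
move=> x y /andP[lx xh] /andP[ly yh]; case: (leP x y) => xy.
  have [c /andP[xc cy] E] := key x y lx xy yh; exists c; split => //.
    by rewrite (le_trans lx xc) (le_trans cy yh).
  by rewrite !ger0_norm ?subr_ge0 // lerD2r.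
have [c /andP[xc cy] E] := key y x ly (ltW xy) xh; exists c; split => //.
- by rewrite (le_trans ly xc) (le_trans cy xh).
- rewrite distrC [X in _ <= X]distrC !ger0_norm ?subr_ge0 ?(ltW xy) //.
  by rewrite lerD2l lerN2.
- by rewrite -opprB E; ring.
Qed.

(** Two mean values give the remainder phi''(d) (c - x) (y - x); the bound on |c - x| in
    [mvt_unordered] is there to make it quadratic. *)
Lemma taylor1_C2 (lo hi K : R) (phi phi' phi'' : R -> R) : 0 <= K ->
  (forall x : R, lo <= x <= hi -> is_derive x 1 phi (phi' x)) ->
  (forall x : R, lo <= x <= hi -> is_derive x 1 phi' (phi'' x)) ->
  (forall x : R, lo <= x <= hi -> `|phi'' x| <= K) ->
  taylor1 (fun x => lo <= x <= hi) phi phi'.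
Proof.
move=> K0 h1 h2 hK; exists K => // x y Sx Sy.
have [c [Sc cx ->]] := mvt_unordered h1 Sx Sy.
rewrite -mulrBl; have [d [Sd _ ->]] := mvt_unordered h2 Sx Sc.
rewrite -[X in _ <= _ * X]ger0_norm ?sqr_ge0 // normrX expr2 mulrA !normrM.
by rewrite ler_wpM2r // ler_pM // hK.
Qed.

Lemma taylor1_expR (M : R) : taylor1 (fun x : R => - M <= x <= M) expR expR.
Proof.
apply: (@taylor1_C2 _ _ (expR M) _ _ expR); first exact: expR_ge0.
- by move=> x /andP[_ xM]; rewrite ger0_norm ?expR_ge0 // ler_expR.
Qed.

Lemma tan_bound (b : R) : 0 <= b -> b < pi / 2 -> forall x, - b <= x <= b ->
  0 < cos x /\ `|tan x| <= (cos b)^-1.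
Proof.
move=> b0 bpi x /andP[bx xb].
have pi0 := pi_gt0 R.
have cb : 0 < cos b by apply: cos_gt0_pihalf; lra.
have cx : cos b <= cos x.
  have [x0|x0] := leP 0 x.
    rewrite leNgt ltr_cos ?in_itv /= -?leNgt //; lra.
  rewrite -(cosN x) leNgt ltr_cos ?in_itv /= -?leNgt; lra.
have cx0 := lt_le_trans cb cx; split => //.
rewrite /tan normrM normfV (gtr0_norm cx0) -[X in _ <= X]mul1r ler_pM ?invr_ge0 ?(ltW cx0) //.
  by rewrite ler_norml sin_geN1 sin_le1.
by rewrite lef_pV2 ?posrE.
Qed.

Lemma taylor1_tan (b : R) : 0 <= b -> b < pi / 2 ->
  taylor1 (fun x : R => - b <= x <= b) tan (fun x => 1 + tan x ^+ 2).
Proof.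
move=> b0 bpi; have hb := tan_bound b0 bpi.
have D1 (x : R) : - b <= x <= b -> is_derive x 1 tan (1 + tan x ^+ 2).
  move=> /hb[cx _]; have cx0 : cos x != 0 by rewrite gt_eqF.
  by rewrite -cos2_tan2 //; exact: is_derive_tan.
set T := (cos b)^-1.
have T0 : 0 <= T by rewrite invr_ge0 ltW // (hb b _).1 // lexx andbT; lra.
have D2 (x : R) : - b <= x <= b ->
    is_derive x 1 (fun x => 1 + tan x ^+ 2) (2 * tan x * (1 + tan x ^+ 2)).
  move=> xb; have dx := D1 x xb; rewrite -[fun _ => _]/(cst 1 + tan ^+ 2).
  by apply: is_derive_eq; rewrite /GRing.scale /= add0r expr1 mulr_natl.
apply: (taylor1_C2 _ D1 D2 (K := 2 * T * (1 + T ^+ 2))).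
  by rewrite !mulr_ge0 // addr_ge0 ?sqr_ge0.
move=> x xb; have [_ tx] := hb x xb.
rewrite normrM (normrM 2) (ger0_norm (ler0n _ 2)) [`|1 + _|]ger0_norm ?addr_ge0 ?sqr_ge0 //.
apply: ler_pM.
- by rewrite mulr_ge0.
- by rewrite addr_ge0 ?sqr_ge0.
- by rewrite ler_wpM2l.
by rewrite lerD2l -[tan x ^+ 2]ger0_norm ?sqr_ge0 // normrX lerXn2r // ?nnegrE.
Qed.
End taylor.

(** * A weighted Wirtinger inequality *)

Section wirtinger.
Variables (R : realType) (t : R).
Hypothesis t0 : 0 <= t.
Local Notation leb := (@completed_lebesgue_measure R).
Local Notation cT := (caratheodory_type (@wlength R idfun)^*%mu).
Local Notation D := (`[0, t]%classic).
Let mD : @measurable _ cT D. Proof. exact: lmeasurable_itv. Qed.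

Lemma le_indef (f g : R -> R) (s : R) : L1 D f -> L1 D g -> 0 <= s <= t ->
  (forall x, 0 <= x <= s -> f x <= g x) -> indef f s <= indef g s.
Proof.
move=> hf hg /andP[s0 st] fg.
have := @le_indefB _ t f g 0 s hf hg (lexx 0) s0 st.
rewrite (indef0 t0 hf) (indef0 t0 hg) !subr0; apply => x /andP[x0 xs].
by apply: fg; rewrite xs ltW.
Qed.

Variables (w : R -> R).
Hypothesis hw : L1 D w.
Hypothesis w0 : forall x, 0 <= x <= t -> 0 <= w x.

Definition arclen : R -> R := indef w.
Local Notation theta := arclen.

Lemma prim_arclen : Prim t theta w.
Proof. exact: indef_prim. Qed.

Lemma arclen0 : theta 0 = 0.
Proof. exact: (indef0 t0). Qed.

Lemma arclen_mono a b : 0 <= a -> a <= b -> b <= t -> theta a <= theta b.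
Proof.
move=> a0 ab bt; rewrite -subr_ge0.
have := @le_indefB _ t (fun=> 0) w a b (L10 _) hw a0 ab bt.
rewrite !(@indef_zero _ t) ?subrr; first last.
- by rewrite bt (le_trans a0).
- by rewrite a0 (le_trans ab).
by apply=> x /andP[ax xb]; apply: w0; rewrite (le_trans xb bt) ltW // (le_lt_trans a0).
Qed.

Lemma arclen_range x : 0 <= x <= t -> 0 <= theta x <= theta t.
Proof.
move=> /andP[x0 xt]; rewrite -{1}arclen0 !arclen_mono //.
Qed.

Definition rho a x := expR (- 2 * a * theta x).

Lemma prim_rho a : Prim t (rho a) (fun x => - 2 * a * rho a x * w x).
Proof.
set M := `|- 2 * a| * theta t.
have := @prim_comp _ t t0 _ _ _ _ _ (taylor1_expR M) _ (primZ (- 2 * a) prim_arclen).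
move=> h; apply: prim_eq (h _) => // [x _|x xt]; first by rewrite /rho; ring.
rewrite -ler_norml normrM ler_wpM2l //.
by have /andP[h1 h2] := arclen_range xt; rewrite ger0_norm.
Qed.

Lemma rho_gt0 a x : 0 < rho a x.
Proof. exact: expR_gt0. Qed.

(* With q = a + r, the derivative of rho q y^2 is
   2 rho q y f - rho w (q^2 + a^2 - r^2 - r1) y^2. *)
Lemma riccati_ineq (a k : R) (r r1 y f : R -> R) :
  Prim t r (fun x => r1 x * w x) -> Prim t y f ->
  (forall x, 0 <= x <= t -> y x = 0 \/ k ^+ 2 <= a ^+ 2 - r x ^+ 2 - r1 x) ->
  indef (fun x => rho a x * w x * ((k ^+ 2 + (a + r x) ^+ 2) * y x ^+ 2)) t <=
  indef (fun x => 2 * rho a x * (a + r x) * y x * f x) t -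
  (rho a t * (a + r t) * y t ^+ 2 - rho a 0 * (a + r 0) * y 0 ^+ 2).
Proof.
move=> hr hy hk.
have hrho := prim_rho a.
have hq := primD (prim_cst t a) hr.
have hh := primM t0 hrho hq.
have hH := primM t0 hh (prim_sqr t0 hy).
have tt : 0 <= t <= t by rewrite lexx t0.
have bq := prim_bm t0 hq; have brho := prim_bm t0 hrho; have by_ := prim_bm t0 hy.
have L2 : L1 D (fun x => 2 * rho a x * (a + r x) * y x * f x).
  apply: (L1_bm mD _ (primL hy)); apply: bmM => //; apply: bmM => //.
  by apply: bmM => //; exact: bm_cst.
have := primE hH tt; move: (primL hH).
set d := (X in indef X t) => Ld E.
have -> : rho a t * (a + r t) * y t ^+ 2 - rho a 0 * (a + r 0) * y 0 ^+ 2 = indef d t.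
  by rewrite E; ring.
rewrite -mulN1r -(indefZ _ Ld tt) -(indefD L2 (L1Z mD _ Ld) tt).
apply: le_indef => //.
- apply: (L1_eq mD _ (L1_bm mD (bmM brho (bmM (bmD (bm_cst D (k ^+ 2)) (bmM bq bq)) (bmM by_
  by_))) hw)).
  by move=> x _; ring.
- exact: (L1D mD L2 (L1Z mD _ Ld)).
move=> x xt; rewrite /d -subr_ge0.
rewrite (_ : _ - _ = rho a x * w x * (y x ^+ 2 * (a ^+ 2 - r x ^+ 2 - r1 x - k ^+ 2)));
  last by ring.
apply: mulr_ge0; first by rewrite mulr_ge0 ?w0 ?(ltW (rho_gt0 _ _)).
case: (hk x xt) => [->|h]; first by rewrite expr0n mul0r.
by rewrite mulr_ge0 ?sqr_ge0 // subr_ge0.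
Qed.

Lemma rho0 a : rho a 0 = 1.
Proof. by rewrite /rho arclen0 mulr0 expR0. Qed.

(** For [r = 0] the Riccati condition is an equality, and the boundary term may be dropped because
    of its sign. *)
Lemma riccati_cst (k a : R) (y f : R -> R) : a ^+ 2 = k ^+ 2 -> Prim t y f ->
  0 <= a * (rho a t * y t ^+ 2 - y 0 ^+ 2) ->
  indef (fun x => rho a x * w x * ((k ^+ 2 + a ^+ 2) * y x ^+ 2)) t <=
  indef (fun x => 2 * rho a x * a * y x * f x) t.
Proof.
move=> ak hy bd.
have h0 : Prim t (fun=> 0) (fun x => 0 * w x).
  by apply: prim_eq (prim_cst t 0) => // x _; rewrite mul0r.
rewrite (_ : indef _ t = indef (fun x => rho a x * w x * ((k ^+ 2 + (a + 0) ^+ 2) * y x ^+ 2))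
  t); last first.
  by apply: indef_eq => x _; rewrite addr0.
rewrite [X in _ <= X](_ : indef _ t = indef (fun x => 2 * rho a x * (a + 0) * y x * f x) t);
  last first.
  by apply: indef_eq => x _; rewrite addr0.
apply: le_trans (@riccati_ineq a k (fun=> 0) (fun=> 0) y f h0 hy _) _.
  by move=> x _; right; rewrite expr0n subr0 subr0 ak.
rewrite rho0 addr0 gerBl (le_trans bd) // le_eqVlt; apply/orP; left; apply/eqP; ring.
Qed.

(* Where g = 1, the function r = - k tan (k u) solves r' = - k^2 - r^2 in arc length. *)
Lemma tan_weight (k : R) (u : R -> R) (g : R -> R) :
  0 <= k -> k * theta t < pi ->
  Prim t u (fun x => g x * w x) ->
  (forall x, 0 <= x <= t -> - (theta t / 2) <= u x <= theta t / 2) ->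
  Prim t (fun x => - k * tan (k * u x))
         (fun x => - k ^+ 2 * (1 + tan (k * u x) ^+ 2) * g x * w x).
Proof.
move=> k0 kL hu ub.
have L0 : 0 <= theta t by have := arclen_mono (lexx 0) t0 (lexx t); rewrite arclen0.
have b0 : 0 <= k * (theta t / 2) by rewrite mulr_ge0 // divr_ge0.
(* This is where pi enters: a branch of the tangent in [k * u], with [u] ranging over an interval of
   length [theta t], has to avoid its poles. *)
have bpi : k * (theta t / 2) < pi / 2 by rewrite mulrA ltr_pM2r ?invr_gt0.
have h := primZ (- k) (prim_comp t0 (taylor1_tan b0 bpi) _ (primZ k hu)).
apply: prim_eq (h _) => // [x _|x xt]; first by ring.
have /andP[h1 h2] := ub x xt.
by rewrite -mulrN !ler_wpM2l.
Qed.

(* Since y c = 0, r may jump at c: one branch of the tangent is used on each side of c, with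
   the same value at 0 and at t, so that the boundary terms cancel. *)
Lemma riccati_tan (k a c : R) (y f : R -> R) : 0 <= k -> k * theta t < pi ->
  0 <= c <= t -> y c = 0 -> rho a t * y t ^+ 2 = y 0 ^+ 2 -> Prim t y f ->
  exists2 p, bmfun D p &
  indef (fun x => rho a x * w x * ((k ^+ 2 + p x ^+ 2) * y x ^+ 2)) t <=
  indef (fun x => 2 * rho a x * p x * y x * f x) t.
Proof.
move=> k0 kL ct yc bd hy; have /andP[c0 ct'] := ct.
have L0 : 0 <= theta t by have := arclen_mono (lexx 0) t0 (lexx t); rewrite arclen0.
have tt : 0 <= t <= t by rewrite lexx t0.
pose i x : R := (x <= c)%R%:R.
have hth := prim_arclen.
have hth1 := prim_stop ct hth.
have hy1 := prim_stop ct hy.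
(* As [y c = 0], [y1] is [y] before [c] and 0 after it, and [y2] is the other half. *)
pose y1 x := y (Num.min x c); pose y2 x := y x + (-1) * y1 x.
have hy2 : Prim t y2 (fun x => f x + (-1) * (i x * f x)) := primD hy (primZ (-1) hy1).
(* The phase [u1] reaches [theta t / 2] at [c], and [u2] starts there from [- (theta t / 2)]. Both
   move at arc-length speed on their side of [c], so [u2 t = u1 0]. *)
pose u1 x := theta (Num.min x c) + (theta t / 2 - theta c).
pose u2 x := theta x + (-1) * theta (Num.min x c) + (- (theta t / 2)).
have hu1 : Prim t u1 (fun x => i x * w x).
  by apply: prim_eq (primD hth1 (prim_cst t (theta t / 2 - theta c))) => // x _; rewrite addr0.
have hu2 : Prim t u2 (fun x => (1 - i x) * w x).
  apply: prim_eq (primD (primD hth (primZ (-1) hth1)) (prim_cst t (- (theta t / 2)))) => // x _.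
  by rewrite /i; ring.
have mc x : 0 <= x <= t -> 0 <= Num.min x c <= t.
  by move=> /andP[x0 xt]; rewrite le_min x0 c0 ge_min xt.
have /andP[thc0 thcL] := arclen_range ct.
have thmin x : 0 <= x <= t -> 0 <= theta (Num.min x c) /\ theta (Num.min x c) <= theta c.
  move=> xt; have /andP[h1 h2] := mc x xt; have /andP[] := arclen_range (mc x xt).
  by move=> -> _; split => //; apply: arclen_mono => //; rewrite ge_min lexx orbT.
have u1b x : 0 <= x <= t -> - (theta t / 2) <= u1 x <= theta t / 2.
  by move=> /thmin[h1 h2]; rewrite /u1; lra.
have u2b x : 0 <= x <= t -> - (theta t / 2) <= u2 x <= theta t / 2.
  move=> xt; have := thmin x xt; have := arclen_range xt; rewrite /u2.
  case: (leP x c) => xc; first by lra.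
  have /andP[x0 x1] := xt; have := arclen_mono c0 (ltW xc) x1; lra.
have hr1 := tan_weight k0 kL hu1 u1b.
have hr2 := tan_weight k0 kL hu2 u2b.
have y1z x : c <= x -> y1 x = 0 by move=> cx; rewrite /y1 (min_idPr cx).
have y1e x : x <= c -> y1 x = y x by move=> cx; rewrite /y1 (min_idPl cx).
have y2z x : x <= c -> y2 x = 0 by move=> cx; rewrite /y2 y1e //; ring.
have y2e x : c <= x -> y2 x = y x by move=> cx; rewrite /y2 y1z //; ring.
have I1 := @riccati_ineq a k _ _ _ _ hr1 hy1 _.
have I2 := @riccati_ineq a k _ _ _ _ hr2 hy2 _.
pose q1 x := a + - k * tan (k * u1 x); pose q2 x := a + - k * tan (k * u2 x).
have bi : bmfun D i := bm_le t c.
have bq1 : bmfun D q1 := prim_bm t0 (primD (prim_cst t a) hr1).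
have bq2 : bmfun D q2 := prim_bm t0 (primD (prim_cst t a) hr2).
exists (fun x => i x * q1 x + (1 + (-1) * i x) * q2 x).
  apply: bmD; first exact: bmM.
  by apply: bmM => //; apply: bmD; [exact: bm_cst|apply: bmM => //; exact: bm_cst].
have brho := prim_bm t0 (prim_rho a).
have LS q z : bmfun D q -> bmfun D z -> L1 D (fun x => rho a x * w x * ((k ^+ 2 + q x ^+ 2) *
  z x ^+ 2)).
  move=> bq bz; apply: (L1_eq mD _ (L1_bm mD (bmM brho (bmM (bmD (bm_cst D (k ^+ 2)) (bmM bq
    bq)) (bmM bz bz))) hw)).
  by move=> x _; ring.
have LT q z g : bmfun D q -> bmfun D z -> L1 D g -> L1 D (fun x => 2 * rho a x * q x * z x * g
  x).
  move=> bq bz Lg; apply: (L1_bm mD _ Lg); apply: bmM => //; apply: bmM => //.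
  by apply: bmM => //; exact: bm_cst.
have by1 := prim_bm t0 hy1; have by2 := prim_bm t0 hy2.
have LS1 := LS q1 y1 bq1 by1; have LS2 := LS q2 y2 bq2 by2.
have LT1 := LT q1 y1 _ bq1 by1 (primL hy1); have LT2 := LT q2 y2 _ bq2 by2 (primL hy2).
rewrite (_ : indef _ t = indef (fun x => rho a x * w x * ((k ^+ 2 + q1 x ^+ 2) * y1 x ^+ 2)) t
  + indef (fun x => rho a x * w x * ((k ^+ 2 + q2 x ^+ 2) * y2 x ^+ 2)) t); last first.
  rewrite -(indefD LS1 LS2 tt); apply: indef_eq => x _; rewrite /i.
  by case: (leP x c) => xc; [rewrite y1e ?y2z //|rewrite (y1z x) ?y2e // ?ltW //];
    rewrite /=; ring.
rewrite [X in _ <= X](_ : indef _ t = indef (fun x => 2 * rho a x * q1 x * y1 x * (i x * f x)) t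
  + indef (fun x => 2 * rho a x * q2 x * y2 x * (f x + (-1) * (i x * f x))) t); last first.
  rewrite -(indefD LT1 LT2 tt); apply: indef_eq => x _; rewrite /i.
  by case: (leP x c) => xc; [rewrite y1e ?y2z //|rewrite (y1z x) ?y2e // ?ltW //];
    rewrite /=; ring.
(* On the side where a phase is frozen its half of [y] vanishes; on the other side the Riccati
   equation leaves the gap [a ^+ 2]. *)
apply: le_trans (lerD (I1 _) (I2 _)) _.
- move=> x xt; case: (leP x c) => xc; [right|left; exact: yc].
  by rewrite /i xc -subr_ge0 (_ : _ - _ = a ^+ 2) ?sqr_ge0 //= ; ring.
- move=> x xt; case: (leP x c) => xc; [left; exact: (y2z x xc)|right].
  by rewrite /i (leNgt x c) xc -subr_ge0 (_ : _ - _ = a ^+ 2) ?sqr_ge0 //= ; ring.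
rewrite -[y (Num.min t c)]/(y1 t) -[y (Num.min 0 c)]/(y1 0) rho0 (y1z t ct') (y1e 0 c0) (y2e t
  ct') (y2z 0 c0).
have -> : u2 t = u1 0.
  by rewrite /u1 /u2 (min_idPr ct') (min_idPl c0) arclen0; field.
rewrite addrACA gerDl le_eqVlt; apply/orP; left; apply/eqP.
transitivity (- ((rho a t * y t ^+ 2 - y 0 ^+ 2) * (a + - k * tan (k * u1 0)))); first by ring.
by rewrite bd subrr mul0r oppr0.
Qed.

(* The weight is a = ln ((1 - s) / s) / theta(t), clamped to [-k, k]; if it is clamped, then
   r = 0 will do, because the boundary term has the right sign. *)
Lemma boundary_energy (s k : R) : 0 <= s <= 1 -> 0 < k -> k * theta t < pi ->
  exists2 a, `|a| <= k & forall y f, Prim t y f -> s * y t + (1 - s) * y 0 = 0 ->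
  exists2 p, bmfun D p &
  indef (fun x => rho a x * w x * ((k ^+ 2 + p x ^+ 2) * y x ^+ 2)) t <=
  indef (fun x => 2 * rho a x * p x * y x * f x) t.
Proof.
move=> /andP[s0 s1] k0 kL; set e := expR (k * theta t).
have L0 : 0 <= theta t by have := arclen_mono (lexx 0) t0 (lexx t); rewrite arclen0.
have tt : 0 <= t <= t by rewrite lexx t0.
have e0 : 0 < e := expR_gt0 _.
have e2 : rho (- k) t = e ^+ 2.
  by rewrite /rho /e -expRM_natl; congr expR; ring.
have e2' : rho k t * e ^+ 2 = 1.
  by rewrite -e2 /rho -expRD -[RHS]expR0; congr expR; ring.
(* The clamped cases are (1 - s) / s >= exp(k theta(t)), with weight [k], and then s / (1 - s) >=
   exp(k theta(t)), with weight [- k]. Written without division they include s = 0 and s = 1. *)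
case: (leP (e * s) (1 - s)) => h1.
  exists k; first by rewrite gtr0_norm.
  move=> y f hy bc; exists (fun=> k); first exact: bm_cst.
  apply: (riccati_cst erefl hy); rewrite mulr_ge0 ?(ltW k0) // subr_ge0.
  have s1' : 0 < 1 - s.
    rewrite lt_def subr_ge0 s1 andbT; apply: contraTneq h1 => h1.
    by rewrite h1 -ltNge mulr_gt0 //; lra.
  rewrite -(ler_pM2l (exprn_gt0 2 s1')) -exprMn.
  have -> : (1 - s) * y 0 = - (s * y t) by lra.
  rewrite sqrrN mulrA exprMn ler_wpM2r ?sqr_ge0 //.
  rewrite -(ler_pM2r (exprn_gt0 2 e0)) -[X in _ <= X]mulrA e2' mulr1 -exprMn.
  by apply: lerXn2r; rewrite ?nnegrE ?mulr_ge0 ?(ltW s1') ?(ltW e0) // mulrC.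
case: (leP (e * (1 - s)) s) => h2.
  exists (- k); first by rewrite normrN gtr0_norm.
  move=> y f hy bc; exists (fun=> - k); first exact: bm_cst.
  apply: (riccati_cst _ hy); first by rewrite sqrrN.
  rewrite mulNr -mulrN mulr_ge0 ?(ltW k0) // opprB subr_ge0 e2.
  have s0' : 0 < s.
    rewrite lt_def s0 andbT; apply: contraTneq h2 => h2.
    by rewrite h2 subr0 mulr1 -ltNge.
  rewrite -(ler_pM2l (exprn_gt0 2 s0')).
  have E : s * y t = - ((1 - s) * y 0) by lra.
  rewrite mulrCA -exprMn E sqrrN -exprMn mulrA -exprMn.
  by rewrite [X in X <= _]exprMn [X in _ <= X]exprMn ler_wpM2r ?sqr_ge0 //; apply: lerXn2r;
    rewrite ?nnegrE ?mulr_ge0 ?subr_ge0 ?(ltW e0).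
have s0' : 0 < s by nra.
have s1' : 0 < 1 - s by nra.
have L1' : 0 < theta t.
  rewrite lt_def L0 andbT; apply/eqP => E; move: h1 h2; rewrite /e E mulr0 expR0 !mul1r.
  by move=> h1 /(lt_trans h1); rewrite ltxx.
have rt : 0 < (1 - s) / s by rewrite divr_gt0.
have k0' := ltW k0.
exists (ln ((1 - s) / s) / theta t).
  rewrite normrM normfV (gtr0_norm L1') ler_pdivrMr // ler_norml.
  rewrite -[X in X <= _ <= _]expRK -[X in _ <= _ <= X]expRK -/e !ler_ln ?posrE ?expR_gt0 //.
  rewrite expRN -/e ler_pdivlMr // ler_pdivrMr // (ltW h1) andbT.
  by rewrite mulrC ler_pdivrMr // mulrC ltW.
set a := ln _ / _ => y f hy bc.
have Ey : y t = - ((1 - s) / s * y 0).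
  by apply: (mulfI (lt0r_neq0 s0')); rewrite mulrN !mulrA [s * (1 - s)]mulrC mulfK ?lt0r_neq0
    //; lra.
(* The values at 0 and at [t] have a product that is at most 0, which yields the zero at which the
   branch is changed. *)
have [c ct yc] : exists2 c, 0 <= c <= t & y c = 0.
  apply: (ucont_ivt (lexx 0) t0 (lexx t) (prim_ucont hy)).
  by rewrite Ey mulrN oppr_le0 mulrCA mulr_ge0 ?(ltW rt) // -expr2 sqr_ge0.
apply: (riccati_tan k0' kL ct yc _ hy).
have E : rho a t = ((1 - s) / s) ^- 2.
  rewrite /rho /a (_ : _ * _ = - (2 * ln ((1 - s) / s))); last by field; exact: lt0r_neq0.
  by rewrite expRN expRM_natl lnK // posrE.
rewrite E Ey; move: (_ / s) rt => r rt.
by rewrite sqrrN exprMn mulKf // expf_neq0 // lt0r_neq0.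
Qed.
End wirtinger.

(** * The spectral norm *)

Lemma cvgn_sum (R : realType) (I : Type) (r : seq I) (f : I -> nat -> R) (l : I -> R) :
  (forall i, f i @ \oo --> l i) ->
  (fun k => \sum_(i <- r) f i k) @ \oo --> \sum_(i <- r) l i.
Proof.
move=> h; elim: r => [|i r IH].
  by rewrite big_nil; under eq_fun do rewrite big_nil; exact: cvg_cst.
by rewrite big_cons; under eq_fun do rewrite big_cons; apply: cvgD.
Qed.

Section spectral.
Variables (R : realType) (n : nat).
Implicit Types (M : 'M[R]_n) (v : 'cV[R]_n).

Definition sqn v : R := \sum_i v i 0 ^+ 2.

Lemma sqn_ge0 v : 0 <= sqn v.
Proof. by apply: sumr_ge0 => i _; exact: sqr_ge0. Qed.

Lemma sqnZ c v : sqn (c *: v) = c ^+ 2 * sqn v.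
Proof. by rewrite /sqn mulr_sumr; apply: eq_bigr => i _; rewrite mxE exprMn. Qed.

Lemma sqn_eq0 v : sqn v = 0 -> v = 0.
Proof.
move=> /eqP; rewrite psumr_eq0 => [/allP h|i _]; last exact: sqr_ge0.
apply/colP => i; rewrite mxE; apply/eqP.
by have := h i (mem_index_enum _); rewrite sqrf_eq0.
Qed.

Lemma euclid_normE v : euclid_norm v ^+ 2 = sqn v.
Proof. by rewrite sqr_sqrtr // sqn_ge0. Qed.

Lemma euclid_norm_ge0 v : 0 <= euclid_norm v.
Proof. exact: sqrtr_ge0. Qed.

Lemma euclid_normZ c v : 0 <= c -> euclid_norm (c *: v) = c * euclid_norm v.
Proof.
by move=> c0; rewrite /euclid_norm -/(sqn _) sqnZ sqrtrM ?sqr_ge0 // sqrtr_sqr ger0_norm.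
Qed.

Definition entry_sum M : R := \sum_i \sum_j `|M i j|.

Lemma entry_sum_ge0 M : 0 <= entry_sum M.
Proof. by apply: sumr_ge0 => i _; apply: sumr_ge0. Qed.

Lemma sum_sqr_le (a : 'I_n -> R) : (forall i, 0 <= a i) ->
  \sum_i a i ^+ 2 <= (\sum_i a i) ^+ 2.
Proof.
move=> a0; rewrite expr2 mulr_suml; apply: ler_sum => i _.
by rewrite expr2 ler_wpM2l // (bigD1 i) //= lerDl sumr_ge0.
Qed.

Lemma spectral_set_ub M v : euclid_norm v <= 1 -> euclid_norm (M *m v) <= entry_sum M.
Proof.
move=> v1; rewrite -(@ler_pXn2r _ 2) ?nnegrE ?euclid_norm_ge0 ?entry_sum_ge0 //.
rewrite euclid_normE; apply: le_trans (sum_sqr_le _); last by move=> i; apply: sumr_ge0.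
apply: ler_sum => i _; rewrite mxE -[X in X <= _]ger0_norm ?sqr_ge0 // normrX.
apply: lerXn2r; rewrite ?nnegrE //; first exact: sumr_ge0.
apply: le_trans (ler_norm_sum _ _ _) _; apply: ler_sum => j _.
rewrite normrM -[X in _ <= X]mulr1 ler_wpM2l //.
rewrite -(@ler_pXn2r _ 2) ?nnegrE // expr1n -normrX ger0_norm ?sqr_ge0 //.
apply: le_trans (_ : sqn v <= 1); last by rewrite -euclid_normE exprn_ile1 ?euclid_norm_ge0.
by rewrite /sqn (bigD1 j) //= lerDl sumr_ge0 // => k _; exact: sqr_ge0.
Qed.

Lemma spectral_ub M v : euclid_norm v <= 1 -> euclid_norm (M *m v) <= spectral_norm M.
Proof.
move=> v1; apply: ub_le_sup; last by exists v.
by exists (entry_sum M) => _ [u u1 <-]; exact: spectral_set_ub.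
Qed.

Lemma euclid_norm0 : euclid_norm (0 : 'cV[R]_n) = 0.
Proof. by rewrite /euclid_norm big1 ?sqrtr0 // => i _; rewrite mxE expr0n. Qed.

Lemma spectral_norm_ge0 M : 0 <= spectral_norm M.
Proof.
by have := @spectral_ub M 0; rewrite mulmx0 euclid_norm0; apply; exact: ler01.
Qed.

Lemma spectral_norm_le_entry_sum M : spectral_norm M <= entry_sum M.
Proof.
apply: ge_sup; first by exists (euclid_norm (M *m 0)); exists 0; rewrite //= euclid_norm0.
by move=> _ [v v1 <-]; exact: spectral_set_ub.
Qed.

Lemma sqn_mul_le M v : sqn (M *m v) <= spectral_norm M ^+ 2 * sqn v.
Proof.
have [v0|v0] := eqVneq (sqn v) 0.
  by rewrite v0 mulr0 (sqn_eq0 v0) mulmx0 /sqn big1 // => i _; rewrite mxE expr0n.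
have s0 : 0 < sqn v by rewrite lt_def v0 sqn_ge0.
have e0 : 0 < euclid_norm v by rewrite sqrtr_gt0.
have := @spectral_ub M ((euclid_norm v)^-1 *: v).
rewrite euclid_normZ ?invr_ge0 ?(ltW e0) // mulVf ?gt_eqF // lexx => /(_ isT).
rewrite -scalemxAr euclid_normZ ?invr_ge0 ?(ltW e0) // ler_pdivrMl // => h.
rewrite -!euclid_normE -exprMn mulrC.
by apply: lerXn2r; rewrite ?nnegrE ?mulr_ge0 ?spectral_norm_ge0 ?euclid_norm_ge0.
Qed.

(** With N the norm of [M] and m = M v, each entry satisfies 2 p m <= N p^2 + m^2 / N, and |m|^2 <=
    N^2 |v|^2. Both squares end up with the coefficient N, which the cancellation in
    [energy_contraction] requires. *)
Lemma spectral_pairing M v (p : 'I_n -> R) :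
  2 * (\sum_i p i * (M *m v) i 0) <= spectral_norm M * (\sum_i p i ^+ 2 + sqn v).
Proof.
have := sqn_mul_le M v; have := spectral_norm_ge0 M; move: (spectral_norm M) => N.
rewrite le_eqVlt => /predU1P[<-|N0] h.
  have : sqn (M *m v) = 0 by apply/eqP; rewrite eq_le sqn_ge0 andbT (le_trans h) // expr0n
    mul0r.
  by move=> /sqn_eq0 ->; rewrite mul0r big1 ?mulr0 // => i _; rewrite mxE mulr0.
apply: le_trans (_ : \sum_i (N * p i ^+ 2 + N^-1 * (M *m v) i 0 ^+ 2) <= _); last first.
  rewrite big_split /= -!mulr_sumr mulrDr lerD2l ler_pdivrMl //.
  by rewrite mulrA -expr2.
rewrite mulr_sumr; apply: ler_sum => i _; rewrite -subr_ge0.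
rewrite (_ : _ - _ = N^-1 * (N * p i - (M *m v) i 0) ^+ 2); last by field; exact: lt0r_neq0.
by rewrite mulr_ge0 ?sqr_ge0 // invr_ge0 ltW.
Qed.

(** The pairing is applied to the vectors with the single nonzero entry [e] or [- e] at [i]. The
    free [e] balances the two terms later. *)
Lemma spectral_entry M v i (e : R) : 0 < e ->
  `|(M *m v) i 0| <= spectral_norm M * (e + e^-1 * sqn v) / 2.
Proof.
move=> e0.
have key (c : R) : c ^+ 2 = e ^+ 2 ->
   2 * (c * (M *m v) i 0) <= spectral_norm M * (e ^+ 2 + sqn v).
  move=> ce; have := spectral_pairing M v (fun k => if k == i then c else 0).
  rewrite (bigD1 i) //= eqxx big1 ?addr0; last by move=> k /negbTE ->; rewrite mul0r.
  by rewrite (bigD1 i) //= eqxx [X in _ + X + _]big1 ?addr0 ?ce // => k /negbTE ->;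
    rewrite expr0n.
have h1 := key e erefl; have h2 := key (- e) (sqrrN e).
rewrite ler_pdivlMr // -(ler_pM2l e0).
have -> : e * (spectral_norm M * (e + e^-1 * sqn v)) = spectral_norm M * (e ^+ 2 + sqn v).
  by field; exact: lt0r_neq0.
by case: (ger0P ((M *m v) i 0)) => s; lra.
Qed.

(** Countably many test vectors make the norm of a measurable matrix function measurable. The strict
    inequality is open in the vector, so a real witness can be replaced by a rational one; being
    homogeneous, it needs no normalization. *)
Lemma spectral_norm_ltP M (c : R) : 0 <= c ->
  (c < spectral_norm M) <->
  exists q : {ffun 'I_n -> rat},
    c ^+ 2 * (\sum_j (ratr (q j)) ^+ 2) < \sum_i (\sum_j M i j * ratr (q j)) ^+ 2 :> R.
Proof.
move=> c0; split; last first.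
  case=> q; pose v : 'cV[R]_n := \col_j ratr (q j).
  rewrite (_ : \sum_j _ = sqn v); last by apply: eq_bigr => j _; rewrite mxE.
  rewrite (_ : \sum_i _ = sqn (M *m v)); last first.
    by apply: eq_bigr => i _; rewrite mxE; congr (_ ^+ 2); apply: eq_bigr => j _; rewrite mxE.
  move=> h; have := lt_le_trans h (sqn_mul_le M v).
  rewrite ltNge => /negP; rewrite ltNge => hn; apply/negP => cN; apply: hn.
  rewrite ler_wpM2r ?sqn_ge0 //; apply: lerXn2r => //; rewrite nnegrE.
  exact: spectral_norm_ge0.
move=> cM; have [v v1 cv] : exists2 v, euclid_norm v <= 1 & c < euclid_norm (M *m v).
  have hs : has_sup [set euclid_norm (M *m v) | v in [set v | euclid_norm v <= 1]].
    split; first by exists (euclid_norm (M *m 0)); exists 0; rewrite //= euclid_norm0.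
    by exists (entry_sum M) => _ [u u1 <-]; exact: spectral_set_ub.
  have [|_ [v v1 <-]] := sup_adherent (eps := spectral_norm M - c) _ hs;
    first by rewrite subr_gt0.
  by rewrite -/(spectral_norm M) subKr => h; exists v.
have hv : 0 < \sum_i (\sum_j M i j * v j 0) ^+ 2 - c ^+ 2 * \sum_j (v j 0) ^+ 2.
  rewrite subr_gt0; apply: le_lt_trans (_ : c ^+ 2 < _).
    by rewrite ler_piMr ?sqr_ge0 // -/(sqn v) -euclid_normE exprn_ile1 ?euclid_norm_ge0.
  rewrite (_ : \sum_i _ = sqn (M *m v)); last by apply: eq_bigr => i _; rewrite mxE.
  by rewrite -euclid_normE; rewrite ltr_pXn2r // nnegrE euclid_norm_ge0.
have hq (k : nat) j : exists q : rat, v j 0 < ratr q < v j 0 + k.+1%:R^-1.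
  have : v j 0 < v j 0 + k.+1%:R^-1 by rewrite ltrDl invr_gt0.
  by move=> /rat_in_itvoo[q]; rewrite in_itv /= => ?; exists q.
pose q k : {ffun 'I_n -> rat} := [ffun j => projT1 (cid (hq k j))].
have cq j : (fun k => ratr (q k j) : R) @ \oo --> v j 0.
  apply: (@squeeze_cvgr _ _ _ _ (fun=> v j 0) (fun k => v j 0 + k.+1%:R^-1)).
  - near=> k; rewrite /q ffunE; case: cid => x /= /andP[h1 h2].
    by rewrite !ltW.
  - exact: cvg_cst.
  - rewrite -[X in _ --> X]addr0; apply: cvgD; first exact: cvg_cst.
    exact: cvg_harmonic.
have cf : (fun k => \sum_i (\sum_j M i j * ratr (q k j)) ^+ 2 - c ^+ 2 * \sum_j (ratr (q k j))
  ^+ 2)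
  @ \oo --> \sum_i (\sum_j M i j * v j 0) ^+ 2 - c ^+ 2 * \sum_j (v j 0) ^+ 2.
  apply: cvgB.
    apply: cvgn_sum => i; under eq_fun do rewrite expr2; rewrite expr2.
    have h : (fun k => \sum_j M i j * ratr (q k j)) @ \oo --> \sum_j M i j * v j 0.
      by apply: cvgn_sum => j; apply: cvgM => //; exact: cvg_cst.
    exact: cvgM.
  apply: cvgM; first exact: cvg_cst.
  apply: cvgn_sum => j; under eq_fun do rewrite expr2; rewrite expr2.
  exact: cvgM.
have /(_ _ _ hv) := cvgr_gt _ cf.
move=> [N _ /(_ N (leqnn N))] /=; rewrite subr_gt0 => h.
by exists (q N).
Unshelve. all: by end_near. Qed.
End spectral.

(** * The energy estimate for systems *)

Section vector_estimate.
Variables (R : realType) (t : R).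
Hypothesis t0 : 0 <= t.
Local Notation leb := (@completed_lebesgue_measure R).
Local Notation cT := (caratheodory_type (@wlength R idfun)^*%mu).
Local Notation D := (`[0, t]%classic).
Let mD : @measurable _ cT D. Proof. exact: lmeasurable_itv. Qed.
Variables (n : nat) (A : R -> 'M[R]_n).
Hypothesis hA : mx_integrable D A.

Definition opnorm (x : R) : R := spectral_norm (A x).
Local Notation w := opnorm.

Lemma opnorm_lmfun : lmfun D w.
Proof.
have mA i j : lmfun D (fun x => A x i j) := L1_lmfun (hA i j).
apply: (measurability _ (RGenOInfty.measurableE R)) => //.
move=> /= _ [_ [c ->] <-]; rewrite preimage_itvoy.
have [c0|c0] := ltP c 0.
  rewrite (_ : _ `&` _ = D) //; apply/seteqP; split => x; first by case.
  by move=> Dx; split => //=; apply: lt_le_trans c0 (spectral_norm_ge0 _).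
rewrite [X in measurable X](_ : _ = \bigcup_(q : {ffun 'I_n -> rat})
   (D `&` [set x | c ^+ 2 * (\sum_j (ratr (q j)) ^+ 2) < \sum_i (\sum_j A x i j * ratr (q j))
     ^+ 2])); last first.
  apply/seteqP; split => x /=.
    by move=> [Dx /(spectral_norm_ltP _ c0)[q hq]]; exists q.
  by move=> [q _ [Dx hq]]; split => //; apply/(spectral_norm_ltP _ c0); exists q.
apply: countable_bigcupT_measurable; first exact: countableP.
move=> q; rewrite -preimage_itvoy.
apply: (_ : lmfun D _) => //.
apply: (@measurable_sum _ cT) => i; apply: (@measurable_funX _ cT).
apply: (@measurable_sum _ cT) => j; apply: lmfunM => //; exact: lmfun_cst.
Qed.

Lemma opnorm_L1 : L1 D w.
Proof.
have LE : L1 D (fun x => entry_sum (A x)).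
  by apply: (L1_sum mD) => i _; apply: (L1_sum mD) => j _; apply: L1_abs; apply: hA.
apply: (L1_le mD opnorm_lmfun LE) => x _.
by rewrite ger0_norm ?spectral_norm_ge0 // spectral_norm_le_entry_sum.
Qed.

Lemma opnorm_ge0 x : 0 <= w x.
Proof. exact: spectral_norm_ge0. Qed.

Let hw := opnorm_L1.
Let w0 : forall x, 0 <= x <= t -> 0 <= w x. Proof. by move=> x _; exact: opnorm_ge0. Qed.
Local Notation rho := (rho w).

(** The scalar inequalities are added over the entries [i]. By [spectral_pairing] with the vector of
    the p_i y_i, the right-hand sides are at most the integral of rho w (sum_i (p_i y_i)^2 + |u|^2),
    and the squares of the p_i y_i cancel those on the left. The weight [a] is chosen before [y],
    hence is the same for all entries and all iterates. *)
Lemma energy_contraction (s k : R) : 0 <= s <= 1 -> 0 < k -> k * arclen w t < pi ->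
  exists2 a, `|a| <= k & forall u y : R -> 'cV[R]_n,
    (forall i, bmfun D (fun x => u x i 0)) ->
    (forall i, Prim t (fun x => y x i 0) (fun x => (A x *m u x) i 0)) ->
    (forall i, s * y t i 0 + (1 - s) * y 0 i 0 = 0) ->
    k ^+ 2 * indef (fun x => rho a x * w x * sqn (y x)) t <=
    indef (fun x => rho a x * w x * sqn (u x)) t.
Proof.
move=> s01 k0 kL; have [a ak hs] := boundary_energy t0 hw w0 s01 k0 kL.
exists a => // u y bu hy bc.
have [p hp] : {p : 'I_n -> R -> R | forall i, bmfun D (p i) /\
    indef (fun x => rho a x * w x * ((k ^+ 2 + p i x ^+ 2) * y x i 0 ^+ 2)) t <=
    indef (fun x => 2 * rho a x * p i x * y x i 0 * (A x *m u x) i 0) t}.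
  have h i := hs _ _ (hy i) (bc i).
  exists (fun i => projT1 (cid2 (h i))) => i.
  by case: cid2 => q /= bq hq; split.
have brho := prim_bm t0 (prim_rho t0 hw w0 a).
have by_ i := prim_bm t0 (hy i).
have tt : 0 <= t <= t by rewrite lexx t0.
have bsq (z : R -> 'cV[R]_n) : (forall i, bmfun D (fun x => z x i 0)) -> bmfun D (fun x => sqn
  (z x)).
  by move=> bz; apply: bm_sum => i _; apply: bmM.
have Ly : L1 D (fun x => rho a x * w x * sqn (y x)).
  apply: (L1_eq mD _ (L1_bm mD (bmM brho (bsq _ by_)) hw)) => x _; ring.
have Lu : L1 D (fun x => rho a x * w x * sqn (u x)).
  apply: (L1_eq mD _ (L1_bm mD (bmM brho (bsq _ bu)) hw)) => x _; ring.
have bpy i : bmfun D (fun x => p i x * y x i 0) by apply: bmM => //; have [] := hp i.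
have Lpy i : L1 D (fun x => rho a x * w x * (p i x * y x i 0) ^+ 2).
  by apply: (L1_eq mD _ (L1_bm mD (bmM brho (bmM (bpy i) (bpy i))) hw)) => x _; ring.
have Ly2 i : L1 D (fun x => rho a x * w x * (y x i 0) ^+ 2).
  by apply: (L1_eq mD _ (L1_bm mD (bmM brho (bmM (by_ i) (by_ i))) hw)) => x _; ring.
have LA i : L1 D (fun x => 2 * rho a x * p i x * y x i 0 * (A x *m u x) i 0).
  apply: (L1_eq mD _ (L1_bm mD (bmM (bmM (bm_cst D 2) brho) (bpy i)) (primL (hy i)))) => x _;
    ring.
pose P := indef (fun x => \sum_i rho a x * w x * (p i x * y x i 0) ^+ 2) t.
have LP : L1 D (fun x => \sum_i rho a x * w x * (p i x * y x i 0) ^+ 2) by apply: (L1_sum mD).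
have H1 : k ^+ 2 * indef (fun x => rho a x * w x * sqn (y x)) t + P <=
    indef (fun x => \sum_i 2 * rho a x * p i x * y x i 0 * (A x *m u x) i 0) t.
  rewrite (indef_sum _ _ tt); last by move=> i _; exact: LA.
  apply: le_trans (ler_sum _ (fun i _ => (hp i).2)).
  rewrite le_eqVlt; apply/orP; left; apply/eqP.
  rewrite -(indefZ _ Ly tt) -(indefD (L1Z mD _ Ly) LP tt) -(@indef_sum _ t _ _ _ _ _ _ tt);
    last first.
    move=> i _; apply: (L1_eq mD _ (L1D mD (L1Z mD (k ^+ 2) (Ly2 i)) (Lpy i))) => x _; ring.
  apply: indef_eq => x _; rewrite /sqn !mulr_sumr -big_split /=.
  by apply: eq_bigr => i _; ring.
have H2 : indef (fun x => \sum_i 2 * rho a x * p i x * y x i 0 * (A x *m u x) i 0) t <=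
    P + indef (fun x => rho a x * w x * sqn (u x)) t.
  rewrite -(indefD LP Lu tt); apply: (le_indef t0) => //.
  - by apply: (L1_sum mD).
  - exact: (L1D mD).
  move=> x _; rewrite -mulr_sumr -mulrDr -mulrA.
  rewrite [X in X <= _](_ : _ = rho a x * (2 * (\sum_i (p i x * y x i 0) * (A x *m u x) i 0))).
    by rewrite ler_wpM2l ?(ltW (rho_gt0 _ _ _)) // spectral_pairing.
  by rewrite !mulr_sumr; apply: eq_bigr => i _; ring.
have := le_trans H1 H2; rewrite addrC lerD2l.
by [].
Qed.
End vector_estimate.

(** * Decay of the boundary value iterates *)

Lemma mulmx_col_entry (R : pzRingType) (m n p : nat) (M : 'M[R]_(m, n)) (N : 'M[R]_(n, p)) i j :
  (M *m N) i j = (M *m col j N) i 0.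
Proof. by rewrite !mxE; apply: eq_bigr => k _; rewrite mxE. Qed.

Section bvp.
Variables (R : realType) (t : R).
Hypothesis t0 : 0 <= t.
Local Notation leb := (@completed_lebesgue_measure R).
Local Notation cT := (caratheodory_type (@wlength R idfun)^*%mu).
Local Notation D := (`[0, t]%classic).
Let mD : @measurable _ cT D. Proof. exact: lmeasurable_itv. Qed.
Variables (n : nat).

Definition mxbm (F : R -> 'M[R]_n) := forall i j, bmfun D (fun x => F x i j).
Definition mxPrim (F f : R -> 'M[R]_n) :=
  forall i j, Prim t (fun x => F x i j) (fun x => f x i j).

Lemma mxbm_cst (M : 'M[R]_n) : mxbm (fun=> M).
Proof. by move=> i j; exact: bm_cst. Qed.

Lemma mx_integral_entry (F : R -> 'M[R]_n) s i j :
  mx_integral `[0, s] F i j = indef (fun x => F x i j) s.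
Proof. by rewrite mxE. Qed.

Lemma mx_integral0 (F : R -> 'M[R]_n) : mx_integrable D F -> mx_integral `[0, 0] F = 0.
Proof.
by move=> hF; apply/matrixP => i j; rewrite mx_integral_entry mxE (indef0 t0) //; apply: hF.
Qed.

Lemma mx_integral_prim (F : R -> 'M[R]_n) : mx_integrable D F -> mxPrim (fun s => mx_integral
  `[0, s] F) F.
Proof.
move=> hF i j; apply: (prim_eq t0 _ _ (indef_prim t0 (hF i j))) => // s _.
by rewrite mx_integral_entry.
Qed.

Lemma mxPrim_bm F f : mxPrim F f -> mxbm F.
Proof. by move=> h i j; apply: prim_bm (h i j). Qed.

Lemma mx_integrable_mulr (A F : R -> 'M[R]_n) : mx_integrable D A -> mxbm F ->
  mx_integrable D (fun x => A x *m F x).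
Proof.
move=> hA bF i j.
apply: (L1_eq mD (f := fun x => \sum_k F x k j * A x i k)).
  by move=> x _; rewrite mxE; apply: eq_bigr => k _; rewrite mulrC.
by apply: (L1_sum mD) => k _; apply: (L1_bm mD); [exact: bF|exact: hA].
Qed.

Lemma mx_integrable_mull (A F : R -> 'M[R]_n) : mx_integrable D A -> mxbm F ->
  mx_integrable D (fun x => F x *m A x).
Proof.
move=> hA bF i j.
apply: (L1_eq mD (f := fun x => \sum_k F x i k * A x k j)).
  by move=> x _; rewrite mxE.
by apply: (L1_sum mD) => k _; apply: (L1_bm mD); [exact: bF|exact: hA].
Qed.

Variable A : R -> 'M[R]_n.
Hypothesis hA : mx_integrable D A.
Local Notation w := (opnorm A).
Local Notation L := (arclen w t).
Let hw := opnorm_L1 hA.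
Let w0 : forall x, 0 <= x <= t -> 0 <= w x. Proof. by move=> x _; exact: opnorm_ge0. Qed.

(* Iterates of y |-> (the primitive z of A y with s z(t) + (1 - s) z(0) = 0). *)
Fixpoint bvp (s : R) (m : nat) : R -> 'M[R]_n :=
  if m is m'.+1 then
    fun x => mx_integral `[0, x] (fun u => A u *m bvp s m' u)
             - s *: mx_integral `[0, t] (fun u => A u *m bvp s m' u)
  else fun=> 1%:M.

Lemma bvp_bm s m : mxbm (bvp s m).
Proof.
elim: m => [|m IH] /=; first exact: mxbm_cst.
have h := mx_integrable_mulr hA IH.
move=> i j; apply: (bm_eq (f := fun x => mx_integral `[0, x] (fun u => A u *m bvp s m u) i j +
   (- (s *: mx_integral `[0, t] (fun u => A u *m bvp s m u)) i j))).
  by move=> x _; rewrite !mxE.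
apply: bmD; last exact: bm_cst.
exact: (mxPrim_bm (mx_integral_prim h)).
Qed.

Lemma bvp_integrable s m : mx_integrable D (fun x => A x *m bvp s m x).
Proof. exact: mx_integrable_mulr hA (bvp_bm s m). Qed.

Lemma bvp_prim s m : mxPrim (bvp s m.+1) (fun x => A x *m bvp s m x).
Proof.
move=> i j; have h := mx_integral_prim (bvp_integrable s m) i j.
apply: (prim_eq t0 _ _ (primD h (prim_cst t (- (s *: mx_integral `[0, t] (fun u => A u *m bvp
  s m u)) i j)))).
  by move=> x _; rewrite /= !mxE.
by move=> x _; rewrite addr0.
Qed.

Lemma bvp_boundary s m : s *: bvp s m.+1 t + (1 - s) *: bvp s m.+1 0 = 0.
Proof.
rewrite /= (mx_integral0 (bvp_integrable s m)); apply/matrixP => i j; rewrite !mxE; ring.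
Qed.

Lemma rho_bounds (a k : R) x : `|a| <= k -> 0 <= x <= t ->
  expR (- (2 * k * L)) <= rho w a x <= expR (2 * k * L).
Proof.
move=> ak xt; rewrite /rho !ler_expR -ler_norml !normrM.
have /andP[h1 h2] := arclen_range t0 hw w0 xt.
rewrite normrN (ger0_norm (ler0n _ 2)) (ger0_norm h1).
by rewrite ler_pM ?mulr_ge0 // ler_wpM2l.
Qed.

(* The L1 norm is compared with the energy through 2 |z| <= e + |z|^2 / e, e = k^-m. *)
Lemma bvp_decay (k : R) : 0 < k -> k * L < pi ->
  forall s m i j, 0 <= s <= 1 ->
  `|mx_integral `[0, t] (fun x => A x *m bvp s m x) i j| <=
  L * (1 + expR (2 * k * L) ^+ 2) / 2 * k^-1 ^+ m.
Proof.
move=> k0 kL s m i j s01.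
have [a ak h] := energy_contraction t0 hA s01 k0 kL.
have tt : 0 <= t <= t by rewrite lexx t0.
set K := expR (2 * k * L).
have K0 : 0 < K := expR_gt0 _.
have brho := prim_bm t0 (prim_rho t0 hw w0 a).
pose u m' x := col j (bvp s m' x).
have bu m' l : bmfun D (fun x => u m' x l 0).
  by apply: bm_eq (bvp_bm s m' l j) => x _; rewrite mxE.
have bsq m' : bmfun D (fun x => sqn (u m' x)) by apply: bm_sum => l _; apply: bmM.
have LE m' : L1 D (fun x => rho w a x * w x * sqn (u m' x)).
  apply: (L1_eq mD _ (L1_bm mD (bmM brho (bsq m')) hw)) => x _; ring.
have LS m' : L1 D (fun x => w x * sqn (u m' x)).
  apply: (L1_eq mD _ (L1_bm mD (bsq m') hw)) => x _; ring.
pose E m' := indef (fun x => rho w a x * w x * sqn (u m' x)) t.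
have step m' : k ^+ 2 * E m'.+1 <= E m'.
  apply: h => l; first exact: bu.
    apply: (prim_eq t0 _ _ (bvp_prim s m' l j)) => x _; first by rewrite [RHS]mxE.
    exact: mulmx_col_entry.
  have ue x : u m'.+1 x l 0 = bvp s m'.+1 x l j by rewrite [LHS]mxE.
  have G (M N : 'M[R]_n) : s * M l j + (1 - s) * N l j = (s *: M + (1 - s) *: N) l j.
    by rewrite !mxE.
  by rewrite !ue G bvp_boundary mxE.
have EK m' : k ^+ (2 * m') * E m' <= E 0%N.
  elim: m' => [|m' IH]; first by rewrite muln0 mul1r.
  apply: le_trans IH; rewrite mulnS exprD -mulrA mulrCA.
  by apply: ler_wpM2l; [rewrite exprn_ge0 // ltW|exact: step].
have E0 : E 0%N <= K * L.
  rewrite -(indefZ K hw tt); apply: (le_indef t0) => //; first exact: (L1Z mD K hw).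
  move=> x xt; rewrite (_ : sqn _ = 1); last first.
    rewrite /sqn (bigD1 j) //= big1 ?addr0; last first.
      by move=> l /negbTE lj; rewrite !mxE lj expr0n.
    by rewrite !mxE eqxx expr1n.
  rewrite mulr1 ler_wpM2r ?w0 //.
  by have /andP[] := rho_bounds ak xt.
(* Removing the weight costs a factor [K] here, through its lower bound, and another one in [E0],
   through its upper bound. *)
have S : indef (fun x => w x * sqn (u m x)) t <= K * E m.
  rewrite -(indefZ K (LE m) tt); apply: (le_indef t0) => //; first exact: (L1Z mD K (LE m)).
  move=> x xt; have /andP[h1 _] := rho_bounds ak xt.
  rewrite (_ : K * _ = K * rho w a x * (w x * sqn (u m x))); last by ring.
  rewrite ler_peMl ?mulr_ge0 ?w0 ?sqn_ge0 //.
  have : K * expR (- (2 * k * L)) <= K * rho w a x by rewrite ler_pM2l.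
  by rewrite -expRD subrr expR0.
have km : 0 < k^-1 ^+ m by rewrite exprn_gt0 // invr_gt0.
have S' : indef (fun x => w x * sqn (u m x)) t <= K ^+ 2 * L * (k^-1 ^+ m) ^+ 2.
  apply: le_trans S _; have := le_trans (EK m) E0.
  rewrite mulrC -ler_pdivlMr ?exprn_gt0 // => EE.
  apply: le_trans (_ : K * (K * L / k ^+ (2 * m)) <= _); first by rewrite ler_pM2l.
  by rewrite mulnC exprM -!exprVn; rewrite le_eqVlt; apply/orP; left; apply/eqP; ring.
rewrite mx_integral_entry.
have Lm := bvp_integrable s m i j.
have Labs : L1 D (fun x => `|(A x *m bvp s m x) i j|) := L1_abs Lm.
have := norm_indefB Lm (lexx 0) t0 (lexx t).
rewrite !(indef0 t0) // !subr0 => hn; apply: le_trans hn _.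
pose e := k^-1 ^+ m.
apply: le_trans (_ : indef (fun x => e / 2 * w x + e^-1 / 2 * (w x * sqn (u m x))) t <= _).
  apply: (le_indef t0) => //; first exact: (L1D mD (L1Z mD (e / 2) hw) (L1Z mD (e^-1 / 2) (LS
    m))).
  move=> x xt; rewrite (_ : (A x *m bvp s m x) i j = (A x *m u m x) i 0);
    last exact: mulmx_col_entry.
  apply: le_trans (spectral_entry _ _ _ km) _; rewrite le_eqVlt; apply/orP; left; apply/eqP.
  rewrite -/e /opnorm; ring.
rewrite (indefD (L1Z mD _ hw) (L1Z mD _ (LS m)) tt) (indefZ _ hw tt) (indefZ _ (LS m) tt).
apply: le_trans (_ : e / 2 * L + e^-1 / 2 * (K ^+ 2 * L * e ^+ 2) <= _).
  by rewrite lerD2l ler_pM2l // divr_gt0 // invr_gt0.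
rewrite -/e le_eqVlt; apply/orP; left; apply/eqP; field; exact: lt0r_neq0.
Qed.
End bvp.

(** * Formal power series with matrix coefficients *)

(** A truncated Cauchy product by total degree; the second bound [M] fits the square of indices of a
    product of two truncated series. *)
Lemma sum_triangle (V : nmodType) (N M : nat) (F : nat -> nat -> V) : (N <= M)%N ->
  \sum_(k < N) \sum_(m < k.+1) F m (k - m)%N =
  \sum_(m < M) \sum_(j < M | (m + j < N)%N) F m j.
Proof.
move=> NM.
transitivity (\sum_(k < N) \sum_(m < M) \sum_(j < M | (m + j == k)%N) F m j).
  apply: eq_bigr => k _.
  rewrite (big_ord_widen M (fun m => F m (k - m)%N)); last by rewrite (leq_trans (ltn_ord k)).
  rewrite big_mkcond; apply: eq_bigr => m _; case: ifP => mk.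
    have h : (k - m < M)%N by apply: leq_ltn_trans (leq_subr _ _) (leq_trans (ltn_ord k) NM).
    rewrite (big_pred1 (Ordinal h)) // => j /=; rewrite -val_eqE /=; lia.
  by rewrite big1 // => j; move/eqP; lia.
rewrite exchange_big; apply: eq_bigr => m _.
rewrite (exchange_big_dep (fun j : 'I_M => (m + j < N)%N)) /=; last first.
  by move=> k j _ /eqP ->; exact: ltn_ord.
by apply: eq_bigr => j mj; rewrite (big_pred1 (Ordinal mj)).
Qed.

Section adjoint.
Variable A : pzRingType.
Implicit Types u v : A.

Definition adr u v := u * v - v * u.

(* ((D + R)^k - R^k) / D for the commuting operators D = adr u and R = right multiplication
   by u. *)
Lemma iter_adr_power u v k :
  \sum_(i < k) u ^+ i * v * u ^+ (k - i.+1) =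
  \sum_(m < k) (iter m (adr u) v * u ^+ (k - m.+1)) *+ 'C(k, m.+1).
Proof.
elim: k => [|k IH]; first by rewrite !big_ord0.
rewrite big_ord_recl /= mul1r subn1 /=.
under eq_bigr => i _ do rewrite /bump /= add1n exprS -!mulrA subSS mulrA.
have -> : \sum_(i < k) u * u ^+ i * (v * u ^+ (k - i.+1)) =
    u * \sum_(i < k) u ^+ i * v * u ^+ (k - i.+1).
  by rewrite mulr_sumr; apply: eq_bigr => i _; rewrite !mulrA.
rewrite IH mulr_sumr.
(* Left multiplication by [u] is D + R; the shift in [m] that it causes is absorbed by Pascal's
   rule. *)
have step m j : u * (iter m (adr u) v * u ^+ j) =
    iter m.+1 (adr u) v * u ^+ j + iter m (adr u) v * u ^+ j.+1.
  by rewrite /= /adr mulrBl -!mulrA -exprS subrK.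
rewrite [X in _ + X](eq_bigr (fun m : 'I_k => (iter m.+1 (adr u) v * u ^+ (k - m.+1)) *+ 'C(k,
  m.+1)
    + (iter m (adr u) v * u ^+ (k - m.+1).+1) *+ 'C(k, m.+1))); last first.
  by move=> m _; rewrite mulrnAr step mulrnDl.
rewrite big_split /=.
rewrite [RHS](eq_bigr (fun m : 'I_k.+1 => (iter m (adr u) v * u ^+ (k - m)) *+ 'C(k, m.+1) +
   (iter m (adr u) v * u ^+ (k - m)) *+ 'C(k, m))); last first.
  by move=> m _; rewrite subSS binS mulrnDr.
rewrite big_split /= [X in _ = X + _]big_ord_recr /= bin_small // mulr0n addr0.
rewrite [X in _ = _ + X]big_ord_recl /= bin0 mulr1n subn0 addrA [RHS]addrC.
congr (_ + _ + _); apply: eq_bigr => m _.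
by rewrite -subSn // subSS.
Qed.
End adjoint.

Section series.
Variables (R : realType) (n : nat).
Local Notation P := {poly R}.
Local Notation V := 'M[P]_n.+1.
Implicit Types (U W Z u v a : V) (M : 'M[R]_n.+1).

(* A square matrix over {poly R} stands for a power series in 'X with matrix
   coefficients; [coefmx k U] is the coefficient of 'X^k, and [ord_ge m U] says
   that U is O('X^m). *)
Definition coefmx (k : nat) U : 'M[R]_n.+1 := \matrix_(i, j) (U i j)`_k.
Definition ord_ge (m : nat) U := exists W, U = 'X^m *: W.
Definition constmx M : V := map_mx polyC M.

Lemma coefmxD k U W : coefmx k (U + W) = coefmx k U + coefmx k W.
Proof. by apply/matrixP => i j; rewrite !mxE coefD. Qed.

Lemma coefmxB k U W : coefmx k (U - W) = coefmx k U - coefmx k W.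
Proof. by apply/matrixP => i j; rewrite !mxE coefB. Qed.

Lemma coefmx0 k : coefmx k 0 = 0.
Proof. by apply/matrixP => i j; rewrite !mxE coef0. Qed.

Lemma coefmx_sum k (I : Type) (r : seq I) (Q : pred I) (F : I -> V) :
  coefmx k (\sum_(i <- r | Q i) F i) = \sum_(i <- r | Q i) coefmx k (F i).
Proof.
apply: (big_morph (coefmx k)); [exact: coefmxD|exact: coefmx0].
Qed.

Lemma coefmxZ k (c : R) U : coefmx k (c%:P *: U) = c *: coefmx k U.
Proof. by apply/matrixP => i j; rewrite !mxE coefCM. Qed.

Lemma coefmxXnZ k m U : coefmx k ('X^m *: U) = if (k < m)%N then 0 else coefmx (k - m) U.
Proof. by apply/matrixP => i j; rewrite !mxE coefXnM; case: ifP; rewrite !mxE. Qed.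

Lemma coefmxM k U W : coefmx k (U * W) = \sum_(l < k.+1) coefmx l U * coefmx (k - l) W.
Proof.
apply/matrixP => i j; rewrite !mxE coef_sum summxE.
under eq_bigr do rewrite coefM.
rewrite exchange_big; apply: eq_bigr => l _; rewrite mxE.
by apply: eq_bigr => m _; rewrite !mxE.
Qed.

Lemma coefmx_const k M : coefmx k (constmx M) = if k == 0%N then M else 0.
Proof. by apply/matrixP => i j; rewrite !mxE coefC; case: ifP => // _; rewrite mxE. Qed.

Lemma coefmx1 k : coefmx k (1 : V) = if k == 0%N then 1 else 0.
Proof. by rewrite -coefmx_const /constmx -[in RHS]idmxE map_mx1. Qed.

Lemma ord_geE m U k : ord_ge m U -> (k < m)%N -> coefmx k U = 0.
Proof. by move=> [W ->] km; rewrite coefmxXnZ km. Qed.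

Lemma ord_geP m U : (forall k, (k < m)%N -> coefmx k U = 0) -> ord_ge m U.
Proof.
move=> h; exists (map_mx (drop_poly m) U); apply/matrixP => i j; rewrite !mxE.
apply/polyP => k; rewrite coefXnM; case: ifP => km.
  by have /matrixP/(_ i j) := h k km; rewrite !mxE.
by rewrite coef_drop_poly subnK // leqNgt km.
Qed.

Lemma ord_ge_0 m : ord_ge m 0.
Proof. by exists 0; rewrite scaler0. Qed.
Lemma ord_geD m U W : ord_ge m U -> ord_ge m W -> ord_ge m (U + W).
Proof. by move=> [U' ->] [W' ->]; exists (U' + W'); rewrite scalerDr. Qed.
Lemma ord_geZ m c U : ord_ge m U -> ord_ge m (c *: U).
Proof. by move=> [U' ->]; exists (c *: U'); rewrite !scalerA mulrC. Qed.
Lemma ord_geN m U : ord_ge m U -> ord_ge m (- U).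
Proof. by move=> /(ord_geZ (-1)); rewrite scaleN1r. Qed.
Lemma ord_geB m U W : ord_ge m U -> ord_ge m W -> ord_ge m (U - W).
Proof. by move=> hU hW; apply: ord_geD => //; apply: ord_geN. Qed.
Lemma ord_ge_sum m (I : Type) (r : seq I) (Q : pred I) (F : I -> V) :
  (forall i, Q i -> ord_ge m (F i)) -> ord_ge m (\sum_(i <- r | Q i) F i).
Proof.
by move=> h; apply: (big_ind (ord_ge m)) => //; [exact: ord_ge_0|exact: ord_geD].
Qed.
Lemma ord_ge_le m k U : (k <= m)%N -> ord_ge m U -> ord_ge k U.
Proof.
move=> km [W ->]; exists ('X^(m - k) *: W).
by rewrite scalerA -exprD subnKC.
Qed.
Lemma ord_geM m k U W : ord_ge m U -> ord_ge k W -> ord_ge (m + k) (U * W).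
Proof.
move=> [U' ->] [W' ->]; exists (U' * W').
by rewrite -scalerAl -scalerAr scalerA exprD.
Qed.
Lemma ord_ge_triv U : ord_ge 0 U.
Proof. by exists U; rewrite expr0 scale1r. Qed.
Lemma ord_geMl m U W : ord_ge m U -> ord_ge m (U * W).
Proof. by move=> h; have := ord_geM h (ord_ge_triv W); rewrite addn0. Qed.
Lemma ord_geMr m U W : ord_ge m W -> ord_ge m (U * W).
Proof. by move=> h; have := ord_geM (ord_ge_triv U) h. Qed.
Lemma ord_geX k U : ord_ge 1 U -> ord_ge k (U ^+ k).
Proof.
move=> h; elim: k => [|k IH]; first exact: ord_ge_triv.
by rewrite exprS -add1n; apply: ord_geM.
Qed.
Lemma ord_ge_adr m u v : ord_ge 1 u -> ord_ge m v -> ord_ge m.+1 (adr u v).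
Proof.
move=> hu hv; apply: ord_geB; first by rewrite -add1n; apply: ord_geM.
by rewrite -addn1; apply: ord_geM.
Qed.
Lemma ord_ge_iter_adr m k u v : ord_ge 1 u -> ord_ge m v -> ord_ge (m + k) (iter k (adr u) v).
Proof.
move=> hu hv; elim: k => [|k IH]; first by rewrite addn0.
by rewrite addnS; apply: ord_ge_adr.
Qed.
Lemma ord_ge_eq m U W k : ord_ge m (U - W) -> (k < m)%N -> coefmx k U = coefmx k W.
Proof.
by move=> h km; apply/eqP; rewrite -subr_eq0 -coefmxB (ord_geE h km).
Qed.

Lemma adrD u U W : adr u (U + W) = adr u U + adr u W.
Proof. rewrite /adr mulrDr mulrDl opprD; exact: addrACA. Qed.
Lemma adrZ u c U : adr u (c *: U) = c *: adr u U.
Proof. by rewrite /adr -scalerAr -scalerAl -scalerBr. Qed.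
Lemma iter_adrD k u U W : iter k (adr u) (U + W) = iter k (adr u) U + iter k (adr u) W.
Proof. by elim: k => //= k ->; rewrite adrD. Qed.
Lemma iter_adrZ k u c U : iter k (adr u) (c *: U) = c *: iter k (adr u) U.
Proof. by elim: k => //= k ->; rewrite adrZ. Qed.
Lemma iter_adr0 k u : iter k (adr u) 0 = 0.
Proof. by elim: k => //= k ->; rewrite /adr mulr0 mul0r subrr. Qed.
Lemma iter_adr_sum k u (I : Type) (r : seq I) (Q : pred I) (F : I -> V) :
  iter k (adr u) (\sum_(i <- r | Q i) F i) = \sum_(i <- r | Q i) iter k (adr u) (F i).
Proof.
by apply: (big_morph (iter k (adr u))); [exact: iter_adrD|exact: iter_adr0].
Qed.

(* Truncations of exp u, of the differential of exp at u in the direction v, and of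
   ((exp ad_u - 1) / ad_u) v. *)
Definition exp_trunc (N : nat) u : V := \sum_(k < N.+1) (k`!%:R^-1)%:P *: u ^+ k.
Definition dexp_trunc (N : nat) u v : V :=
  \sum_(k < N.+1) (k`!%:R^-1)%:P *: \sum_(i < k) u ^+ i * v * u ^+ (k - i.+1).
Definition phi_ad (N : nat) u v : V :=
  \sum_(m < N.+1) (m.+1`!%:R^-1)%:P *: iter m (adr u) v.

(** Since 'C(k, m+1) / k! = 1 / ((m+1)! (k-m-1)!), [iter_adr_power] turns the differential of exp
    into a Cauchy product. The products that truncation leaves over have m + j >= N, hence order
    above N because [v] itself has order 1. *)
Lemma dexp_truncE N u v : ord_ge 1 u -> ord_ge 1 v ->
  ord_ge N.+1 (dexp_trunc N u v - phi_ad N u v * exp_trunc N u).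
Proof.
move=> hu hv.
pose F m j : V := ((m.+1`!%:R^-1)%:P * (j`!%:R^-1)%:P) *: (iter m (adr u) v * u ^+ j).
have oF m j : ord_ge (m + j).+1 (F m j).
  apply: ord_geZ; rewrite -add1n addnA; apply: ord_geM; last exact: ord_geX.
  exact: ord_ge_iter_adr.
have -> : phi_ad N u v * exp_trunc N u = \sum_(m < N.+1) \sum_(j < N.+1) F m j.
  rewrite /phi_ad mulr_suml; apply: eq_bigr => m _.
  rewrite /exp_trunc mulr_sumr; apply: eq_bigr => j _.
  by rewrite -scalerAl -scalerAr scalerA.
have -> : dexp_trunc N u v = \sum_(m < N.+1) \sum_(j < N.+1 | (m + j < N)%N) F m j.
  rewrite /dexp_trunc big_ord_recl big_ord0 scaler0 add0r.
  rewrite -sum_triangle //; apply: eq_bigr => k _; rewrite lift0.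
  rewrite iter_adr_power scaler_sumr; apply: eq_bigr => m _.
  rewrite /F subSS -scalerMnr scalerMnl; congr (_ *: _).
  rewrite -polyCM -rmorphMn /= -mulr_natr; congr (_%:P).
  have nz q : q`!%:R != 0 :> R by rewrite pnatr_eq0 -lt0n fact_gt0.
  have mk : (m.+1 <= k.+1)%N by exact: ltn_ord.
  rewrite -(bin_fact mk) subSS natrM [(_ * (k - m)`!)%:R]natrM.
  have : 'C(k.+1, m.+1)%:R != 0 :> R by rewrite pnatr_eq0 -lt0n bin_gt0.
  have := nz (k - m)%N; have := nz m.+1.
  move: ('C(_, _)%:R) (m.+1`!%:R) ((k - m)`!%:R) => x y z y0 z0 x0.
  by field; rewrite x0 y0 z0.
rewrite -sumrB; apply: ord_ge_sum => m _.
rewrite [X in _ - X](bigID (fun j : 'I_N.+1 => (m + j < N)%N)) /= opprD addNKr.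
apply: ord_geN; apply: ord_ge_sum => j; rewrite -leqNgt => h.
by apply: ord_ge_le (oF m j).
Qed.

(** This is [bernoulli_number_gf] with ad_u substituted for x. Every ad_u raises the order by one,
    so the substitution is legitimate and the truncation errors have order above [N]. *)
Lemma phi_ad_bernoulli N u v a : ord_ge 1 u -> ord_ge 1 a ->
  ord_ge N.+1 (v - \sum_(j < N.+1) ((bernoulli_number R j / j`!%:R)%:P *: iter j (adr u) a)) ->
  ord_ge N.+1 (phi_ad N u v - a).
Proof.
move=> hu ha hv.
set b := \sum_(j < _) _ in hv.
have h1 : ord_ge N.+1 (phi_ad N u v - phi_ad N u b).
  rewrite /phi_ad -sumrB; apply: ord_ge_sum => m _; rewrite -scalerBr; apply: ord_geZ.
  rewrite -scaleN1r -iter_adrZ -iter_adrD scaleN1r.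
  by apply: (ord_ge_le (leq_addr m N.+1)); apply: ord_ge_iter_adr.
pose F j m : V := ((bernoulli_number R j / j`!%:R) * (m.+1`!%:R^-1))%:P *: iter (m + j) (adr
  u) a.
have oF m j : ord_ge (m + j).+1 (F m j).
  by apply: ord_geZ; rewrite addnC -add1n; apply: ord_ge_iter_adr.
have E : phi_ad N u b = \sum_(j < N.+1) \sum_(m < N.+1) F j m.
  rewrite exchange_big /phi_ad; apply: eq_bigr => m _.
  rewrite iter_adr_sum scaler_sumr; apply: eq_bigr => j _.
  by rewrite iter_adrZ scalerA /F -polyCM mulrC -iterD.
have E2 : ord_ge N.+1 (phi_ad N u b - \sum_(j < N.+1) \sum_(m < N.+1 | (j + m < N)%N) F j m).
  rewrite E -sumrB; apply: ord_ge_sum => m _.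
  rewrite [X in X - _](bigID (fun j : 'I_N.+1 => (m + j < N)%N)) /= addrAC subrr add0r.
  apply: ord_ge_sum => j; rewrite -leqNgt => h.
  by apply: ord_ge_le (oF m j).
rewrite -(subrKA (phi_ad N u b)); apply: ord_geD => //.
rewrite -(subrKA (\sum_(j < N.+1) \sum_(m < N.+1 | (j + m < N)%N) F j m)).
apply: ord_geD => //; rewrite -sum_triangle //.
have -> : \sum_(k < N) \sum_(m < k.+1) F m (k - m)%N = \sum_(k < N) (((k == 0%N :>
  nat))%:R)%:P *: iter k (adr u) a.
  apply: eq_bigr => k _; rewrite -bernoulli_number_gf rmorph_sum scaler_suml /=.
  apply: eq_bigr => m _; rewrite /F.
  have mk : (m <= k)%N by rewrite -ltnS ltn_ord.
  by rewrite subnK // -subSn.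
case: N {h1 E E2 hv b} => [|N]; first by rewrite big_ord0 sub0r; apply: ord_geN.
rewrite big_ord_recl /= scale1r big1 ?addr0 ?subrr; last by move=> k _; rewrite scale0r.
exact: ord_ge_0.
Qed.
End series.

(** * Formal logarithm and resolvent *)

Section formal_log.
Variables (R : realType) (n : nat).
Local Notation P := {poly R}.
Local Notation V := 'M[P]_n.+1.

Definition exp_poly (N : nat) : P := \poly_(k < N.+1) k`!%:R^-1.
(** Truncation of log(1 + p), not of log p. *)
Definition log_poly (N : nat) (p : P) : P :=
  \sum_(k < N) ((-1) ^+ k / k.+1%:R) *: p ^+ k.+1.

Lemma deriv_exp_poly N : (exp_poly N.+1)^`() = exp_poly N.
Proof.
apply/polyP => k; rewrite coef_deriv !coef_poly ltnS.
case: ifP => // _; last by rewrite mul0rn.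
have k0 : k.+1%:R != 0 :> R by rewrite pnatr_eq0.
have f0 : k`!%:R != 0 :> R by rewrite pnatr_eq0 -lt0n fact_gt0.
rewrite -[LHS]mulr_natr factS natrM; move: k0 f0; move: (k.+1%:R) (k`!%:R) => x y x0 y0.
by field; rewrite x0 y0.
Qed.

Lemma exp_polyS N : exp_poly N.+1 = exp_poly N + (N.+1`!%:R^-1)%:P * 'X^(N.+1).
Proof.
apply/polyP => k; rewrite coefD coefCM coefXn !coef_poly.
rewrite [(k < N.+2)%N]ltnS; case: (ltngtP k N.+1) => kN /=; by rewrite ?mulr0 ?addr0 ?mulr1
  ?add0r ?kN.
Qed.

Lemma exp_poly_sub1 N : exists q, exp_poly N - 1 = 'X * q.
Proof.
exists (drop_poly 1 (exp_poly N)); apply/polyP => -[|k].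
  by rewrite coefB coef_poly coef1 coefXM /= fact0 invr1 subrr.
by rewrite coefB coef1 subr0 coefXM /= coef_drop_poly addn1.
Qed.

Lemma deriv_log_poly N p : (log_poly N p)^`() = p^`() * \sum_(k < N) (- p) ^+ k.
Proof.
rewrite /log_poly (big_morph _ (@derivD R) (@deriv0 R)) mulr_sumr; apply: eq_bigr => k _.
rewrite derivZ deriv_exp /= -scalerMnr scalerMnl -[_ *+ k.+1]mulr_natr divfK ?pnatr_eq0 //.
by rewrite [(- p) ^+ k]exprNn -mul_polyC rmorphXn rmorphN1 mulrCA.
Qed.

(** The derivative of the left-hand side is exp times a truncated geometric series for 1 / exp, thus
    1 up to high order. In characteristic 0 the derivative and the vanishing constant term determine
    the coefficients. *)
Lemma log_exp_poly N : exists r, log_poly N (exp_poly N - 1) = 'X + 'X^(N.+1) * r :> P.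
Proof.
case: N => [|N].
  by exists (-1); rewrite /log_poly big_ord0 expr1 mulrN1 subrr.
set f := log_poly _ _.
have [q eq] := exp_poly_sub1 N.+1.
have [r hr] : exists r, f^`() = 1 + 'X^(N.+1) * r.
  rewrite /f deriv_log_poly derivB derivC subr0 deriv_exp_poly.
  set z := - (_ - 1); set s := \sum_(k < _) _.
  have zs : (1 - z) * s = 1 - z ^+ N.+1.
    by rewrite -[RHS]opprB subrX1 -/s -mulNr opprB.
  have ez : exp_poly N = (1 - z) - (N.+1`!%:R^-1)%:P * 'X^(N.+1).
    by rewrite /z opprK subrKC exp_polyS addrK.
  rewrite ez mulrBl zs.
  have -> : z ^+ N.+1 = 'X^(N.+1) * (- q) ^+ N.+1.
    by rewrite -exprMn mulrN -eq.
  by exists (- (- q) ^+ N.+1 - (N.+1`!%:R^-1)%:P * s); ring.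
exists (drop_poly N.+2 f); apply/polyP => k.
rewrite coefD coefX coefXnM; case: ltnP => kN; last first.
  rewrite coef_drop_poly subnK // (_ : (k == 1)%N = false) ?add0r //.
  by apply/eqP => k1; rewrite k1 in kN.
rewrite addr0; case: k kN => [|k] kN /=.
  rewrite /f /log_poly coef_sum big1 // => i _.
  by rewrite coefZ eq exprMn coefXnM /= mulr0.
have := congr1 (fun p : P => p`_k) hr.
rewrite coef_deriv coefD coef1 coefXnM; rewrite ltnS in kN; rewrite kN addr0 eqSS => h.
have k0 : k.+1%:R != 0 :> R by rewrite pnatr_eq0.
apply: (mulIf k0); rewrite mulr_natr h; by case: eqP => [->|]; rewrite ?mulr1 ?mul0r.
Qed.

(** Substitutes the matrix series [u] for the variable of a scalar polynomial, whose coefficients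
    become constant series. Scalar identities carry over because the powers of [u] commute. *)
Definition lift_poly (u : V) (p : P) : V := horner_mx u (map_poly polyC p).

Lemma lift_polyD u p q : lift_poly u (p + q) = lift_poly u p + lift_poly u q.
Proof. by rewrite /lift_poly !rmorphD. Qed.
Lemma lift_polyM u p q : lift_poly u (p * q) = lift_poly u p * lift_poly u q.
Proof. by rewrite /lift_poly !rmorphM. Qed.
Lemma lift_poly1 u : lift_poly u 1 = 1.
Proof. by rewrite /lift_poly !rmorph1. Qed.
Lemma lift_poly0 u : lift_poly u 0 = 0.
Proof. by rewrite /lift_poly !rmorph0. Qed.
Lemma lift_polyN u p : lift_poly u (- p) = - lift_poly u p.
Proof. by rewrite /lift_poly !rmorphN. Qed.
Lemma lift_polyX u : lift_poly u 'X = u.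
Proof. by rewrite /lift_poly map_polyX horner_mx_X. Qed.
Lemma lift_polyXn u p k : lift_poly u (p ^+ k) = lift_poly u p ^+ k.
Proof. by rewrite /lift_poly !rmorphXn. Qed.
Lemma lift_polyZ u c p : lift_poly u (c *: p) = c%:P *: lift_poly u p.
Proof. by rewrite /lift_poly map_polyZ /= horner_mxZ. Qed.
Lemma lift_poly_sum u (I : Type) (r : seq I) (Q : pred I) (F : I -> P) :
  lift_poly u (\sum_(i <- r | Q i) F i) = \sum_(i <- r | Q i) lift_poly u (F i).
Proof. by apply: (big_morph (lift_poly u)); [exact: lift_polyD|exact: lift_poly0]. Qed.

Lemma exp_truncE N (u : V) : exp_trunc N u = lift_poly u (exp_poly N).
Proof.
rewrite /exp_poly poly_def lift_poly_sum; apply: eq_bigr => k _.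
by rewrite lift_polyZ lift_polyXn lift_polyX.
Qed.

Definition log_trunc (N : nat) (W : V) : V :=
  \sum_(k < N) ((-1) ^+ k / k.+1%:R)%:P *: W ^+ k.+1.

Lemma log_exp_trunc N (u : V) : ord_ge 1 u ->
  ord_ge N.+1 (log_trunc N (exp_trunc N u - 1) - u).
Proof.
move=> hu; have [r hr] := log_exp_poly N.
have -> : log_trunc N (exp_trunc N u - 1) = lift_poly u (log_poly N (exp_poly N - 1)).
  rewrite /log_poly lift_poly_sum; apply: eq_bigr => k _.
  by rewrite lift_polyZ lift_polyXn lift_polyD lift_polyN lift_poly1 exp_truncE.
rewrite hr lift_polyD lift_polyX addrC addKr lift_polyM lift_polyXn lift_polyX.
by apply: ord_geMl; apply: ord_geX.
Qed.

Lemma exp_trunc_sub1 N (u : V) : ord_ge 1 u -> ord_ge 1 (exp_trunc N u - 1).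
Proof.
move=> hu; have [q hq] := exp_poly_sub1 N.
rewrite exp_truncE -(lift_poly1 u) -lift_polyN -lift_polyD hq lift_polyM lift_polyX.
exact: ord_geMl.
Qed.

(* C is the formal inverse of 1 + s W. *)
Lemma resolvent_trunc N (s : R) (W C : V) : ord_ge 1 W ->
  ord_ge N.+1 (C - (1 - s%:P *: (W * C))) ->
  ord_ge N.+1 (W * C - \sum_(k < N) ((- s) ^+ k)%:P *: W ^+ k.+1).
Proof.
move=> hW hC.
pose z : V := - (s%:P *: W).
have hz : ord_ge 1 z by apply: ord_geN; apply: ord_geZ.
pose S := \sum_(k < N) z ^+ k.
have E1 : \sum_(k < N) ((- s) ^+ k)%:P *: W ^+ k.+1 = W * S.
  rewrite mulr_sumr; apply: eq_bigr => k _.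
  by rewrite exprS scalerAr /z -scaleNr exprZn -rmorphN -rmorphXn.
have zS : S * (1 - z) = 1 - z ^+ N.
  have c : GRing.comm S (1 - z).
    apply: commrB; first exact: commr1.
    by apply: commr_sym; apply: commr_sum => k _; apply: commrX.
  by rewrite c -[RHS]opprB subrX1 -/S -mulNr opprB.
rewrite E1.
have hD : ord_ge N.+1 ((1 - z) * C - 1).
  suff <- : C - (1 - s%:P *: (W * C)) = (1 - z) * C - 1 by [].
  by rewrite /z opprK mulrDl mul1r -scalerAl opprB addrA addrAC.
have -> : W * C - W * S = W * (S * ((1 - z) * C - 1)) + W * (z ^+ N * C).
  rewrite -mulrBr -mulrDr; congr (W * _).
  by rewrite mulrBr mulr1 mulrA zS mulrBl mul1r addrAC subrK.
apply: ord_geD; first by do 2 apply: ord_geMr.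
by rewrite -add1n; apply: ord_geM => //; apply: ord_geMl; apply: ord_geX.
Qed.
End formal_log.

Section composition_sums.
Variables (R : realType) (n : nat).
Local Notation P := {poly R}.
Local Notation V := 'M[P]_n.+1.

Lemma big_tupleS (T : finType) (X : nmodType) k (Q : pred (k.+1.-tuple T)) (F : k.+1.-tuple T
  -> X) :
  \sum_(t | Q t) F t =
  \sum_(i : T) \sum_(t : k.-tuple T | Q [tuple of i :: t]) F [tuple of i :: t].
Proof.
rewrite pair_big_dep /= (reindex (fun p : T * k.-tuple T => [tuple of p.1 :: p.2])) //=.
exists (fun t => (thead t, [tuple of behead t])) => [[i t] _|t _] /=.
  by congr pair; apply: val_inj.
by rewrite -tuple_eta.
Qed.

(** Induction on [k]: the outermost ad_u contributes a degree [i], which becomes the head of the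
    composition. Parts equal to 0 drop out since [Om 0] is zero, and parts larger than [q] cannot
    occur. *)
Lemma coefmx_iter_adr (m : nat) (Om : nat -> 'M[R]_n.+1) (A : 'M[R]_n.+1) (u : V) :
  Om 0%N = 0 -> (forall l, (l < m)%N -> coefmx l u = Om l) ->
  forall k q, (q < m)%N ->
  coefmx q (iter k (adr u) (constmx A)) =
  \sum_(t : k.-tuple 'I_m | all (fun i : 'I_m => 0 < i)%N t && (\sum_(i <- t) i == q)%N)
     foldr (fun i : 'I_m => admx (Om i)) A t.
Proof.
move=> Om0 uE; elim=> [|k IH] q qm.
  rewrite /= coefmx_const; case: eqP => [->|q0].
    by rewrite (big_pred1 [tuple]) // => t; rewrite (tuple0 t) [RHS]eqxx /= big_nil.
  rewrite big1 // => t; rewrite (tuple0 t) /= big_nil => /eqP h; by case: q0.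
rewrite /= {1}/adr coefmxB !coefmxM.
set Z := iter k (adr u) (constmx A).
have -> : \sum_(l < q.+1) coefmx l u * coefmx (q - l) Z -
    \sum_(l < q.+1) coefmx l Z * coefmx (q - l) u =
    \sum_(l < q.+1) admx (Om l) (coefmx (q - l) Z).
  rewrite [X in _ - X](reindex_inj rev_ord_inj) /= -sumrB; apply: eq_bigr => l _.
  have lq : (l <= q)%N by rewrite -ltnS.
  rewrite subSS subKn // uE; last by rewrite (leq_ltn_trans lq).
  by rewrite /admx.
rewrite big_tupleS.
rewrite (big_ord_widen m (fun l => admx (Om l) (coefmx (q - l) Z))) // big_mkcond /=.
apply: eq_bigr => i _; case: ifP => iq; last first.
  by rewrite big1 // => t /andP[_]; rewrite big_cons => /eqP; lia.
rewrite IH; last by rewrite (leq_ltn_trans (leq_subr _ _)).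
have [i0|i0] := posnP i.
  by rewrite i0 Om0 /admx mul0mx mulmx0 subrr big1.
rewrite {1}/admx mulmx_sumr mulmx_suml -sumrB; apply: eq_big => [t|t _] //=.
rewrite big_cons; congr (_ && _); apply/eqP/eqP; lia.
Qed.
End composition_sums.

(** * Magnus terms as coefficients of a logarithm *)

Section matrix_ode.
Variables (R : realType) (t : R).
Hypothesis t0 : 0 <= t.
Local Notation D := (`[0, t]%classic).
Variable n : nat.
Local Notation M := 'M[R]_n.+1.
Local Notation P := {poly R}.
Local Notation V := 'M[P]_n.+1.
Let mD := @lmeasurable_itv R `[0, t].

Lemma mxPrim_eq (F G f g : R -> M) : (forall s, 0 <= s <= t -> F s = G s) ->
  (forall s, 0 <= s <= t -> f s = g s) -> mxPrim t F f -> mxPrim t G g.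
Proof.
move=> FG fg h i j; apply: (prim_eq t0 _ _ (h i j)) => s st; first by rewrite FG.
by rewrite fg.
Qed.

Lemma mxPrim_cst (B : M) : mxPrim t (fun=> B) (fun=> 0).
Proof. by move=> i j; apply: (prim_eq t0 _ _ (prim_cst t (B i j))) => s _ //; rewrite mxE. Qed.

Lemma mxPrimD (F G f g : R -> M) : mxPrim t F f -> mxPrim t G g ->
  mxPrim t (fun x => F x + G x) (fun x => f x + g x).
Proof.
by move=> hF hG i j; apply: (prim_eq t0 _ _ (primD (hF i j) (hG i j))) => s _; rewrite mxE.
Qed.

Lemma mxPrimZ c (F f : R -> M) : mxPrim t F f -> mxPrim t (fun x => c *: F x) (fun x => c *: f
  x).
Proof.
by move=> hF i j; apply: (prim_eq t0 _ _ (primZ c (hF i j))) => s _; rewrite mxE.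
Qed.

Lemma mxPrim_sum (I : Type) (r : seq I) (Q : pred I) (F f : I -> R -> M) :
  (forall i, Q i -> mxPrim t (F i) (f i)) ->
  mxPrim t (fun x => \sum_(i <- r | Q i) F i x) (fun x => \sum_(i <- r | Q i) f i x).
Proof.
move=> h i j; have h' k : Q k -> Prim t (fun x => F k x i j) (fun x => f k x i j).
  by move=> Qk; apply: h.
have hs := @prim_sum _ t t0 _ r Q (fun k x => F k x i j) (fun k x => f k x i j) h'.
by apply: (prim_eq t0 _ _ hs) => s _; rewrite summxE.
Qed.

Lemma mxPrimM (F G f g : R -> M) : mxPrim t F f -> mxPrim t G g ->
  mxPrim t (fun x => F x * G x) (fun x => f x * G x + F x * g x).
Proof.
move=> hF hG i j.
have h (k : 'I_n.+1) : true -> Prim t (fun x => F x i k * G x k j) (fun x => f x i k * G x k j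
  + F x i k * g x k j).
  by move=> _; apply: (primM t0 (hF i k) (hG k j)).
have hs := @prim_sum _ t t0 _ (index_enum 'I_n.+1) xpredT (fun k x => F x i k * G x k j) (fun
  k x => f x i k * G x k j + F x i k * g x k j) h.
apply: (prim_eq t0 _ _ hs) => s _; rewrite !mxE //.
by rewrite big_split.
Qed.

Lemma mxPrim_unique (F G f : R -> M) s : mxPrim t F f -> mxPrim t G f -> F 0 = G 0 ->
  0 <= s <= t -> F s = G s.
Proof.
move=> hF hG FG st; apply/matrixP => i j.
by rewrite (primE (hF i j) st) (primE (hG i j) st) FG.
Qed.

Definition serPrim (F f : R -> V) :=
  forall k, mxPrim t (fun x => coefmx k (F x)) (fun x => coefmx k (f x)).

Lemma serPrim_sum (I : Type) (r : seq I) (Q : pred I) (F f : I -> R -> V) :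
  (forall i, Q i -> serPrim (F i) (f i)) ->
  serPrim (fun x => \sum_(i <- r | Q i) F i x) (fun x => \sum_(i <- r | Q i) f i x).
Proof.
move=> h k; have h' i : Q i -> mxPrim t (fun x => coefmx k (F i x)) (fun x => coefmx k (f i x)).
  by move=> Qi; apply: h.
have hs := @mxPrim_sum _ r Q (fun i x => coefmx k (F i x)) (fun i x => coefmx k (f i x)) h'.
by apply: (mxPrim_eq _ _ hs) => s _; rewrite coefmx_sum.
Qed.

Lemma serPrimZ (c : R) (F f : R -> V) : serPrim F f ->
  serPrim (fun x => c%:P *: F x) (fun x => c%:P *: f x).
Proof.
by move=> h k; apply: (mxPrim_eq _ _ (mxPrimZ c (h k))) => s _; rewrite coefmxZ.
Qed.

Lemma serPrimM (F G f g : R -> V) : serPrim F f -> serPrim G g ->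
  serPrim (fun x => F x * G x) (fun x => f x * G x + F x * g x).
Proof.
move=> hF hG k.
have h (l : 'I_k.+1) : true -> mxPrim t (fun x => coefmx l (F x) * coefmx (k - l) (G x))
    (fun x => coefmx l (f x) * coefmx (k - l) (G x) + coefmx l (F x) * coefmx (k - l) (g x)).
  by move=> _; apply: mxPrimM.
have hs := @mxPrim_sum _ (index_enum 'I_k.+1) xpredT (fun l x => coefmx l (F x) * coefmx (k -
  l) (G x))
   (fun l x => coefmx l (f x) * coefmx (k - l) (G x) + coefmx l (F x) * coefmx (k - l) (g x)) h.
apply: (mxPrim_eq _ _ hs) => s _; first by rewrite coefmxM.
by rewrite coefmxD !coefmxM big_split.
Qed.

Lemma serPrim1 : serPrim (fun=> 1) (fun=> 0).
Proof.
by move=> k; apply: (mxPrim_eq _ _ (mxPrim_cst (coefmx k (1 : V)))) => s _ //; rewrite coefmx0.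
Qed.

Lemma serPrim_eq (F f g : R -> V) : (forall x, f x = g x) -> serPrim F f -> serPrim F g.
Proof. by move=> fg h k; apply: (mxPrim_eq _ _ (h k)) => s _ //; rewrite fg. Qed.

Lemma serPrimX (F f : R -> V) k : serPrim F f ->
  serPrim (fun x => F x ^+ k) (fun x => \sum_(i < k) F x ^+ i * f x * F x ^+ (k - i.+1)).
Proof.
move=> hF; elim: k => [|k IH].
  by apply: serPrim_eq serPrim1 => x; rewrite big_ord0.
have := serPrimM hF IH; move=> h q.
apply: (mxPrim_eq _ _ (h q)) => s _; first by rewrite exprS.
rewrite big_ord_recl /= mul1r subn1; congr (coefmx q (_ + _)).
rewrite mulr_sumr; apply: eq_bigr => i _.
by rewrite /bump add1n subSS !mulrA exprS.
Qed.

Lemma serPrim_exp N (F f : R -> V) : serPrim F f ->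
  serPrim (fun x => exp_trunc N (F x)) (fun x => dexp_trunc N (F x) (f x)).
Proof. by move=> hF; apply: serPrim_sum => k _; apply/serPrimZ/serPrimX. Qed.

Definition trunc_series (N : nat) (F : nat -> M) : V :=
  \sum_(k < N.+1) 'X^k *: constmx (F k).

Lemma coefmx_trunc_series N F k :
  coefmx k (trunc_series N F) = if (k <= N)%N then F k else 0.
Proof.
rewrite /trunc_series coefmx_sum.
have h (i : 'I_N.+1) : coefmx k ('X^i *: constmx (F i)) = if (i == k :> nat) then F i else 0.
  rewrite coefmxXnZ; case: ltngtP => ik //; last by rewrite ik subnn coefmx_const.
  by rewrite coefmx_const subn_eq0 leqNgt ik.
under eq_bigr do rewrite h.
rewrite -big_mkcond /=; case: ifP => kN.
  by rewrite (big_pred1 (Ordinal (kN : (k < N.+1)%N))).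
by rewrite big1 // => i /eqP ik; rewrite -ik -ltnS ltn_ord in kN.
Qed.

Lemma trunc_series_ord1 N F : F 0%N = 0 -> ord_ge 1 (trunc_series N F).
Proof.
by move=> F0; apply: ord_geP => -[|//] _; rewrite coefmx_trunc_series.
Qed.

Lemma serPrim_trunc N (F f : nat -> R -> M) : (forall k, mxPrim t (F k) (f k)) ->
  serPrim (fun x => trunc_series N (F^~ x)) (fun x => trunc_series N (f^~ x)).
Proof.
move=> h k; case kN: (k <= N)%N.
  by apply: (mxPrim_eq _ _ (h k)) => s _; rewrite coefmx_trunc_series kN.
by apply: (mxPrim_eq _ _ (mxPrim_cst 0)) => s _; rewrite coefmx_trunc_series kN.
Qed.

Variable A : R -> M.
Hypothesis hA : mx_integrable D A.

Definition magnus_deriv (k : nat) (x : R) : M :=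
  match k with
  | 0 => 0
  | 1 => A x
  | _ => \sum_(1 <= l < k) (bernoulli_number R l / l`!%:R) *:
    \sum_(j : l.-tuple 'I_k |
            all (fun i : 'I_k => 0 < i)%N j && (\sum_(i <- j) i == k.-1)%N)
       foldr (fun i : 'I_k => admx (magnus_term A i x)) (A x) j
  end.

Lemma admx_integrable (F B : R -> M) : mxbm t F -> mx_integrable D B ->
  mx_integrable D (fun x => admx (F x) (B x)).
Proof.
move=> hF hB i j; rewrite /admx.
have h1 := mx_integrable_mull hB hF i j; have h2 := mx_integrable_mulr hB hF i j.
have := L1D mD h1 (L1Z mD (-1) h2); apply: (L1_eq mD) => x _.
by rewrite !mxE mulN1r.
Qed.

(** Strong induction: the earlier terms are primitives, hence bounded, so their nested commutators
    with [A] are integrable and no default value of an integral intervenes. *)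
Lemma magnus_prim k : mxPrim t (magnus_term A k) (magnus_deriv k).
Proof.
elim/ltn_ind: k => -[_|[_|k IH]].
- exact: mxPrim_cst.
- exact: mx_integral_prim.
have E s : magnus_term A k.+2 s = magnus_step A (magnus_term A) k.+2 s.
  by rewrite magnus_termE.
apply: (mxPrim_eq (fun s _ => esym (E s)) (fun s _ => erefl)).
apply: mxPrim_sum => l _; apply: mxPrimZ; apply: mxPrim_sum => j _.
apply: (mx_integral_prim t0).
elim: (tval j) => [|i s IHs]; first exact: hA.
apply: admx_integrable => //; apply: mxPrim_bm (IH _ (ltn_ord i)); exact: t0.
Qed.

Lemma magnus_term_at0 k : magnus_term A k 0 = 0.
Proof.
have h := magnus_prim k.
case: k h => [|[|k]] h //; first exact: (mx_integral0 t0 hA).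
rewrite magnus_termE // /magnus_step big1 // => l _.
rewrite big1 ?scaler0 // => j _; apply: (mx_integral0 t0).
elim: (tval j) => [|i s IHs]; first exact: hA.
apply: admx_integrable => //; exact: (mxPrim_bm t0 (magnus_prim i)).
Qed.

Local Notation u N x := (trunc_series N ((magnus_term A)^~ x)).

(** The recursion is the coefficientwise form of Omega' = sum_j B_j / j! ad_Omega^j ('X A). The
    factor ['X^1] shifts the degree, which is why compositions of n - 1 occur in the term of degree
    n. *)
Lemma magnus_deriv_series N x :
  ord_ge N.+1 (trunc_series N (magnus_deriv^~ x) -
   \sum_(j < N.+1) ((bernoulli_number R j / j`!%:R)%:P *:
       iter j (adr (u N x)) ('X^1 *: constmx (A x)))).
Proof.
have hu : ord_ge 1 (u N x) by exact: trunc_series_ord1.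
apply: ord_geP => k; rewrite ltnS => kN.
apply/eqP; rewrite coefmxB subr_eq0 coefmx_trunc_series kN coefmx_sum; apply/eqP.
under eq_bigr do rewrite coefmxZ iter_adrZ coefmxXnZ.
case: k kN => [|k] kN; first by rewrite big1 // => j _; rewrite scaler0.
under eq_bigr do rewrite ltnS ltn0 subn1 /=.
(* This vanishing gives the finite range of the outer sum in the recursion. *)
have hz j : (k < j)%N -> coefmx k (iter j (adr (u N x)) (constmx (A x))) = 0.
  move=> kj; apply: (@ord_geE _ _ (0 + j)) => //.
  by apply: ord_ge_iter_adr => //; exact: ord_ge_triv.
rewrite big_ord_recl [iter ord0 _ _]/= coefmx_const.
have -> : bernoulli_number R 0 / (0`!)%:R = 1.
  have := bernoulli_number_rec R 0; rewrite big_ord_recl big_ord0 addr0 /= bin0 mul1r => ->.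
  by rewrite fact0 divr1.
case: k kN hz => [|k] kN hz.
  rewrite scale1r big1 ?addr0 // => j _.
  by rewrite hz ?scaler0 ?lift0.
rewrite scaler0 add0r [LHS]/=.
rewrite -(big_mkord xpredT (fun j => (bernoulli_number R j.+1 / j.+1`!%:R) *:
   coefmx k.+1 (iter j.+1 (adr (u N x)) (constmx (A x))))).
rewrite [RHS](big_cat_nat (n := k.+1)) //; last exact: ltnW.
rewrite [X in _ = _ + X]big_nat_cond [X in _ = _ + X]big1 ?addr0; last first.
  by move=> j /andP[/andP[kj _] _]; rewrite hz ?scaler0 // ltnS.
rewrite big_add1 /= big_nat_cond [RHS]big_nat_cond; apply: eq_bigr => j /andP[/andP[_ jk] _].
congr (_ *: _).
rewrite -[LHS]/(\sum_(i : (j.+1).-tuple 'I_k.+2 | _) _) -iterS.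
rewrite (@coefmx_iter_adr _ _ k.+2 (fun l => magnus_term A l x)) //.
by move=> l lk; rewrite coefmx_trunc_series (leq_trans (ltnW lk) kN).
Qed.
End matrix_ode.

(** * From the boundary value iterates to the decay of the Magnus terms *)

Section magnus_bound.
Variables (R : realType) (t : R).
Hypothesis t0 : 0 <= t.
Local Notation D := (`[0, t]%classic).
Variable n : nat.
Local Notation M := 'M[R]_n.+1.
Local Notation P := {poly R}.
Local Notation V := 'M[P]_n.+1.
Let mD := @lmeasurable_itv R `[0, t].
Variable A : R -> M.
Hypothesis hA : mx_integrable D A.

(** The coefficients Y_k of the formal solution of Y' = 'X A Y. *)
Fixpoint dyson (k : nat) : R -> M :=
  if k is k'.+1 then fun s => mx_integral `[0, s] (fun x => A x *m dyson k' x)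
  else fun=> 1%:M.

Lemma dyson_bm k : mxbm t (dyson k).
Proof.
elim: k => [|k IH]; first exact: mxbm_cst.
exact: (mxPrim_bm t0 (mx_integral_prim t0 (mx_integrable_mulr hA IH))).
Qed.

Lemma dyson_prim k : mxPrim t (dyson k.+1) (fun x => A x *m dyson k x).
Proof. exact: (mx_integral_prim t0 (mx_integrable_mulr hA (dyson_bm k))). Qed.

Lemma dysonS0 k : dyson k.+1 0 = 0.
Proof. exact: (mx_integral0 t0 (mx_integrable_mulr hA (dyson_bm k))). Qed.

Definition magnus_series (N : nat) (x : R) : V := trunc_series N ((magnus_term A)^~ x).
Local Notation E N x := (exp_trunc N (magnus_series N x)).

Lemma magnus_series_ord1 N x : ord_ge 1 (magnus_series N x).
Proof. exact: trunc_series_ord1. Qed.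

Lemma magnus_series0 N : magnus_series N 0 = 0.
Proof.
rewrite /magnus_series /trunc_series big1 // => k _.
by rewrite (magnus_term_at0 t0 hA) /constmx map_mx0 scaler0.
Qed.

(** By [dexp_truncE] and [phi_ad_bernoulli], E' = 'X A E modulo 'X^(N+1) with E = 1 at 0. Read by
    degrees, this is the recursion of [dyson], with the same initial values. *)
Lemma exp_magnus_dyson N k s : (k <= N)%N -> 0 <= s <= t -> coefmx k (E N s) = dyson k s.
Proof.
pose v x := trunc_series N ((magnus_deriv A)^~ x).
have hu : serPrim t (magnus_series N) v := serPrim_trunc t0 N (magnus_prim t0 hA).
have hE := serPrim_exp t0 N hu.
have E0 : E N 0 = 1.
  rewrite magnus_series0 /exp_trunc big_ord_recl big1 ?addr0; last first.
    by move=> i _; rewrite expr0n /= scaler0.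
  by rewrite expr0 /= fact0 invr1 scale1r.
have dE x : ord_ge N.+1 (dexp_trunc N (magnus_series N x) (v x) - 'X^1 *: constmx (A x) * E N
  x).
  have hux := magnus_series_ord1 N x.
  have hvx : ord_ge 1 (v x) by exact: trunc_series_ord1.
  have h1 := dexp_truncE N hux hvx.
  have ha : ord_ge 1 ('X^1 *: constmx (A x)) by exists (constmx (A x)).
  have h2 := phi_ad_bernoulli hux ha (magnus_deriv_series A N x).
  have := ord_geD h1 (ord_geMl (E N x) h2).
  by rewrite mulrBl addrA subrK.
elim: k s => [|k IH] s kN st.
  apply: (@mxPrim_unique _ t _ (fun x => coefmx 0 (E N x)) (fun=> 1%:M) (fun=> 0)) st => //.
  - apply: (mxPrim_eq t0 _ _ (hE 0%N)) => // x _.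
    by rewrite (ord_ge_eq (dE x)) // -scalerAl coefmxXnZ.
  - exact: mxPrim_cst.
  - by rewrite E0 coefmx1.
apply: (@mxPrim_unique _ t _ (fun x => coefmx k.+1 (E N x)) (dyson k.+1) (fun x => A x *m
  dyson k x)) st.
- apply: (mxPrim_eq t0 _ _ (hE k.+1)) => // x xt.
  rewrite (ord_ge_eq (dE x)) // -scalerAl coefmxXnZ ltnS ltn0 subn1 /=.
  rewrite coefmxM big_ord_recl /= coefmx_const subn0 IH ?(ltnW kN) // big1 ?addr0 //.
  by move=> i _; rewrite coefmx_const mul0r.
- exact: dyson_prim.
- by rewrite E0 coefmx1 dysonS0.
Qed.

(** The generating series of the iterates solves the linear equation formally, so it is Y(x) times
    its value at 0. *)
Lemma bvp_dyson s m x : 0 <= x <= t ->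
  bvp t A s m x = \sum_(k < m.+1) dyson k x *m bvp t A s (m - k) 0.
Proof.
elim: m x => [|m IH] x xt.
  by rewrite big_ord_recl big_ord0 addr0 mul1mx.
have dP : mxPrim t (fun x => \sum_(k < m.+2) dyson k x *m bvp t A s (m.+1 - k) 0)
    (fun x => A x *m bvp t A s m x).
  have h (k : 'I_m.+2) : true -> mxPrim t (fun x => dyson k x *m bvp t A s (m.+1 - k) 0)
     (fun x => (if nat_of_ord k is k'.+1 then A x *m dyson k' x else 0) *m bvp t A s (m.+1 -
       k) 0).
    move=> _; have hc := mxPrim_cst t0 (bvp t A s (m.+1 - k) 0).
    have hd : mxPrim t (dyson k) (fun x => if nat_of_ord k is k'.+1 then A x *m dyson k' x
      else 0).
      by case: (nat_of_ord k) => [|k']; [exact: mxPrim_cst|exact: dyson_prim].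
    apply: (mxPrim_eq t0 _ _ (mxPrimM t0 hd hc)) => // y _.
    by rewrite mulr0 addr0.
  have hs := @mxPrim_sum _ t t0 _ _ (index_enum 'I_m.+2) xpredT
    (fun k x => dyson k x *m bvp t A s (m.+1 - k) 0)
    (fun k x => (if nat_of_ord k is k'.+1 then A x *m dyson k' x else 0) *m bvp t A s (m.+1 -
      k) 0) h.
  apply: (mxPrim_eq t0 _ _ hs) => // y yt.
  rewrite big_ord_recl mul0mx add0r IH // mulmx_sumr; apply: eq_bigr => i _.
  by rewrite /= /bump add1n subSS mulmxA.
apply: (mxPrim_unique (bvp_prim t0 hA s m) dP) => //.
rewrite big_ord_recl mul1mx subn0 big1 ?addr0 // => i _.
by rewrite lift0 dysonS0 mul0mx.
Qed.

(* The right-hand side is the coefficient of 'X^(m+1) in (Y - 1) (1 + s (Y - 1))^-1. *)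
Lemma bvp_log_deriv s m :
  mx_integral D (fun x => A x *m bvp t A s m x) =
  \sum_(k < m.+1) (- s) ^+ k *: coefmx m.+1 ((E m.+1 t - 1) ^+ k.+1).
Proof.
have tt : 0 <= t <= t by rewrite lexx t0.
set W := E m.+1 t - 1.
have hW : ord_ge 1 W by apply: exp_trunc_sub1; exact: magnus_series_ord1.
pose C := trunc_series m.+1 (fun k => bvp t A s k 0).
have cW k : (k <= m.+1)%N -> coefmx k W = if k == 0%N then 0 else dyson k t.
  move=> km; rewrite coefmxB exp_magnus_dyson // coefmx1.
  by case: k km => [|k] km /=; rewrite ?subr0 ?subrr.
have cC k : (k <= m.+1)%N -> coefmx k C = bvp t A s k 0.
  by move=> km; rewrite coefmx_trunc_series km.
pose J k := mx_integral D (fun x => A x *m bvp t A s k x).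
have bt k : bvp t A s k.+1 t = J k - s *: J k by [].
have b0 k : bvp t A s k.+1 0 = - (s *: J k).
  rewrite [LHS]/= (mx_integral0 t0 (bvp_integrable t0 hA s k)) sub0r //.
(* [J k] is the increment of the iterate k+1 over [0, t], and [bvp_dyson] expands that increment as
   a coefficient of (Y - 1) C. *)
have cWC k : (k < m.+1)%N -> coefmx k.+1 (W * C) = J k.
  move=> km.
  have -> : J k = bvp t A s k.+1 t - bvp t A s k.+1 0 by rewrite bt b0 opprK subrK.
  rewrite (bvp_dyson s k.+1 tt) coefmxM [LHS]big_ord_recl [X in _ = X - _]big_ord_recl.
  rewrite [dyson _ _ *m _]mul1mx subn0 cW // mul0r add0r addrAC subrr add0r.
  apply: eq_bigr => i _; rewrite lift0; have ik : (i < k.+1)%N by exact: ltn_ord.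
  have im : (i.+1 <= m.+1)%N := leq_trans ik km.
  have kim : (k - i <= m.+1)%N := leq_trans (leq_subr i k) (ltnW km).
  by rewrite (cW _ im) subSS (cC _ kim).
(* The initial values - s J say that C = 1 - s W C, so C is the resolvent (1 + s W)^-1. *)
have hC : ord_ge m.+2 (C - (1 - s%:P *: (W * C))).
  apply: ord_geP => k; rewrite ltnS => km; apply/eqP; rewrite coefmxB subr_eq0; apply/eqP.
  rewrite cC // coefmxB coefmxZ coefmx1.
  case: k km => [|k] km.
    by rewrite coefmxM big_ord_recl big_ord0 cW // mul0r addr0 scaler0 subr0.
  by rewrite cWC // b0 sub0r.
rewrite -/(J m) -cWC // (ord_ge_eq (resolvent_trunc hW hC)) // coefmx_sum.
by apply: eq_bigr => k _; rewrite coefmxZ.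
Qed.

Lemma magnus_log m :
  magnus_term A m.+1 t =
  \sum_(k < m.+1) ((-1) ^+ k / k.+1%:R) *: coefmx m.+1 ((E m.+1 t - 1) ^+ k.+1).
Proof.
have h := log_exp_trunc m.+1 (magnus_series_ord1 m.+1 t).
have := ord_ge_eq h (ltnSn m.+1).
rewrite coefmx_trunc_series leqnn => <-; rewrite coefmx_sum.
by apply: eq_bigr => k _; rewrite coefmxZ.
Qed.

(** Takes the place of integration over s: a bound of the derivative that is uniform in s
    suffices. *)
Lemma poly_mean_value (p : P) (K : R) :
  (forall x, 0 <= x <= 1 -> `|(p^`()).[x]| <= K) -> `|p.[1] - p.[0]| <= K.
Proof.
move=> h.
have dp (x : R) : x \in `]0, 1[ -> is_derive x 1 (horner p) (p^`()).[x].
  by move=> _; exact: is_derive_poly.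
have cp : {within `[0, 1], continuous (horner p)}.
  apply: derivable_within_continuous => z _.
  by case: (is_derive_poly p z).
have [c c01 ->] := MVT_segment ler01 dp cp.
by rewrite subr0 mulr1; apply: h; move: c01; rewrite in_itv.
Qed.

Lemma magnus_decay (k : R) : 0 < k -> k * arclen (opnorm A) t < pi ->
  exists2 K, 0 <= K & forall m i j, `|magnus_term A m.+1 t i j| <= K * k^-1 ^+ m.
Proof.
move=> k0 kL; set L := arclen _ t in kL.
have L0 : 0 <= L by apply: indef_ge0 => // x _; exact: opnorm_ge0.
exists (L * (1 + expR (2 * k * L) ^+ 2) / 2).
  by rewrite divr_ge0 // mulr_ge0 // addr_ge0 // sqr_ge0.
move=> m i j.
pose c (l : nat) : R := coefmx m.+1 ((E m.+1 t - 1) ^+ l.+1) i j.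
(* As a polynomial in s, [p] is the entry (i, j) of the coefficient of degree m+1 in log(1 + s W), W
   = Y(t) - 1; its derivative is that of W (1 + s W)^-1. *)
pose p : P := \sum_(l < m.+1) ((-1) ^+ l / l.+1%:R * c l) *: 'X^(l.+1).
have p1 : magnus_term A m.+1 t i j = p.[1] - p.[0].
  rewrite magnus_log summxE /p !horner_sum -sumrB; apply: eq_bigr => l _.
  by rewrite !hornerZ !hornerXn expr1n mulr1 expr0n mulr0 subr0 mxE.
rewrite p1; apply: poly_mean_value => s s01.
have -> : (p^`()).[s] = mx_integral D (fun x => A x *m bvp t A s m x) i j.
  rewrite bvp_log_deriv summxE /p (big_morph _ (@derivD R) (@deriv0 R)) horner_sum.
  apply: eq_bigr => l _; rewrite derivZ derivXn hornerZ hornerMn hornerXn mxE -/(c l) /=.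
  have l0 : l.+1%:R != 0 :> R by rewrite pnatr_eq0.
  rewrite -[s ^+ l *+ l.+1]mulr_natr [(- s) ^+ l]exprNn; move: l0; move: (l.+1%:R) => y y0.
  by field.
exact: bvp_decay.
Qed.
End magnus_bound.

(** * Summation *)

Lemma cvgn_mx (R : realType) (m n : nat) (F : nat -> 'M[R]_(m, n)) (l : 'M[R]_(m, n)) :
  (forall i j, (fun k => F k i j) @ \oo --> l i j) -> F @ \oo --> l.
Proof.
move=> h; apply/cvg_ballP => e e0.
have hF i j : \forall k \near \oo, ball (l i j) e (F k i j).
  by have /cvg_ballP := h i j; apply.
near=> k; split => // i j; move: i j.
near: k; apply: filter_forall => i; apply: filter_forall => j; exact: hF.
Unshelve. all: by end_near. Qed.

Lemma limn_mx (R : realType) (n : nat) (F : nat -> 'M[R]_n.+1) (l : 'M[R]_n.+1) :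
  F @ \oo --> l -> limn F = l.
Proof. by move=> h; apply: cvg_lim h; exact: norm_hausdorff. Qed.

Lemma sum_exp_coeff_le (R : realType) (x : R) N : 0 <= x ->
  \sum_(k < N) x ^+ k / k`!%:R <= expR x.
Proof.
move=> x0.
have -> : \sum_(k < N) x ^+ k / k`!%:R = series (exp_coeff x) N.
  by rewrite /series /= big_mkord; apply: eq_bigr => k _.
apply: nondecreasing_cvgn_le; last exact: is_cvg_series_exp_coeff.
by apply: nondecreasing_series => k _ _; exact: exp_coeff_ge0.
Qed.

Section entry_sum_norm.
Variables (R : realType) (n : nat).
Implicit Types X Z : 'M[R]_n.+1.
Local Notation nrm := (@entry_sum R n.+1).

Lemma entry_sumD X Z : nrm (X + Z) <= nrm X + nrm Z.
Proof.
rewrite /entry_sum -big_split; apply: ler_sum => i _ /=.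
rewrite -big_split; apply: ler_sum => j _ /=; rewrite mxE; exact: ler_normD.
Qed.

Lemma entry_sumZ c X : nrm (c *: X) = `|c| * nrm X.
Proof.
rewrite /entry_sum mulr_sumr; apply: eq_bigr => i _.
by rewrite mulr_sumr; apply: eq_bigr => j _; rewrite mxE normrM.
Qed.

Lemma entry_sum0 : nrm 0 = 0.
Proof. by rewrite -(scale0r (0 : 'M[R]_n.+1)) entry_sumZ normr0 mul0r. Qed.

Lemma entry_sum_sum (I : Type) (r : seq I) (Q : pred I) (F : I -> 'M[R]_n.+1) :
  nrm (\sum_(i <- r | Q i) F i) <= \sum_(i <- r | Q i) nrm (F i).
Proof.
elim/big_rec2: _ => [|i y1 y2 _ h]; first by rewrite entry_sum0.
by apply: le_trans (entry_sumD _ _) _; rewrite lerD2l.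
Qed.

Lemma entry_sumM X Z : nrm (X * Z) <= nrm X * nrm Z.
Proof.
rewrite /entry_sum mulr_suml; apply: ler_sum => i _.
apply: le_trans (_ : \sum_j \sum_k `|X i k| * `|Z k j| <= _).
  apply: ler_sum => j _; rewrite mxE; apply: le_trans (ler_norm_sum _ _ _) _.
  by apply: ler_sum => k _; rewrite normrM.
rewrite exchange_big mulr_suml; apply: ler_sum => k _.
rewrite -mulr_sumr ler_wpM2l // [X in _ <= X](bigD1 k) //= lerDl.
by apply: sumr_ge0 => l _; apply: sumr_ge0.
Qed.

Lemma le_entry_sum X i j : `|X i j| <= nrm X.
Proof.
have h : `|X i j| <= \sum_l `|X i l| by rewrite [X in _ <= X](bigD1 j) //= lerDl sumr_ge0.
apply: le_trans h _; by rewrite /entry_sum [X in _ <= X](bigD1 i) //= lerDl sumr_ge0 // => k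
  _; exact: sumr_ge0.
Qed.

Lemma entry_sumX X k : nrm (X ^+ k) <= nrm 1 * nrm X ^+ k.
Proof.
elim: k => [|k IH]; first by rewrite !expr0 mulr1.
rewrite exprS [X in _ <= _ * X]exprS mulrCA; apply: le_trans (entry_sumM _ _) _.
by rewrite ler_wpM2l ?entry_sum_ge0.
Qed.

(** The crude (2 B)^k in place of k B^(k-1) keeps the induction short and still sums to an
    exponential. *)
Lemma entry_sum_power_diff X Z (B : R) k : 1 <= B -> nrm X <= B -> nrm Z <= B ->
  nrm (X ^+ k - Z ^+ k) <= nrm 1 * (2 * B) ^+ k * nrm (X - Z).
Proof.
move=> B1 XB ZB; have B0 : 0 <= B by rewrite (le_trans ler01).
have d0 := entry_sum_ge0 (1 : 'M[R]_n.+1); have e0 := entry_sum_ge0 (X - Z).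
elim: k => [|k IH]; first by rewrite !expr0 subrr entry_sum0 mulr1 mulr_ge0.
have -> : X ^+ k.+1 - Z ^+ k.+1 = X * (X ^+ k - Z ^+ k) + (X - Z) * Z ^+ k.
  by rewrite mulrBr mulrBl -!exprS addrA subrK.
apply: le_trans (entry_sumD _ _) _.
have h1 : nrm (X * (X ^+ k - Z ^+ k)) <= B * (nrm 1 * (2 * B) ^+ k * nrm (X - Z)).
  apply: le_trans (entry_sumM _ _) _.
  by rewrite ler_pM ?entry_sum_ge0.
have h2 : nrm ((X - Z) * Z ^+ k) <= B * (nrm 1 * (2 * B) ^+ k * nrm (X - Z)).
  apply: le_trans (entry_sumM _ _) _; rewrite mulrC mulrA ler_wpM2r //.
  apply: le_trans (entry_sumX _ _) _; rewrite mulrCA ler_wpM2l //.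
  apply: le_trans (_ : (2 * B) ^+ k <= _); last by rewrite ler_peMl // exprn_ge0 // mulr_ge0.
  apply: lerXn2r; rewrite ?nnegrE ?entry_sum_ge0 ?mulr_ge0 //.
  by apply: le_trans ZB _; rewrite ler_peMl // ler1n.
apply: le_trans (lerD h1 h2) _; rewrite [X in _ <= _ * X * _]exprS.
by rewrite le_eqVlt; apply/orP; left; apply/eqP; ring.
Qed.

Definition exp_partial N X : 'M[R]_n.+1 := \sum_(k < N) (k`!%:R^-1) *: X ^+ k.

(** The constant is independent of [N], so the order of truncation and the argument can move
    together. *)
Lemma exp_partial_lip N X Z (B : R) : 1 <= B -> nrm X <= B -> nrm Z <= B ->
  nrm (exp_partial N X - exp_partial N Z) <= nrm 1 * expR (2 * B) * nrm (X - Z).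
Proof.
move=> B1 XB ZB; have B0 : 0 <= B by rewrite (le_trans ler01).
rewrite /exp_partial -sumrB; apply: le_trans (entry_sum_sum _ _ _) _.
apply: le_trans (_ : nrm 1 * (\sum_(k < N) (2 * B) ^+ k / k`!%:R) * nrm (X - Z) <= _).
  have E (a d : R) : a * (\sum_(k < N) (2 * B) ^+ k / k`!%:R) * d =
      \sum_(k < N) a * ((2 * B) ^+ k / k`!%:R) * d by rewrite mulr_sumr mulr_suml.
  rewrite E; apply: ler_sum => k _.
  rewrite -scalerBr entry_sumZ ger0_norm ?invr_ge0 //.
  rewrite (_ : _ * (_ / _) * _ = k`!%:R^-1 * (nrm 1 * (2 * B) ^+ k * nrm (X - Z)));
    last by ring.
  by rewrite ler_wpM2l ?invr_ge0 // entry_sum_power_diff.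
by rewrite ler_wpM2r ?entry_sum_ge0 // ler_wpM2l ?entry_sum_ge0 // sum_exp_coeff_le // mulr_ge0.
Qed.
End entry_sum_norm.

(** * Weighted coefficient norms *)

Section coefficient_norm.
Variables (R : realType) (r : R).
Hypothesis r1 : 1 <= r.
Let r0 : 0 <= r. Proof. exact: le_trans ler01 r1. Qed.
Local Notation P := {poly R}.

Definition abs_poly (p : P) : P := \poly_(i < size p) `|p`_i|.

Lemma coef_abs_poly p k : (abs_poly p)`_k = `|p`_k|.
Proof.
rewrite coef_poly; case: ltnP => // h; by rewrite nth_default // normr0.
Qed.

Lemma horner_mono (p q : P) : (forall k, p`_k <= q`_k) -> p.[r] <= q.[r].
Proof.
move=> h; rewrite -subr_ge0 -hornerN -hornerD horner_coef; apply: sumr_ge0 => k _.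
by rewrite mulr_ge0 ?exprn_ge0 // coefB subr_ge0.
Qed.

(** The weighted l1 norm sum_k |p_k| r^k, which is submultiplicative. *)
Definition pnorm (p : P) : R := (abs_poly p).[r].

Lemma pnorm_ge0 p : 0 <= pnorm p.
Proof.
rewrite -(horner0 r); apply: horner_mono => k; rewrite coef0 coef_abs_poly //.
Qed.

Lemma pnormD p q : pnorm (p + q) <= pnorm p + pnorm q.
Proof.
rewrite /pnorm -hornerD; apply: horner_mono => k.
by rewrite coefD !coef_abs_poly coefD ler_normD.
Qed.

Lemma pnormM p q : pnorm (p * q) <= pnorm p * pnorm q.
Proof.
rewrite /pnorm -hornerM; apply: horner_mono => k.
rewrite coef_abs_poly !coefM; apply: le_trans (ler_norm_sum _ _ _) _.
by apply: ler_sum => l _; rewrite normrM !coef_abs_poly.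
Qed.

Lemma pnormC c : pnorm c%:P = `|c|.
Proof.
rewrite /pnorm (_ : abs_poly _ = `|c|%:P) ?hornerC //.
by apply/polyP => k; rewrite coef_abs_poly !coefC; case: ifP; rewrite ?normr0.
Qed.

Lemma pnormXn k : pnorm 'X^k = r ^+ k.
Proof.
rewrite /pnorm (_ : abs_poly _ = 'X^k) ?hornerXn //.
by apply/polyP => l; rewrite coef_abs_poly coefXn; case: eqP; rewrite ?normr0 ?normr1.
Qed.

Lemma horner1_le_pnorm p : `|p.[1]| <= pnorm p.
Proof.
rewrite /pnorm horner_poly horner_coef; apply: le_trans (ler_norm_sum _ _ _) _.
apply: ler_sum => k _; rewrite expr1n mulr1 ler_peMr // exprn_ege1 //.
Qed.

(** Coefficients of index at least [N] carry a weight of at least r^N in [pnorm]. *)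
Lemma pnorm_tail N (p : P) : r ^+ N * `|p.[1] - \sum_(k < N) p`_k| <= pnorm p.
Proof.
have h1 : \sum_(k < N) p`_k = (take_poly N p).[1].
  rewrite /take_poly horner_poly; apply: eq_bigr => k _.
  by rewrite expr1n mulr1.
have E := poly_take_drop N p.
have -> : p.[1] - \sum_(k < N) p`_k = (drop_poly N p).[1].
  by rewrite h1 -{1}E hornerD hornerM hornerXn expr1n mulr1 addrC addKr.
apply: le_trans (_ : r ^+ N * pnorm (drop_poly N p) <= _).
  by rewrite ler_wpM2l ?exprn_ge0 // horner1_le_pnorm.
rewrite mulrC /pnorm -hornerXn -hornerM; apply: horner_mono => k.
rewrite coefMXn !coef_abs_poly coef_drop_poly; case: ltnP => kN //.
by rewrite subnK.
Qed.
End coefficient_norm.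

Section series_norm.
Variables (R : realType) (n : nat) (r : R).
Hypothesis r1 : 1 <= r.
Local Notation P := {poly R}.
Local Notation V := 'M[P]_n.+1.
Implicit Types U W : V.

Definition mnorm U : R := \sum_i \sum_j pnorm r (U i j).

Lemma mnorm_ge0 U : 0 <= mnorm U.
Proof. by apply: sumr_ge0 => i _; apply: sumr_ge0 => j _; exact: pnorm_ge0. Qed.

Lemma mnormD U W : mnorm (U + W) <= mnorm U + mnorm W.
Proof.
rewrite /mnorm -big_split; apply: ler_sum => i _ /=.
by rewrite -big_split; apply: ler_sum => j _ /=; rewrite mxE; apply: pnormD.
Qed.

Lemma mnorm0 : mnorm 0 = 0.
Proof.
rewrite /mnorm big1 // => i _; rewrite big1 // => j _.
by rewrite mxE -polyC0 pnormC normr0.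
Qed.

Lemma mnorm_sum (I : Type) (s : seq I) (Q : pred I) (F : I -> V) :
  mnorm (\sum_(i <- s | Q i) F i) <= \sum_(i <- s | Q i) mnorm (F i).
Proof.
elim/big_rec2: _ => [|i y1 y2 _ h]; first by rewrite mnorm0.
by apply: le_trans (mnormD _ _) _; rewrite lerD2l.
Qed.

Lemma pnorm_sum (I : Type) (s : seq I) (F : I -> P) :
  pnorm r (\sum_(i <- s) F i) <= \sum_(i <- s) pnorm r (F i).
Proof.
elim/big_rec2: _ => [|i y1 y2 _ h]; first by rewrite -polyC0 pnormC normr0.
by apply: le_trans (pnormD r1 _ _) _; rewrite lerD2l.
Qed.

Lemma mnormZ p U : mnorm (p *: U) <= pnorm r p * mnorm U.
Proof.
rewrite /mnorm mulr_sumr; apply: ler_sum => i _; rewrite mulr_sumr.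
by apply: ler_sum => j _; rewrite mxE; apply: pnormM.
Qed.

Lemma mnormM U W : mnorm (U * W) <= mnorm U * mnorm W.
Proof.
rewrite /mnorm mulr_suml; apply: ler_sum => i _.
apply: le_trans (_ : \sum_j \sum_k pnorm r (U i k) * pnorm r (W k j) <= _).
  apply: ler_sum => j _; rewrite mxE; apply: le_trans (pnorm_sum _ _) _.
  by apply: ler_sum => k _; apply: pnormM.
rewrite exchange_big mulr_suml; apply: ler_sum => k _.
rewrite -mulr_sumr ler_wpM2l ?pnorm_ge0 // [X in _ <= X](bigD1 k) //= lerDl.
by apply: sumr_ge0 => l _; apply: sumr_ge0 => ? _; exact: pnorm_ge0.
Qed.

Lemma mnormX U k : mnorm (U ^+ k) <= mnorm 1 * mnorm U ^+ k.
Proof.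
elim: k => [|k IH]; first by rewrite !expr0 mulr1.
rewrite exprS [X in _ <= _ * X]exprS mulrCA; apply: le_trans (mnormM _ _) _.
by rewrite ler_wpM2l ?mnorm_ge0.
Qed.

Lemma mnorm_exp N U : mnorm (exp_trunc N U) <= mnorm 1 * expR (mnorm U).
Proof.
apply: le_trans (mnorm_sum _ _ _) _.
apply: le_trans (_ : mnorm 1 * (\sum_(k < N.+1) mnorm U ^+ k / k`!%:R) <= _); last first.
  by rewrite ler_wpM2l ?mnorm_ge0 // sum_exp_coeff_le // mnorm_ge0.
have E (a : R) : a * (\sum_(k < N.+1) mnorm U ^+ k / k`!%:R) =
   \sum_(k < N.+1) a * (mnorm U ^+ k / k`!%:R) by rewrite mulr_sumr.
rewrite E; apply: ler_sum => k _; apply: le_trans (mnormZ _ _) _.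
rewrite pnormC ger0_norm ?invr_ge0 // mulrA [X in _ <= X]mulrC ler_wpM2l ?invr_ge0 //.
exact: mnormX.
Qed.

Lemma mnorm_const (M : 'M[R]_n.+1) : mnorm (constmx M) = entry_sum M.
Proof.
by apply: eq_bigr => i _; apply: eq_bigr => j _; rewrite mxE pnormC.
Qed.

Lemma mnorm_trunc_series N (F : nat -> 'M[R]_n.+1) :
  mnorm (trunc_series N F) <= \sum_(k < N.+1) r ^+ k * entry_sum (F k).
Proof.
apply: le_trans (mnorm_sum _ _ _) _; apply: ler_sum => k _.
by apply: le_trans (mnormZ _ _) _; rewrite pnormXn mnorm_const.
Qed.

Lemma pnorm_le_mnorm U i j : pnorm r (U i j) <= mnorm U.
Proof.
have h : pnorm r (U i j) <= \sum_l pnorm r (U i l).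
  by rewrite [X in _ <= X](bigD1 j) //= lerDl sumr_ge0 // => k _; exact: pnorm_ge0.
apply: le_trans h _; rewrite /mnorm [X in _ <= X](bigD1 i) //= lerDl.
by apply: sumr_ge0 => k _; apply: sumr_ge0 => l _; exact: pnorm_ge0.
Qed.

Definition eval1 U : 'M[R]_n.+1 := map_mx (horner_eval 1) U.

Lemma eval1X U k : eval1 (U ^+ k) = eval1 U ^+ k.
Proof.
elim: k => [|k IH]; first by rewrite !expr0 /eval1 map_mx1.
by rewrite !exprS -IH; exact: map_mxM.
Qed.

Lemma eval1E U i j : eval1 U i j = (U i j).[1].
Proof. by rewrite mxE. Qed.

Lemma eval1_exp N U : eval1 (exp_trunc N U) = exp_partial N.+1 (eval1 U).
Proof.
apply/matrixP => i j; rewrite eval1E !summxE horner_sum; apply: eq_bigr => k _.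
by rewrite mxE hornerM hornerC [RHS]mxE -eval1X eval1E.
Qed.

Lemma eval1_trunc_series N F : eval1 (trunc_series N F) = \sum_(k < N.+1) F k.
Proof.
apply/matrixP => i j; rewrite eval1E !summxE horner_sum; apply: eq_bigr => k _.
by rewrite 2!mxE hornerM hornerXn hornerC expr1n mul1r.
Qed.

(** The exponential of a truncated Magnus series has terms of much higher degree than the
    truncation; for r > 1 this makes their total at 'X = 1 small. *)
Lemma eval1_tail N U i j :
  r ^+ N * `|eval1 U i j - (\sum_(k < N) coefmx k U) i j| <= mnorm U.
Proof.
apply: le_trans (pnorm_le_mnorm U i j).
rewrite mxE /horner_eval summxE.
rewrite (_ : \sum_(k < N) _ = \sum_(k < N) (U i j)`_k); first exact: pnorm_tail.
by apply: eq_bigr => k _; rewrite mxE.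
Qed.
End series_norm.

(** * Convergence of the Picard series *)

Section picard.
Variables (R : realType) (t : R).
Hypothesis t0 : 0 <= t.
Local Notation D := (`[0, t]%classic).
Variable n : nat.
Local Notation M := 'M[R]_n.+1.
Let mD := @lmeasurable_itv R `[0, t].
Variables A Y : R -> M.
Hypothesis hA : mx_integrable D A.
Hypothesis hY : caratheodory_solution t A Y.

Lemma prim_pow (F f : R -> R) m : Prim t F f ->
  Prim t (fun x => F x ^+ m.+1 / m.+1`!%:R) (fun x => F x ^+ m / m`!%:R * f x).
Proof.
move=> hF.
have h : Prim t (fun x => F x ^+ m.+1) (fun x => m.+1%:R * F x ^+ m * f x).
  elim: m => [|m IH]; first by apply: (prim_eq t0 _ _ hF) => s _;
    rewrite ?expr1 ?expr0 ?mul1r ?mulr1.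
  apply: (prim_eq t0 _ _ (primM t0 hF IH)) => s _; first by rewrite -exprS.
  by rewrite -(natr1 m.+1) [F s ^+ m.+1]exprS; ring.
have k0 : m.+1%:R != 0 :> R by rewrite pnatr_eq0.
have f0 : m`!%:R != 0 :> R by rewrite pnatr_eq0 -lt0n fact_gt0.
apply: (prim_eq t0 _ _ (primZ (m.+1`!%:R^-1) h)) => s _; first by rewrite mulrC.
rewrite factS natrM; move: k0 f0; move: (m.+1%:R) (m`!%:R) => x y x0 y0.
by field; rewrite x0 y0.
Qed.

Lemma solution_prim : mxPrim t Y (fun x => A x *m Y x).
Proof.
have [hI hE] := hY.
apply: (mxPrim_eq t0 _ _ (mxPrimD t0 (mxPrim_cst t0 1%:M) (mx_integral_prim t0 hI))) => s st.
  by rewrite (hE s st).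
by rewrite add0r.
Qed.

Lemma solution0 : Y 0 = 1%:M.
Proof.
have [hI hE] := hY; rewrite (hE 0) ?lexx ?t0 //.
by rewrite (mx_integral0 t0 hI) addr0.
Qed.

Let Z m x := Y x - \sum_(k < m) dyson A k x.

Lemma remainder_prim m : mxPrim t (Z m.+1) (fun x => A x *m Z m x).
Proof.
have h (k : 'I_m) : true -> mxPrim t (dyson A k.+1) (fun x => A x *m dyson A k x).
  by move=> _; exact: dyson_prim.
have hs := mxPrim_sum t0 (index_enum 'I_m) h.
have := mxPrimD t0 solution_prim (mxPrimD t0 (mxPrim_cst t0 (-1)) (mxPrimZ t0 (-1) hs)).
apply: (mxPrim_eq t0) => s _.
  rewrite /Z big_ord_recl scaleN1r opprD //=.
rewrite /Z mulmxBr add0r scaleN1r; congr (_ - _).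
by rewrite mulmx_sumr.
Qed.

(** The remainder of index m+1 is the primitive of [A] times the one of index m, starting from [Y],
    which is bounded by [B]. The factorial makes the choice of norm immaterial, so the
    submultiplicative [entry_sum] is used. *)
Lemma picard_bound : exists2 B, 0 <= B & forall m s, 0 <= s <= t ->
  entry_sum (Y s - \sum_(k < m) dyson A k s) <=
  B * (indef (fun x => entry_sum (A x)) s ^+ m / m`!%:R).
Proof.
have bY := mxPrim_bm t0 solution_prim.
pose w x := entry_sum (A x).
have hw : L1 D w.
  by apply: (L1_sum mD) => i _; apply: (L1_sum mD) => j _; apply: L1_abs; apply: hA.
have bnrm (F : R -> M) : mxbm t F -> bmfun D (fun x => entry_sum (F x)).
  move=> hF; apply: bm_sum => i _; apply: bm_sum => j _.
  have [mF [C hC]] := hF i j; split; first exact: lmfun_norm.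
  by exists C => x Dx; rewrite normr_id hC.
have [_ [B hB]] := bnrm Y bY.
have D0 : D 0 by rewrite /= in_itv /= lexx t0.
have B0 : 0 <= B := le_trans (normr_ge0 _) (hB 0 D0).
exists B => // m; elim: m => [|m IH] s st.
  rewrite big_ord0 subr0 expr0 fact0 divr1 mulr1.
  by apply: le_trans (hB s _); [exact: ler_norm|rewrite /= in_itv].
rewrite -/(Z m.+1 s).
have hZ := remainder_prim m.
have Zm : mxbm t (Z m).
  case: m {IH hZ} => [|m]; last exact: (mxPrim_bm t0 (remainder_prim m)).
  by move=> i j; apply: bm_eq (bY i j) => x _; rewrite /Z big_ord0 subr0.
have Z0 : Z m.+1 0 = 0.
  rewrite /Z solution0 big_ord_recl [dyson A ord0 0]/= big1 ?addr0 ?subrr // => k _.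
  by rewrite lift0 (dysonS0 t0 hA).
have ZE i j : Z m.+1 s i j = indef (fun x => (A x *m Z m x) i j) s.
  by rewrite (primE (hZ i j) st) Z0 mxE add0r.
have hI i j : L1 D (fun x => (A x *m Z m x) i j) := primL (hZ i j).
have hLw : L1 D (fun x => entry_sum (A x *m Z m x)).
  by apply: (L1_sum mD) => i _; apply: (L1_sum mD) => j _; apply: L1_abs; apply: hI.
have pth : Prim t (indef w) w := indef_prim t0 hw.
have ppow := prim_pow m pth.
apply: le_trans (_ : indef (fun x => entry_sum (A x *m Z m x)) s <= _).
  rewrite (indef_sum _ _ st); last first.
    by move=> i _; apply: (L1_sum mD) => j _; apply: L1_abs; apply: hI.
  apply: ler_sum => i _; rewrite (indef_sum _ _ st); last by move=> j _; apply: L1_abs;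
    apply: hI.
  apply: ler_sum => j _; rewrite ZE.
  have /andP[s0 s1] := st.
  have := norm_indefB (hI i j) (lexx 0) s0 s1.
  by rewrite !(indef0 t0) ?subr0 //; apply: L1_abs; apply: hI.
have LP : L1 D (fun x => indef w x ^+ m / m`!%:R * w x) := primL ppow.
have := primE ppow st; rewrite (indef0 t0 hw) expr0n mul0r add0r => ->.
rewrite -(indefZ B LP st); apply: (le_indef t0) => //; first exact: (L1Z mD B LP).
move=> x /andP[x0 xs]; have xt : 0 <= x <= t by rewrite x0 (le_trans xs) //; case/andP: st.
apply: le_trans (entry_sumM _ _) _; rewrite mulrC mulrA ler_wpM2r ?entry_sum_ge0 //.
exact: IH.
Qed.
End picard.

Section geometric_terms.
Variables (R : realType) (n : nat) (a : nat -> 'M[R]_n.+1) (K q : R).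
Hypotheses (K0 : 0 <= K) (q0 : 0 <= q) (q1 : q < 1).
Hypothesis ha : forall m i j, `|a m i j| <= K * q ^+ m.

Lemma geometric_series_cvg i j : cvgn (series (fun m => a m i j)).
Proof.
apply: normed_cvg; apply: (@series_le_cvg _ _ (geometric K q)).
- by move=> m; exact: normr_ge0.
- by move=> m; rewrite /geometric /= mulr_ge0 ?exprn_ge0.
- by move=> m; exact: ha.
- by apply: is_cvg_geometric_series; rewrite ger0_norm.
Qed.

Lemma series_mx_entry N i j : series a N i j = series (fun m => a m i j) N.
Proof. by rewrite /series /= summxE. Qed.

Lemma geometric_series_mx_cvg : exists S, series a @ \oo --> (S : 'M[R]_n.+1).
Proof.
exists (\matrix_(i, j) limn (series (fun m => a m i j))).
apply: cvgn_mx => i j; rewrite mxE.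
under eq_fun do rewrite series_mx_entry.
exact: geometric_series_cvg.
Qed.

Lemma entry_sum_geometric m : entry_sum (a m) <= n.+1%:R * (n.+1%:R * (K * q ^+ m)).
Proof.
rewrite /entry_sum; apply: le_trans (_ : \sum_(i < n.+1) \sum_(j < n.+1) K * q ^+ m <= _).
  by apply: ler_sum => i _; apply: ler_sum => j _.
by rewrite !sumr_const !card_ord !mulr_natl.
Qed.

Lemma sum_geometric_le (x : R) N : 0 <= x -> x < 1 -> \sum_(k < N) x ^+ k <= (1 - x)^-1.
Proof.
move=> x0 x1; have d : 0 < 1 - x by rewrite subr_gt0.
rewrite -[X in _ <= X]mul1r ler_pdivlMr // mulrC -opprB mulNr -subrX1 opprB.
by rewrite gerBl exprn_ge0.
Qed.
End geometric_terms.

Lemma cvgn_mx_entry (R : realType) (n : nat) (F : nat -> 'M[R]_n.+1) (l : 'M[R]_n.+1) i j :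
  F @ \oo --> l -> (fun k => F k i j) @ \oo --> l i j.
Proof.
move=> h; apply/cvg_ballP => e e0; have /cvg_ballP/(_ e e0) := h.
by apply: filterS => k [_]; apply.
Qed.

Theorem theorem3 (R : realType) (d : nat) (hd : (1 <= d)%N) (t : R) (ht : 0 <= t)
    (A : R -> 'M[R]_d) (hA : mx_integrable `[0, t] A)
    (Y : R -> 'M[R]_d) (hY : caratheodory_solution t A Y)
    (hpi : (\int[@completed_lebesgue_measure R]_(x in `[0%R, t])
              (spectral_norm (A x))%:E < (pi : R)%:E)%E) :
  let Sigma := series (fun n => magnus_term A n.+1 t) in
  cvgn Sigma /\ expmx (limn Sigma) = Y t.
Proof.
case: d hd A hA Y hY hpi => // n _ A hA Y hY hpi Sigma.
have tt : 0 <= t <= t by rewrite ht lexx.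
set L := arclen (opnorm A) t.
have L0 : 0 <= L by apply: indef_ge0 => // x _; exact: opnorm_ge0.
have Lpi : L < pi.
  rewrite -lte_fin; apply: le_lt_trans hpi; rewrite /L /arclen /indef /Rintegral fineK //.
  have hi := opnorm_L1 hA; apply: integrable_fin_num hi; exact: lmeasurable_itv.
have pi0 := pi_gt0 R.
(* A value with 1 < k and k L < pi; both inequalities amount to L < pi. *)
pose k : R := 2 * pi / (pi + L).
have pL : 0 < pi + L by rewrite ltr_wpDr.
have k1 : 1 < k by rewrite /k ltr_pdivlMr // mul1r; lra.
have k0 : 0 < k := lt_trans ltr01 k1.
have kL : k * L < pi.
  rewrite /k mulrAC ltr_pdivrMr //; rewrite -subr_gt0.
  rewrite (_ : _ - _ = pi * (pi - L)); last by ring.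
  by rewrite mulr_gt0 // subr_gt0.
have [K K0 hK] := magnus_decay ht hA k0 kL.
have q0 : 0 <= k^-1 by rewrite invr_ge0 ltW.
have q1 : k^-1 < 1 by rewrite invf_lt1.
have [S hS] := geometric_series_mx_cvg K0 q0 q1 hK.
split; first by apply: cvgP hS.
rewrite (limn_mx hS).
(* Strictly between 1 and k: below k, so that the Magnus series is summable with weights r^n, and
   above 1, so that tails decay like r^-N. *)
pose r : R := (1 + k) / 2.
have r1 : 1 < r by rewrite /r; lra.
have rk : r < k by rewrite /r; lra.
have r0 : 0 < r := lt_trans ltr01 r1.
(* The sum of the geometric majorant. The leading [r] appears because the term of degree m+1 is
   bounded by a multiple of k^-m. *)
pose Q : R := r * (n.+1%:R * (n.+1%:R * K)) * (1 - r / k)^-1.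
have rk0 : 0 <= r / k by apply: divr_ge0; apply: ltW.
have rk1 : r / k < 1 by rewrite ltr_pdivrMr // mul1r.
have K1 : 0 <= r * (n.+1%:R * (n.+1%:R * K)).
  by apply: mulr_ge0; [exact: ltW|rewrite !mulr_ge0].
have Q0 : 0 <= Q by apply: mulr_ge0 => //; rewrite invr_ge0 subr_ge0 ltW.
have hQ N : \sum_(m < N.+1) r ^+ m * entry_sum (magnus_term A m t) <= Q.
  rewrite big_ord_recl [entry_sum _](_ : _ = 0) ?mulr0 ?add0r; last exact: entry_sum0.
  apply: le_trans (_ : r * (n.+1%:R * (n.+1%:R * K)) * \sum_(m < N) (r / k) ^+ m <= _);
    last first.
    by rewrite ler_wpM2l ?sum_geometric_le.
  rewrite mulr_sumr; apply: ler_sum => m _; rewrite lift0.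
  apply: le_trans (ler_wpM2l (exprn_ge0 m.+1 (ltW r0)) (entry_sum_geometric hK m)) _.
  rewrite [r ^+ m.+1]exprS [(r / k) ^+ m]exprMn; move: (k^-1 ^+ m) => z.
  by rewrite le_eqVlt; apply/orP; left; apply/eqP; ring.
(* [Sigma N] sums the degrees 1 to N; the truncated series also has degree 0, where the term is
   0. *)
have SigmaE N : Sigma N = eval1 (magnus_series A N t).
  rewrite eval1_trunc_series big_ord_recl [magnus_term A ord0 t]/= add0r.
  by rewrite /Sigma /series /= big_mkord; apply: eq_bigr => m _.
have hSigma N : entry_sum (Sigma N) <= Q.
  apply: le_trans (hQ N); rewrite SigmaE eval1_trunc_series.
  apply: le_trans (entry_sum_sum _ _ _) _; apply: ler_sum => m _.
  by rewrite ler_peMl ?entry_sum_ge0 // exprn_ege1 // ltW.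
have [B B0 hB] := picard_bound ht hA hY.
(* A common bound, at least 1, for the limit and for all partial sums, as [exp_partial_lip]
   requires. *)
pose C := 1 + Q + entry_sum S.
have SC : entry_sum S <= C by rewrite /C lerDr addr_ge0.
have QC : Q <= C by rewrite /C addrAC lerDr addr_ge0 ?entry_sum_ge0.
have C1 : 1 <= C by rewrite /C -addrA lerDl addr_ge0 ?entry_sum_ge0.
pose th := indef (fun x => entry_sum (A x)) t.
(* Three errors: replacing the limit by a partial sum, discarding the degrees above N in its
   exponential, and the Picard remainder. *)
pose e1 N := entry_sum (1 : 'M[R]_n.+1) * expR (2 * C) * entry_sum (S - Sigma N).
pose e2 N := r^-1 ^+ N.+1 * (mnorm r (1 : 'M[{poly R}]_n.+1) * expR Q).
pose e3 N := B * (th ^+ N.+1 / N.+1`!%:R).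
have bound N i j : `|exp_partial N.+1 S i j - Y t i j| <= e1 N + e2 N + e3 N.
  pose E := exp_trunc N (magnus_series A N t).
  have b1 : `|(exp_partial N.+1 S - exp_partial N.+1 (Sigma N)) i j| <= e1 N.
    apply: le_trans (le_entry_sum _ i j) _; apply: exp_partial_lip => //.
    exact: le_trans (hSigma N) QC.
  have b2 : `|exp_partial N.+1 (Sigma N) i j - (\sum_(m < N.+1) dyson A m t) i j| <= e2 N.
    rewrite SigmaE -eval1_exp -/E.
    have -> : \sum_(m < N.+1) dyson A m t = \sum_(m < N.+1) coefmx m E.
      by apply: eq_bigr => m _; rewrite (exp_magnus_dyson ht hA) // -ltnS.
    rewrite /e2 exprVn ler_pdivlMl ?exprn_gt0 //.
    apply: le_trans (eval1_tail (ltW r1) N.+1 E i j) _.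
    apply: le_trans (mnorm_exp (ltW r1) N _) _; rewrite ler_wpM2l ?mnorm_ge0 // ?(ltW r1) //.
    rewrite ler_expR; apply: le_trans (mnorm_trunc_series (ltW r1) _ _) (hQ N).
  have b3 : `|(Y t - \sum_(m < N.+1) dyson A m t) i j| <= e3 N.
    exact: le_trans (le_entry_sum _ i j) (hB _ _ tt).
  have split4 (X1 X2 X3 X4 : 'M[R]_n.+1) :
    X1 i j - X4 i j = (X1 - X2) i j + (X2 i j - X3 i j) - (X4 - X3) i j.
    by rewrite !mxE; ring.
  rewrite (split4 _ (exp_partial N.+1 (Sigma N)) (\sum_(m < N.+1) dyson A m t)).
  apply: le_trans (ler_normB _ _) _; apply: lerD b3.
  by apply: le_trans (ler_normD _ _) _; apply: lerD.
have c1 : e1 @ \oo --> 0.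
  rewrite -(mulr0 (entry_sum (1 : 'M[R]_n.+1) * expR (2 * C))).
  apply: cvgM; first exact: cvg_cst.
  rewrite /entry_sum.
  have h i j : (fun N => `|(S - Sigma N) i j|) @ \oo --> (0 : R).
    under eq_fun do rewrite !mxE.
    rewrite -(normr0 R) -(subrr (S i j)); apply: cvg_norm; apply: cvgB; first exact: cvg_cst.
    exact: cvgn_mx_entry hS.
  have := @cvgn_sum _ _ (index_enum 'I_n.+1) _ _ (fun i => @cvgn_sum _ _ (index_enum 'I_n.+1)
    _ _ (h i)).
  by rewrite big1 // => i _; rewrite big1.
have c2 : e2 @ \oo --> 0.
  rewrite -(mul0r (mnorm r (1 : 'M[{poly R}]_n.+1) * expR Q)); apply: cvgM; last exact: cvg_cst.
  have h : (fun N => r^-1 ^+ N) @ \oo --> (0 : R).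
    by apply: cvg_expr; rewrite ger0_norm ?invr_ge0 ?(ltW r0) // invf_lt1.
  by rewrite -cvg_shiftS in h; exact: h.
have c3 : e3 @ \oo --> 0.
  rewrite -(mulr0 B); apply: cvgM; first exact: cvg_cst.
  have h := cvg_exp_coeff th.
  by rewrite -cvg_shiftS in h; exact: h.
apply: limn_mx; apply: cvgn_mx => i j.
rewrite (_ : (fun m => _) = (fun m => exp_partial m S i j)); last first.
  by apply/funext => m; rewrite /series /= big_mkord.
(* [exp_partial N.+1] is the truncation at degree N, so the bounds apply to the shifted sequence. *)
rewrite -cvg_shiftS.
have ce : (fun N => e1 N + e2 N + e3 N) @ \oo --> (0 : R).
  by rewrite -(addr0 0) -[X in X + 0](addr0 0); apply: cvgD => //; apply: cvgD.
apply: cvg_zero.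
apply: norm_cvg0; apply: squeeze_cvgr ce => //; last exact: cvg_cst.
by near=> N; rewrite normr_ge0 bound.
Unshelve. all: by end_near. Qed.
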